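(* Let $d\in\{1,2,3\}$. Consider the $P^1$ finite element method with vertex quadrature on a family of unstructured simplicial meshes of $\Omega$ that is shape regular (with a constant $\sigma$ independent of $h$) and satisfies the monotonicity mesh constraint. Let $u^*$ and $\lambda^*$ be the (positive) ground state and the corresponding eigenvalue of the continuous energy $E$, and let $u_h^*$ and $\lambda_h^*$ be the (positive) ground state and the corresponding eigenvalue of the discrete energy $E_h$. Suppose that $u^*\in H^2(\Omega)\cap H_0^1(\Omega)$ and that $V\in C^1(\bar\Omega)$. Then $u_h^*\to u^*$ in $H_0^1(\Omega)$ and $\lambda_h^*\to\lambda^*$ as $h\to0$.
   Context: Let $L>0$, $\Omega=[-L,L]^d$, $\beta>0$, $V:\Omega\to\mathbb R$ with $V\ge c>0$ for a constant $c$. Continuous problem. $E(\phi)=\frac12\int_\Omega(|\nabla\phi|^2+V|\phi|^2)\,d\mathbf x+\frac\beta4\int_\Omega|\phi|^4\,d\mathbf x$ on $\{\phi\in H_0^1(\Omega):\int_\Omega|\phi|^2=1\}$. It has a unique positive minimizer $u^*$ (the ground state), and $\lambda^*$ is the number such that $-\Delta u^*+Vu^*+\beta|u^*|^2u^*=\lambda^*u^*$ weakly in $H_0^1(\Omega)$. Discrete problem. $\Omega_h$ is a conforming simplicial mesh of $\Omega$, $h_K$ is the size (diameter) of a simplex $K$, $h=\sup_Kh_K$. $V_0^h$ is the space of continuous functions vanishing on $\partial\Omega$ that are affine on each simplex. $\langle f,g\rangle$ denotes $\int_\Omega fg$ (or $\int_\Omega f\cdot g$) computed with the quadrature $\int_Kf\approx\frac{|K|}{d+1}\sum_{\mathbf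 x_i\text{ vertex of }K}f(\mathbf x_i)$ on each simplex. $\mathbf x_1,\dots,\mathbf x_N$ are the interior vertices, $\phi_i$ the nodal basis, $w_i$ the total quadrature weight at $\mathbf x_i$; $\mathbf u\in\mathbb R^N$ is identified with $u_h=\Pi\mathbf u=\sum_iu_i\phi_i$. $\mathbb M=\mathrm{diag}(w_i)$, $\mathbb S_{ij}=\langle\nabla\phi_i,\nabla\phi_j\rangle$, $\mathbb V=\mathrm{diag}(V(\mathbf x_i))$, $\Delta_h=-\mathbb M^{-1}\mathbb S$. The discrete energy is $E_h(u_h)=\frac12\langle\nabla u_h,\nabla u_h\rangle+\frac12\langle Vu_h,u_h\rangle+\frac\beta4\langle u_h^2,u_h^2\rangle$ on $\{u_h\in V_0^h:\langle u_h,u_h\rangle=1\}$. The discrete ground state $u_h^*$ is the minimizer that is positive at all interior vertices, $\mathbf u^*$ is its vector of nodal values, and $\lambda_h^*$ is the number with $-\Delta_h\mathbf u^*+\mathbb V\mathbf u^*+\beta(\mathbf u^* )^3=\lambda_h^*\mathbf u^*$ (powers entrywise). The matrices $-\Delta_h+\mathbb V+\beta\,\mathrm{diag}(\mathbf u^2)$ are irreducible. Shape regularity: there is $\sigma>0$ independent of $h$ with $h_K/\rho_K\le\sigma$ for all simplices $K$, where $\rho_K$ is the diameter of the largest ball contained in $K$. Monotonicity mesh constraint (for $d\ge2$; void for $d=1$): for each edge $E$ of the mesh, $\sum_{T\supset E}\frac1{d(d-1)}|\kappa_E^T|\cot\theta_E^T\ge0$, the sum being over simplices $T$ containing $E$,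 where $\kappa_E^T$ is the $(d-2)$-dimensional face of $T$ opposite to $E$ (with $|\kappa_E^T|=1$ if $d=2$) and $\theta_E^T$ is the dihedral angle of $T$ at $\kappa_E^T$, i.e. between the two $(d-1)$-dimensional faces of $T$ opposite to the two endpoints of $E$. *)

(* Defs.v *)
From HB Require Import structures.
From mathcomp Require Import all_boot all_order all_algebra.
From mathcomp Require Import all_classical all_reals all_analysis.
Set Implicit Arguments.
Unset Strict Implicit.
Unset Printing Implicit Defensive.
Import Order.TTheory GRing.Theory Num.Theory.
Import numFieldNormedType.Exports.
Local Open Scope classical_set_scope.
Local Open Scope ring_scope.

Section measurable_rV.
Context {disp : measure_display} {T : measurableType disp}.
Variable n : nat.

Let coord : 'I_n -> 'rV[T]_n -> T := fun i x => x ord0 i.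

Let rV_set0 : g_sigma_preimage coord set0.
Proof. exact: sigma_algebra0. Qed.

Let rV_setC A : g_sigma_preimage coord A -> g_sigma_preimage coord (~` A).
Proof. exact: sigma_algebraC. Qed.

Let rV_bigcup (F : _^nat) : (forall i, g_sigma_preimage coord (F i)) ->
  g_sigma_preimage coord (\bigcup_i (F i)).
Proof. exact: sigma_algebra_bigcup. Qed.

HB.instance Definition _ := @isMeasurable.Build (measure_tuple_display disp)
  'rV[T]_n (g_sigma_preimage coord) rV_set0 rV_setC rV_bigcup.

Lemma measurable_coord (i : 'I_n) :
  measurable_fun [set: 'rV[T]_n] (fun x : 'rV[T]_n => x ord0 i).
Proof.
move=> _ Y mY; rewrite setTI; apply: sub_sigma_algebra => /=.
rewrite -bigcup_seq/=; exists i => /=; first by rewrite mem_index_enum.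
by exists Y => //; rewrite setTI.
Qed.

End measurable_rV.

Lemma measurable_fun_rV d1 d2 (T1 : measurableType d1) (T2 : measurableType d2)
    n (f : T1 -> 'rV[T2]_n) :
  (forall i, measurable_fun [set: T1] (fun x => f x ord0 i)) ->
  measurable_fun [set: T1] f.
Proof.
move=> mf _ A mA; rewrite setTI.
pose C := fun i (x : 'rV[T2]_n) => x ord0 i.
suff: (measurable : set (set 'rV[T2]_n)) `<=` [set B | measurable (f @^-1` B)].
  by apply.
apply: smallest_sub.
  split=> /=.
  - by rewrite preimage_set0.
  - by move=> B mB; rewrite setTD preimage_setC; exact: measurableC.
  - by move=> F mF; rewrite preimage_bigcup; exact: bigcup_measurable.
rewrite -bigcup_seq => B /= [i _ [Y mY <-]] /=.
by rewrite setTI -comp_preimage -[X in measurable X]setTI; exact: (mf i).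
Qed.

Section lebesgue_rV.
Context {R : realType}.

Definition vcons n (p : R * 'rV[R]_n) :
  'rV[R]_n.+1 :=
  \row_i (if unlift ord0 i is Some j then p.2 ord0 j else p.1).

Definition vuncons n (x : 'rV[R]_n.+1) :
  R * 'rV[R]_n :=
  (x ord0 ord0, \row_j x ord0 (lift ord0 j)).

Lemma vconsK n : cancel (@vcons n) (@vuncons n).
Proof.
case=> a v; rewrite /vuncons; congr (_, _).
  by rewrite mxE unlift_none.
by apply/rowP => j; rewrite !mxE liftK.
Qed.

Lemma measurable_vcons n : measurable_fun setT (@vcons n).
Proof.
apply: measurable_fun_rV => i.
case: (unliftP ord0 i) => [j ->|->].
  rewrite (_ : (fun _ => _) = (fun v : 'rV[R]_n => v ord0 j) \o snd).
    by apply: measurableT_comp => //; exact: measurable_coord.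
  by apply/funext => p /=; rewrite mxE liftK.
rewrite (_ : (fun _ => _) = fst)//.
by apply/funext => p /=; rewrite mxE unlift_none.
Qed.

Lemma measurable_vuncons n : measurable_fun setT (@vuncons n).
Proof.
apply: measurable_fun_pair; first exact: measurable_coord.
apply: measurable_fun_rV => j /=.
rewrite (_ : (fun _ => _) =
   (fun v : 'rV[R]_n.+1 => v ord0 (lift ord0 j))).
  exact: measurable_coord.
by apply/funext => p /=; rewrite mxE.
Qed.

Section step.
Variables (n : nat).
Variable m : {sigma_finite_measure set 'rV[R]_n -> \bar R}.

Definition lebesgue_step : set 'rV[R]_n.+1 -> \bar R :=
  pushforward (lebesgue_measure \x m)%E (@vcons n).


HB.instance Definition _ := Measure.copy lebesgue_step
  (measure_function_pushforward__canonical__measure_function_Measure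
    (lebesgue_measure \x m)%E (@measurable_vcons n)).

Lemma lebesgue_step_sigma_finite : sigma_finite setT lebesgue_step.
Proof.
have /sigma_finiteP[F [TF ndF Foo]] :=
  sigma_finiteT (@lebesgue_measure R).
have /sigma_finiteP[G [TG ndG Goo]] := sigma_finiteT m.
exists (fun k => @vuncons n @^-1` (F k `*` G k)).
  rewrite -preimage_bigcup; apply/esym/seteqP; split=> // v _.
  have /= [k _ Fk] : (\bigcup_k F k) (vuncons v).1 by rewrite -TF.
  have /= [l _ Gl] : (\bigcup_k G k) (vuncons v).2 by rewrite -TG.
  exists (maxn k l) => //; split => /=.
  - by move: Fk; apply/subsetPset/ndF/leq_maxl.
  - by move: Gl; apply/subsetPset/ndG/leq_maxr.
move=> k; have [mF Fk] := Foo k; have [mG Gk] := Goo k; split.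
  by rewrite -[X in measurable X]setTI; apply: measurable_vuncons => //;
    exact: measurableX.
rewrite /lebesgue_step /pushforward -comp_preimage.
rewrite (_ : _ \o _ = id) ?preimage_id; last by apply/funext => p; exact: vconsK.
by rewrite product_measure1E// lte_mul_pinfty// ge0_fin_numE.
Qed.

HB.instance Definition _ := @Measure_isSigmaFinite.Build _ _ _ lebesgue_step
  lebesgue_step_sigma_finite.

End step.

Fixpoint lebesgue_rec n : {sigma_finite_measure set 'rV[R]_n -> \bar R} :=
  match n with
  | 0 => \d_(0 : 'rV[R]_0)
  | n'.+1 => lebesgue_step (lebesgue_rec n')
  end.

(* Lebesgue measure on R^n: the n-fold product of the one-dimensional one. *)
Definition lebesgue n :
    {sigma_finite_measure set 'rV[R]_n -> \bar R} :=
  lebesgue_rec n.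

Lemma measurable_box n (A : 'I_n -> set R) : (forall i, measurable (A i)) ->
  measurable [set x : 'rV[R]_n | forall i, A i (x ord0 i)].
Proof.
move=> mA; rewrite (_ : [set _ | _] =
    \bigcap_(i in [set: 'I_n]) ((fun x : 'rV[R]_n => x ord0 i) @^-1` A i)).
  apply: fin_bigcap_measurable => // i _.
  by rewrite -[X in measurable X]setTI; exact: measurable_coord.
by apply/seteqP; split=> x /= h i; [move=> _; exact: h|exact: h].
Qed.

Lemma lebesgue_box n (A : 'I_n -> set R) : (forall i, measurable (A i)) ->
  lebesgue n [set x | forall i, A i (x ord0 i)] =
  (\prod_(i < n) lebesgue_measure (A i))%E.
Proof.
elim: n A => [|n IHn] A mA.
  by rewrite big_ord0 /lebesgue /= diracE mem_set// => -[].
rewrite big_ord_recl -IHn// /lebesgue /= /lebesgue_step /pushforward.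
rewrite -product_measure1E//=; first last.
- exact: (measurable_box (fun i => mA (lift ord0 i))).
- exact: (mA ord0).
congr ((lebesgue_measure \x lebesgue_rec n)%E _).
apply/seteqP; split=> -[a v] /=.
  move=> h; split=> [|i]; first by have := h ord0; rewrite mxE unlift_none.
  by have := h (lift ord0 i); rewrite mxE liftK.
move=> [A0 Av] i; rewrite mxE.
by case: (unliftP ord0 i) => [j ->|->] //=; exact: Av.
Qed.

End lebesgue_rV.

Section euclid.
Context {R : realType} {d : nat}.
Implicit Types u v x y : 'rV[R]_d.

(* The norm [`|x|] that the library puts on ['rV[R]_d] is the sup norm. *)
Definition dotv u v : R := \sum_i u ord0 i * v ord0 i.
Definition normv u : R := Num.sqrt (dotv u u).
Definition angle u v : R := acos (dotv u v / (normv u * normv v)).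

Definition diam (A : set 'rV[R]_d) : R :=
  sup [set normv (p.1 - p.2) | p in A `*` A].

Definition inball_diam (A : set 'rV[R]_d) : R :=
  sup [set 2 * r | r in [set r | 0 <= r /\
        exists c, [set x | normv (x - c) <= r] `<=` A]].

Definition cube (L : R) : set 'rV[R]_d :=
  [set x | forall i, - L <= x ord0 i <= L].

Definition dirv (i : 'I_d) : 'rV[R]_d := delta_mx ord0 i.

Definition pderiv (i : 'I_d) (f : 'rV[R]_d -> R) : 'rV[R]_d -> R :=
  fun x => 'D_(dirv i) f x.

Definition smooth (f : 'rV[R]_d -> R) : Prop :=
  forall s : seq 'I_d, let g := foldr pderiv f s in
    continuous g /\ forall i x, derivable g x (dirv i).

End euclid.

Section sobolev.
Context {R : realType} {d : nat}.
Variable D : set 'rV[R]_d.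
Implicit Types f g u v phi : 'rV[R]_d -> R.
Local Notation mu := (lebesgue d).

Definition test_function phi : Prop :=
  smooth phi /\
  exists2 K : set 'rV[R]_d, compact K /\ K `<=` D° &
    forall x, ~ K x -> phi x = 0.

Definition L2 f : Prop :=
  measurable_fun D f /\ (\int[mu]_(x in D) ((f x) ^+ 2)%:E < +oo)%E.

Definition is_wderiv (i : 'I_d) f g : Prop :=
  L2 g /\ forall phi, test_function phi ->
    \int[mu]_(x in D) (f x * pderiv i phi x) =
    - \int[mu]_(x in D) (g x * phi x).

(* A representative of the weak derivative; it is unique up to a null set and
   meaningless when [f] has no weak derivative in L^2(D). *)
Definition wderiv (i : 'I_d) f : 'rV[R]_d -> R :=
  xget (cst 0) [set g | is_wderiv i f g].

Definition H1 f : Prop := L2 f /\ forall i, exists g, is_wderiv i f g.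

Definition H2 f : Prop := H1 f /\ forall i, H1 (wderiv i f).

Definition H1norm f : R :=
  Num.sqrt (\int[mu]_(x in D) ((f x) ^+ 2 + \sum_i (wderiv i f x) ^+ 2)).

Definition H01 f : Prop :=
  H1 f /\ exists2 phi : nat -> 'rV[R]_d -> R, forall n, test_function (phi n) &
    H1norm (phi n \- f) @[n --> \oo] --> 0.

Definition cvg_H01 (I : Type) (F : set_system I) (u_ : I -> 'rV[R]_d -> R) u :=
  [/\ forall i, H01 (u_ i), H01 u & H1norm (u_ i \- u) @[i --> F] --> 0].

(* C^1 up to the boundary of the closed domain [D]. *)
Definition C1_closed f : Prop :=
  {within D, continuous f} /\
  forall i, exists2 g : 'rV[R]_d -> R, {within D, continuous g} &
    forall x, D° x -> derivable f x (dirv i) /\ pderiv i f x = g x.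

Variables (beta : R) (V : 'rV[R]_d -> R).

Definition energy u : \bar R :=
  ((2^-1)%:E *
     \int[mu]_(x in D) (\sum_i (wderiv i u x) ^+ 2 + V x * (u x) ^+ 2)%:E
   + (beta / 4)%:E * \int[mu]_(x in D) ((u x) ^+ 4)%:E)%E.

Definition unit_mass u : Prop := \int[mu]_(x in D) (u x) ^+ 2 = 1.

Definition ground_state u : Prop :=
  [/\ H01 u, unit_mass u,
      forall v, H01 v -> unit_mass v -> (energy u <= energy v)%E &
      {ae mu, forall x, D x -> 0 < u x}].

Definition eigenpair u (lambda : R) : Prop :=
  forall v, H01 v ->
    \int[mu]_(x in D) (\sum_i wderiv i u x * wderiv i v x
                       + V x * u x * v x + beta * `|u x| ^+ 2 * u x * v x)
    = lambda * \int[mu]_(x in D) (u x * v x).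

End sobolev.

Section hull.
Context {R : realType} {d nv : nat}.
Variable vtx : 'I_nv -> 'rV[R]_d.

Definition hull (A : {set 'I_nv}) : set 'rV[R]_d :=
  [set x | exists c : 'I_nv -> R, [/\ forall i, 0 <= c i,
     \sum_(i in A) c i = 1 & x = \sum_(i in A) c i *: vtx i]].

Definition affinely_free (A : {set 'I_nv}) : Prop :=
  forall c : 'I_nv -> R, \sum_(i in A) c i = 0 ->
    \sum_(i in A) c i *: vtx i = 0 -> forall i, i \in A -> c i = 0.

End hull.

(* A conforming simplicial mesh of [D]: simplices are given by their sets of
   vertices, and two simplices meet exactly in the hull of their common
   vertices, i.e. in a common face or not at all. *)
Record mesh {R : realType} {d : nat} (D : set 'rV[R]_d) := Mesh {
  nvtx : nat;
  vtx : 'I_nvtx -> 'rV[R]_d;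
  simplices : {set {set 'I_nvtx}};
  vtx_inj : injective vtx;
  simplex_card : forall K, K \in simplices -> #|K| = d.+1;
  simplex_free : forall K, K \in simplices -> affinely_free vtx K;
  mesh_cover : \bigcup_(K in [set` simplices]) hull vtx K = D;
  mesh_conforming : forall K K', K \in simplices -> K' \in simplices ->
    hull vtx K `&` hull vtx K' = hull vtx (K :&: K');
  mesh_vtx_used : forall i, exists2 K, K \in simplices & i \in K
}.

Section discrete.
Context {R : realType} {d : nat} {D : set 'rV[R]_d}.
Variable M : mesh D.
Local Notation vtx := (@vtx R d D M).
Local Notation simplices := (simplices M).
Local Notation vertex := ('I_(nvtx M)).
Local Notation simplex := {set vertex}.
Local Notation hull := (hull vtx).
Implicit Types (K : simplex) (f g : 'rV[R]_d -> R).

Definition volume K : R := fine (lebesgue d (hull K)).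

Definition mesh_size : R := \big[Num.max/0]_(K in simplices) diam (hull K).

Definition shape_regular (sigma : R) : Prop :=
  forall K, K \in simplices -> diam (hull K) / inball_diam (hull K) <= sigma.

(* [p] minus its orthogonal projection on the affine hull of the vertices in
   [A]. *)
Definition perpendicular (A : simplex) (p : 'rV[R]_d) : 'rV[R]_d :=
  xget 0 [set q |
    (exists2 c : vertex -> R, \sum_(k in A) c k = 1 &
       q = p - \sum_(k in A) c k *: vtx k) /\
    forall k l, k \in A -> l \in A -> dotv q (vtx k - vtx l) = 0].

Definition opposite_face K (i j : vertex) : simplex := K :\ i :\ j.

(* The facets of [K] opposite to [j] and [i] are spanned by the face
   [opposite_face K i j] together with [i], resp. [j]; their dihedral angle is
   measured between the perpendiculars dropped from [i] and [j] on that face. *)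
Definition dihedral_angle K (i j : vertex) : R :=
  angle (perpendicular (opposite_face K i j) (vtx i))
        (perpendicular (opposite_face K i j) (vtx j)).

(* The (d-2)-dimensional measure of [opposite_face K i j] for d = 2 and d = 3;
   in the latter case the face is a segment. *)
Definition opposite_measure K (i j : vertex) : R :=
  if d == 2 then 1 else diam (hull (opposite_face K i j)).

Definition cot (t : R) : R := cos t / sin t.

Definition monotone_mesh : Prop :=
  forall i j : vertex, i != j ->
    (exists2 K, K \in simplices & (i \in K) && (j \in K)) ->
    0 <= \sum_(K in simplices | (i \in K) && (j \in K))
           1 / (d%:R * (d%:R - 1)) * opposite_measure K i j
           * cot (dihedral_angle K i j).

Definition affine_on K f : Prop :=
  exists (g : 'rV[R]_d) (a : R), forall x, hull K x -> f x = a + dotv g x.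

(* The constant gradient of a function that is affine on [K]. *)
Definition grad_on K f : 'rV[R]_d :=
  xget 0 [set g | forall x y, hull K x -> hull K y -> f x - f y = dotv g (x - y)].

(* Functions of V_0^h are extended by zero outside [D]. *)
Definition V0h f : Prop :=
  [/\ {within D, continuous f}, forall x, ~ D° x -> f x = 0 &
      forall K, K \in simplices -> affine_on K f].

(* Vertex quadrature of a function that may jump across simplices: [F K i] is
   the value at the vertex [i] of its restriction to the simplex [K]. *)
Definition quadrature (F : simplex -> vertex -> R) : R :=
  \sum_(K in simplices) volume K / d.+1%:R * \sum_(i in K) F K i.

Definition qdot f g : R := quadrature (fun _ i => f (vtx i) * g (vtx i)).

Definition qdot_grad f g : R :=
  quadrature (fun K _ => dotv (grad_on K f) (grad_on K g)).

Definition interior_vertices : {set vertex} := [set i | `[< D° (vtx i) >]].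
Definition nb_nodes := #|interior_vertices|.
Definition node (k : 'I_nb_nodes) : 'rV[R]_d := vtx (enum_val k).

Definition weight (k : 'I_nb_nodes) : R :=
  \sum_(K in simplices | enum_val k \in K) volume K / d.+1%:R.

Definition nodal_basis (k : 'I_nb_nodes) : 'rV[R]_d -> R :=
  xget (cst 0) [set f | V0h f /\ forall l, f (node l) = (l == k)%:R].

Definition nodal_values f : 'cV[R]_nb_nodes := \col_k f (node k).

Definition mass_mx : 'M[R]_nb_nodes := diag_mx (\row_k weight k).
Definition stiff_mx : 'M[R]_nb_nodes :=
  \matrix_(k, l) qdot_grad (nodal_basis k) (nodal_basis l).
Definition laplace_mx : 'M[R]_nb_nodes := - (invmx mass_mx *m stiff_mx).

Variables (beta : R) (V : 'rV[R]_d -> R).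

Definition potential_mx : 'M[R]_nb_nodes := diag_mx (\row_k V (node k)).

Definition energy_h f : R :=
  2^-1 * qdot_grad f f + 2^-1 * qdot (fun x => V x * f x) f
  + beta / 4 * qdot (fun x => f x ^+ 2) (fun x => f x ^+ 2).

Definition ground_state_h f : Prop :=
  [/\ V0h f, qdot f f = 1,
      forall g, V0h g -> qdot g g = 1 -> energy_h f <= energy_h g &
      forall k, 0 < f (node k)].

Definition eigenpair_h f (lambda : R) : Prop :=
  let u := nodal_values f in
  - laplace_mx *m u + potential_mx *m u + beta *: map_mx (fun t => t ^+ 3) u
  = lambda *: u.

Definition linearized_mx (u : 'cV[R]_nb_nodes) : 'M[R]_nb_nodes :=
  - laplace_mx + potential_mx + beta *: diag_mx (\row_k (u k ord0) ^+ 2).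

End discrete.

Definition irreducible_mx {R : realType} {n : nat} (A : 'M[R]_n) : Prop :=
  forall S : {set 'I_n}, S != finset.set0 -> S != [set: 'I_n]%SET ->
    exists i j, [/\ i \in S, j \notin S & A i j != 0].

(* The filter h -> 0 on the index set of a family of meshes. *)
Definition size_to0 {R : realType} (I : Type) (h : I -> R) : set_system I :=
  filter_from [set e : R | 0 < e] (fun e => [set i | h i < e]).

(* Main.v *)
From HB Require Import structures.
From mathcomp Require Import all_boot all_order all_algebra.
From mathcomp Require Import all_classical all_reals all_analysis.
From mathcomp Require Import measurable_realfun ring lra.
Require Import Defs.

(** The discrete ground state [uh], normalised in L^2, competes with [u]; its
    energy exceeds the minimum by a quantity that tends to zero, and the energy
    is uniformly convex along quadratic means.

    Upper bound: some test function is almost a minimiser, and its nodal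
    interpolant has almost the same discrete energy, so the discrete minima are
    asymptotically at most the continuous minimum.  Lower bound: on a simplex
    [K] an affine function oscillates by at most [|grad| * diam K], so vertex
    quadrature of its square and of its fourth power differs from the integral
    by a quantity controlled by the discrete energy and the mesh size; the
    quartic term uses [d <= 3] and shape regularity.  Hence the energy of the
    normalised [uh] tends to the minimum.

    The quadratic mean [sqrt ((u^2 + v^2) / 2)] of two competitors has unit mass
    and Dirichlet energy at most the mean of the two energies, so
    [beta / 8 * \int (u^2 - v^2)^2 <= E v - E u].  This gives convergence in
    L^2, and the eigenvalue equation of [u] upgrades it to H^1.  The discrete
    eigenvalue is [2 E_h(uh) + beta / 2 <uh^2, uh^2>].

    Members of H^1_0 are handled as L^2 limits of test functions together with
    their gradients, so that no Sobolev theory is needed.  For a nonnegative finite element function such a sequence comes from its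
    max-min representation by affine functions, smoothed and then thresholded
    so as to have compact support. *)

Set Implicit Arguments.
Unset Strict Implicit.
Unset Printing Implicit Defensive.
Import Order.TTheory GRing.Theory Num.Theory.
Import numFieldNormedType.Exports.
Local Open Scope classical_set_scope.
Local Open Scope ring_scope.

(** * Measurability and integration *)

Section measurable_continuous.
Context {R : realType} {d : nat}.
Local Notation E := 'rV[R]_d.

(** No compact embedding is used, so convergence has to come from a quantitative form of uniqueness:
    in terms of the density [u ^+ 2] the Dirichlet energy is convex, the potential term linear and
    the quartic term uniformly convex. Positivity then turns closeness of densities into closeness
    of functions.

    Two obstacles shape the rest. The ground state is given only as a limit of test functions, and
    nothing bounds it or its approximants in L^4 beforehand. Inequalities between densities are
    therefore proved pointwise for smooth functions, with a truncation that keeps them bounded, and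
    only integrals pass to the limit. Secondly, a finite element function must be exhibited as a
    limit of smooth functions with compact support: replacing the absolute value in maxima and
    minima by [sqrt (y^2 + e^2)] keeps the gradients bounded, and they converge away from ties, so
    dominated convergence suffices.

    Since no rate is claimed, the quadrature errors of powers take the form of a factor close to 1,
    governed by [delta], plus a [delta]-dependent multiple of the mesh size. *)

Definition obox (a b : E) : set E :=
  [set x | forall i, x ord0 i \in `]a ord0 i, b ord0 i[].

Lemma measurable_obox a b : measurable (obox a b).
Proof.
apply: (@measurable_box _ _ (fun i => `]a ord0 i, b ord0 i[%classic)) => i.
exact: measurable_itv.
Qed.

Lemma nbhs_rVP (x : E) (A : set E) :
  nbhs x A <-> exists2 e : R, 0 < e &
    forall y : E, (forall i, `|x ord0 i - y ord0 i| < e) -> A y.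
Proof.
split=> [/nbhs_ballP[e /= e0 h]|[e e0 h]].
  exists e => // y hy; apply: h; split=> // i j; rewrite (ord1 i).
  exact: hy.
apply/nbhs_ballP; exists e => //= y [_ hy]; apply: h => i; exact: hy.
Qed.

(** The measurable sets of ['rV[R]_d] are generated by the coordinates, not by the topology. An open
    set is the union of the boxes with rational corners that it contains, and these are countably
    many. *)
Lemma open_measurable_rV (U : set E) : open U -> measurable U.
Proof.
move=> oU.
pose B (p : 'rV[rat]_d * 'rV[rat]_d) : set E :=
  obox (map_mx ratr p.1) (map_mx ratr p.2).
have -> : U = \bigcup_(p in [set p | B p `<=` U]) B p.
  apply/seteqP; split=> [x Ux|x [p /= + ]]; last exact.
  have /nbhs_rVP[e e0 he] : nbhs x U by exact: open_nbhs_nbhs.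
  have H (i : 'I_d) : exists q : rat * rat,
      x ord0 i - e < ratr q.1 < x ord0 i /\ x ord0 i < ratr q.2 < x ord0 i + e.
    have xe : x ord0 i - e < x ord0 i by rewrite ltrBlDr ltrDl.
    have xe' : x ord0 i < x ord0 i + e by rewrite ltrDl.
    have [q1 hq1] := rat_in_itvoo xe; have [q2 hq2] := rat_in_itvoo xe'.
    exists (q1, q2); split.
      by move: hq1; rewrite in_itv.
    by move: hq2; rewrite in_itv.
  have [q hq] := choice H.
  exists (\row_i (q i).1, \row_i (q i).2) => /=.
    move=> y By; apply: he => i; have := By i; rewrite !mxE in_itv/=.
    have [/andP[h1 h2] /andP[h3 h4]] := hq i; move=> /andP[h5 h6].
    rewrite ltr_norml; apply/andP; split; lra.
  move=> i; rewrite !mxE in_itv/=.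
  by have [/andP[_ ->] /andP[-> _]] := hq i.
rewrite bigcup_mkcond; apply: countable_bigcupT_measurable => // p.
by case: ifPn => // _; exact: measurable_obox.
Qed.

Lemma closed_measurable_rV (U : set E) : closed U -> measurable U.
Proof.
by move=> cU; rewrite -(setCK U); apply: measurableC; apply: open_measurable_rV;
  exact: closed_openC.
Qed.

Lemma within_continuous_measurable_rV (D : set E) (f : E -> R) :
  measurable D -> {within D, continuous f} -> measurable_fun D f.
Proof.
move=> mD cf; apply: (measurability _ (measurable_realfun.RGenOpens.measurableE R)).
move=> _ [_ [a [b ->] <-]].
have /continuousP/(_ _ (interval_open _ _)) := cf.
move=> /(_ (BRight a) (BLeft b) isT isT) /open_subspaceP[V oV VD].
rewrite setIC -VD; apply: measurableI => //; exact: open_measurable_rV.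
Qed.

Lemma continuous_measurable_rV (f : E -> R) (D : set E) :
  measurable D -> continuous f -> measurable_fun D f.
Proof.
move=> mD cf; apply: within_continuous_measurable_rV => //.
exact: continuous_subspaceT.
Qed.

End measurable_continuous.

Section real_integral.
Context {disp : measure_display} {T : measurableType disp} {R : realType}.
Variables (mu : {measure set T -> \bar R}) (D : set T).
Hypothesis mD : measurable D.
Implicit Types f g h : T -> R.

Definition intg f : Prop := mu.-integrable D (EFin \o f).
Local Notation Int f := (Rintegral mu D f).

Lemma intg_meas f : intg f -> measurable_fun D f.
Proof. by move=> /integrableP[/measurable_EFinP]. Qed.

Lemma intg_eq f g : (forall x, D x -> f x = g x) -> intg f -> intg g.
Proof.
move=> fg; apply: eq_integrable => // x; rewrite inE => Dx /=.
by rewrite fg.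
Qed.

Lemma intg_le f g : measurable_fun D f -> (forall x, D x -> `|f x| <= g x) ->
  intg g -> intg f.
Proof.
move=> mf fg; apply: le_integrable => //; first exact/measurable_EFinP.
by move=> x Dx /=; rewrite lee_fin (le_trans (fg x Dx))// ler_norm.
Qed.

Lemma intgD f g : intg f -> intg g -> intg (fun x => f x + g x).
Proof. by move=> fi gi; exact: (integrableD mD fi gi). Qed.

Lemma intgB f g : intg f -> intg g -> intg (fun x => f x - g x).
Proof. by move=> fi gi; exact: (integrableB mD fi gi). Qed.

Lemma intgZ k f : intg f -> intg (fun x => k * f x).
Proof. by move=> fi; exact: (integrableZl mD k fi). Qed.

Lemma intgN f : intg f -> intg (fun x => - f x).
Proof. by move=> fi; exact: (integrableN fi). Qed.

Lemma intg_sum (I : Type) (s : seq I) (P : pred I) (F : I -> T -> R) :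
  (forall i, P i -> intg (F i)) -> intg (fun x => \sum_(i <- s | P i) F i x).
Proof.
move=> h; have := @integrable_sum _ T R mu D mD _ s P (fun i => EFin \o F i) h.
by apply: eq_integrable => // x _ /=; rewrite sumEFin.
Qed.

Lemma intg_abs f : intg f -> intg (fun x => `|f x|).
Proof. exact: integrable_norm. Qed.

Lemma Int_sum (I : Type) (s : seq I) (P : pred I) (F : I -> T -> R) :
  (forall i, P i -> intg (F i)) ->
  Int (fun x => \sum_(i <- s | P i) F i x) = \sum_(i <- s | P i) Int (F i).
Proof.
move=> h; elim: s => [|i s IH].
  under eq_Rintegral do rewrite big_nil.
  by rewrite big_nil Rintegral_cst// mul0r.
rewrite big_cons; under eq_Rintegral do rewrite big_cons.
case: ifPn => [Pi|_]; last exact: IH.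
rewrite RintegralD//; first by rewrite IH.
- exact: h.
- exact: intg_sum.
Qed.

Lemma IntN f : intg f -> Int (fun x => - f x) = - Int f.
Proof.
move=> fi; rewrite -mulN1r -RintegralZl//.
by under eq_Rintegral do rewrite -mulN1r.
Qed.

Lemma Int_le f g : intg f -> intg g -> (forall x, D x -> f x <= g x) ->
  Int f <= Int g.
Proof. exact: le_Rintegral. Qed.

Lemma Int_ae_eq f g : measurable_fun D f -> measurable_fun D g ->
  {ae mu, forall x, D x -> f x = g x} -> Int f = Int g.
Proof.
move=> mf mg fg; rewrite /Rintegral; congr fine; apply: ae_eq_integral => //.
- exact/measurable_EFinP.
- exact/measurable_EFinP.
- by apply: filterS fg => x h Dx /=; rewrite h.
Qed.

(** Pointwise comparison holds with [max f g] in place of [g], and these two agree almost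
    everywhere. *)
Lemma Int_ae_le f g : intg f -> intg g ->
  {ae mu, forall x, D x -> f x <= g x} -> Int f <= Int g.
Proof.
move=> fi gi fg; rewrite /Rintegral fine_le//.
- exact: integrable_fin_num.
- exact: integrable_fin_num.
have mf := intg_meas fi; have mg := intg_meas gi.
have ig : intg (fun x => Num.max (f x) (g x)).
  apply: (@intg_le _ (fun x => `|f x| + `|g x|)).
  - exact: measurable_maxr.
  - move=> x Dx; rewrite /Num.max; case: ifP => _.
      by rewrite lerDr normr_ge0.
    by rewrite lerDl normr_ge0.
  - by apply: intgD; exact: intg_abs.
apply: (@le_trans _ _ (\int[mu]_(x in D) (Num.max (f x) (g x))%:E)%E).
  apply: le_integral => // x _; rewrite lee_fin; by rewrite le_max lexx.
rewrite le_eqVlt; apply/orP; left; apply/eqP; apply: ae_eq_integral => //.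
- by apply/measurable_EFinP; exact: measurable_maxr.
- exact/measurable_EFinP.
- by apply: filterS fg => x h Dx /=; rewrite max_r// h.
Qed.

Lemma intg_ae_eq f g : measurable_fun D g ->
  {ae mu, forall x, D x -> f x = g x} -> intg f -> intg g.
Proof.
move=> mg fg fi; apply/integrableP; split; first exact/measurable_EFinP.
have /integrableP[_] := fi; apply: le_lt_trans.
rewrite le_eqVlt; apply/orP; left; apply/eqP; apply: ae_eq_integral => //.
- by apply/measurable_EFinP; apply: measurableT_comp.
- by apply/measurable_EFinP; apply: measurableT_comp => //; exact: intg_meas.
- by apply: filterS fg => x h Dx /=; rewrite h.
Qed.

Lemma Int_dct (f_ : nat -> T -> R) f g :
  (forall n, measurable_fun D (f_ n)) -> measurable_fun D f ->
  {ae mu, forall x, D x -> f_ ^~ x @ \oo --> f x} ->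
  intg g -> (forall n x, D x -> `|f_ n x| <= g x) ->
  intg f /\ Int (f_ n) @[n --> \oo] --> Int f.
Proof.
move=> mf_ mf ff gi fg.
have [||||| fi _ cv] := @dominated_convergence _ T R mu D mD
   (fun n => EFin \o f_ n) (EFin \o f) (EFin \o g).
- by move=> n; exact/measurable_EFinP.
- exact/measurable_EFinP.
- by apply: filterS ff => x h Dx /=; apply: cvg_EFin; [exact: nearW|exact: h].
- exact: gi.
- by apply: aeW => x n Dx; rewrite lee_fin fg.
split; first exact: fi.
apply: fine_cvg; rewrite /Rintegral fineK; first exact: cv.
exact: integrable_fin_num.
Qed.

Hypothesis muD : (mu D < +oo)%E.

Lemma intg_cst k : intg (fun=> k).
Proof.
apply: measurable_bounded_integrable => //.
by exists `|k|; split; rewrite ?num_real// => M kM x _ /=; exact: ltW.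
Qed.

Lemma intg_bounded f M : measurable_fun D f -> (forall x, D x -> `|f x| <= M) ->
  intg f.
Proof. by move=> mf fM; apply: (@intg_le _ (fun=> M)) => //; exact: intg_cst. Qed.

Definition sq_intg f : Prop := measurable_fun D f /\ intg (fun x => f x ^+ 2).

Lemma sq_intgP f : sq_intg f <-> measurable_fun D f /\
  (\int[mu]_(x in D) ((f x) ^+ 2)%:E < +oo)%E.
Proof.
split=> -[mf h]; split => //.
  by apply: integrable_lty h.
apply/integrableP; split.
  by apply/measurable_EFinP; exact: measurable_funX.
rewrite (eq_integral (fun x => ((f x) ^+ 2)%:E))// => x _ /=.
by rewrite ger0_norm// sqr_ge0.
Qed.

Lemma sq_intgM f g : sq_intg f -> sq_intg g -> intg (fun x => f x * g x).
Proof.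
move=> [mf f2] [mg g2].
apply: (@intg_le _ (fun x => f x ^+ 2 + g x ^+ 2)).
- exact: measurable_funM.
- move=> x _; rewrite ler_norml; apply/andP; split; nra.
- exact: intgD.
Qed.

Lemma sq_intgD f g : sq_intg f -> sq_intg g -> sq_intg (fun x => f x + g x).
Proof.
move=> /[dup] f2 [mf fi] /[dup] g2 [mg gi]; split; first exact: measurable_funD.
have h : intg (fun x => f x ^+ 2 + 2 * (f x * g x) + g x ^+ 2).
  by apply: intgD => //; apply: intgD => //; apply: intgZ; exact: sq_intgM.
by apply: intg_eq h => x _; ring.
Qed.

Lemma sq_intgZ k f : sq_intg f -> sq_intg (fun x => k * f x).
Proof.
move=> [mf fi]; split; first exact: measurable_funM.
by apply: intg_eq (intgZ (k ^+ 2) fi) => x _; rewrite exprMn.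
Qed.

Lemma sq_intgN f : sq_intg f -> sq_intg (fun x => - f x).
Proof.
have -> : (fun x => - f x) = (fun x => -1 * f x).
  by apply/funext => x; rewrite mulN1r.
exact: sq_intgZ.
Qed.

Lemma sq_intgB f g : sq_intg f -> sq_intg g -> sq_intg (fun x => f x - g x).
Proof. by move=> f2 g2; apply: sq_intgD => //; exact: sq_intgN. Qed.

Lemma sq_intg_intg f : sq_intg f -> intg f.
Proof.
move=> [mf f2]; apply: (@intg_le _ (fun x => f x ^+ 2 + 1)) => //.
- by move=> x _; rewrite ler_norml; apply/andP; split; nra.
- by apply: intgD => //; exact: intg_cst.
Qed.

Lemma sq_intg_bounded f M : measurable_fun D f ->
  (forall x, D x -> `|f x| <= M) -> sq_intg f.
Proof.
move=> mf fM; split=> //; apply: (@intg_bounded _ (M ^+ 2)).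
  exact: measurable_funX.
move=> x Dx; rewrite normrX lerXn2r// ?nnegrE// ?fM//.
by rewrite (le_trans _ (fM x Dx)).
Qed.

Lemma Int_sq_ge0 f : 0 <= Int (fun x => f x ^+ 2).
Proof. by apply: Rintegral_ge0 => x _; exact: sqr_ge0. Qed.

(** Integrates [e (a - b / e)^2 >= 0], with [a] and [b] the absolute values. The free weight [e]
    lets this serve wherever Cauchy-Schwarz would be used to pass to a limit. *)
Lemma Int_young f g (e : R) : sq_intg f -> sq_intg g -> 0 < e ->
  `|Int (fun x => f x * g x)| <=
    e * Int (fun x => f x ^+ 2) + e^-1 * Int (fun x => g x ^+ 2).
Proof.
move=> f2 g2 e0; have fg := sq_intgM f2 g2.
rewrite -(RintegralZl e mD f2.2) -(RintegralZl e^-1 mD g2.2).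
rewrite -RintegralD//; [|exact: intgZ f2.2|exact: intgZ g2.2].
apply: le_trans (le_normr_Rintegral mD fg) _.
apply: Int_le; [exact: intg_abs| |].
  by apply: intgD; [exact: intgZ f2.2|exact: intgZ g2.2].
move=> x _; rewrite normrM -(real_normK (num_real (f x))).
rewrite -(real_normK (num_real (g x))).
move: (`|f x|) (`|g x|) (normr_ge0 (f x)) (normr_ge0 (g x)) => a b a0 b0.
have ei : 0 < e^-1 by rewrite invr_gt0.
have ee : e * e^-1 = 1 by rewrite mulfV// gt_eqF.
have := sqr_ge0 (a - e^-1 * b).
move=> /(mulr_ge0 (ltW e0)).
have -> : e * (a - e^-1 * b) ^+ 2 =
  e * a ^+ 2 - 2 * (e * e^-1) * a * b + (e * e^-1) * (e^-1 * b ^+ 2) by ring.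
rewrite ee; nra.
Qed.

End real_integral.

(** * Smooth functions *)

Section directional_chain.
Context {R : realType} {V : normedModType R}.

Lemma derive_line (f : V -> R) x v :
  'D_v f x = 'D_1 (fun h : R => f (h *: v + x)) 0.
Proof.
rewrite /derive; set g1 := fun h => h^-1 *: _; set g2 := fun h => h^-1 *: _.
suff -> : g1 = g2 by [].
by apply/funext => h; rewrite /g1 /g2 /= addr0 scale0r add0r [_%:A]mulr1.
Qed.

(** Restricting to the line through [x] in direction [v] reduces this to the chain rule in one
    variable, so [f] has to be derivable in that one direction only. *)
Lemma is_derive_comp_dir (g : R -> R) (f : V -> R) x v (dg df : R) :
  is_derive x v f df -> is_derive (f x) 1 g dg ->
  is_derive x v (g \o f) (dg * df).
Proof.
move=> [fx <-] [gx <-].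
pose fl h := f (h *: v + x).
have fl0 : fl 0 = f x by rewrite /fl scale0r add0r.
have dfl : derivable fl 0 1 by move/derivable1P : fx.
have dgl : derivable g (fl 0) 1 by rewrite fl0.
apply: DeriveDef.
  apply/derivable1P/derivable1_diffP.
  by apply: (@differentiable_comp _ _ _ _ fl g); exact/derivable1_diffP.
rewrite derive_line.
have := derive1_comp dfl dgl; rewrite !derive1E /= fl0 => ->.
by rewrite -derive_line.
Qed.

End directional_chain.

Section Ck.
Context {R : realType} {d : nat}.
Local Notation E := 'rV[R]_d.
Implicit Types f g : E -> R.

(** An inductive form of [smooth]: the latter speaks of arbitrary lists of derivatives, whereas
    stability under products and compositions is proved by induction on the order. *)
Fixpoint Ck k f : Prop := continuous f /\
  if k is k'.+1 then
    forall i : 'I_d, (forall x, derivable f x (dirv i)) /\ Ck k' (pderiv i f)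
  else True.

Lemma smoothP f : smooth f <-> forall k, Ck k f.
Proof.
split=> [sf k|Cf s].
  elim: k f sf => [|k IH] f sf /=; first by have [] := sf [::].
  split; first by have [] := sf [::].
  move=> i; split=> [x|]; first by have [_] := sf [::]; exact.
  apply: IH => s /=; have := sf (rcons s i).
  by rewrite /= foldr_rcons.
(* The derivative taken first is the last entry of the list. *)
elim/last_ind: s f Cf => [|s i IH] f Cf /=.
  by split=> [|i x]; [have [] := Cf 0%N|have [_ /(_ i)[]] := Cf 1%N].
rewrite foldr_rcons; apply: IH => k.
by have [_ /(_ i)[]] := Cf k.+1.
Qed.

Lemma CkS k f : Ck k.+1 f -> Ck k f.
Proof.
elim: k f => [|k IH] f [cf h]; first by split.
split=> // i; have [df Cf] := h i; split=> //; exact: IH.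
Qed.

Lemma Ck_continuous k f : Ck k f -> continuous f.
Proof. by case: k => [[]|k []]. Qed.

Lemma Ck_cst k (a : R) : Ck k (fun=> a).
Proof.
elim: k a => [|k IH] a; first by split=> //; exact: cst_continuous.
split; first exact: cst_continuous.
move=> i; split; first by move=> x; exact: derivable_cst.
rewrite (_ : pderiv i _ = fun=> 0)//.
by apply/funext => x; exact: derive_cst.
Qed.

Lemma CkD k f g : Ck k f -> Ck k g -> Ck k (fun x => f x + g x).
Proof.
elim: k f g => [|k IH] f g [cf hf] [cg hg].
  by split=> // x; exact: (continuousD (cf x) (cg x)).
split; first by move=> x; exact: (continuousD (cf x) (cg x)).
move=> i; have [df Cf] := hf i; have [dg Cg] := hg i; split.
  by move=> x; exact: (derivableD (df x) (dg x)).
rewrite (_ : pderiv i _ = fun x => pderiv i f x + pderiv i g x).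
  exact: IH.
by apply/funext => x; exact: (deriveD (df x) (dg x)).
Qed.

Lemma CkM k f g : Ck k f -> Ck k g -> Ck k (fun x => f x * g x).
Proof.
elim: k f g => [|k IH] f g /[dup] Cf [cf hf] /[dup] Cg [cg hg].
  by split=> // x; exact: (continuousM (cf x) (cg x)).
split; first by move=> x; exact: (continuousM (cf x) (cg x)).
move=> i; have [df Cf'] := hf i; have [dg Cg'] := hg i; split.
  by move=> x; exact: (derivableM (df x) (dg x)).
rewrite (_ : pderiv i _ = fun x => f x * pderiv i g x + g x * pderiv i f x).
  by apply: CkD; apply: IH => //; exact: CkS.
by apply/funext => x; exact: (deriveM (df x) (dg x)).
Qed.

Lemma Ck_sum k (I : Type) (s : seq I) (P : pred I) (F : I -> E -> R) :
  (forall i, P i -> Ck k (F i)) -> Ck k (fun x => \sum_(i <- s | P i) F i x).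
Proof.
move=> h; elim: s => [|a s IH].
  by under eq_fun do rewrite big_nil; exact: Ck_cst.
under eq_fun do rewrite big_cons.
have [Pa|//] := boolP (P a); apply: CkD => //; exact: h.
Qed.

Lemma Ck_prod k (I : Type) (s : seq I) (P : pred I) (F : I -> E -> R) :
  (forall i, P i -> Ck k (F i)) -> Ck k (fun x => \prod_(i <- s | P i) F i x).
Proof.
move=> h; elim: s => [|a s IH].
  by under eq_fun do rewrite big_nil; exact: Ck_cst.
under eq_fun do rewrite big_cons.
have [Pa|//] := boolP (P a); apply: CkM => //; exact: h.
Qed.

Lemma is_derive_coord (x : E) (i j : 'I_d) :
  is_derive x (dirv i) (fun y : E => y ord0 j) (i == j)%:R.
Proof.
have dl : differentiable (fun y : E => y ord0 j) x.
  exact: differentiable_coord.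
apply: DeriveDef; first exact: diff_derivable.
apply: cvg_lim => //.
rewrite (_ : (fun _ => _) = fun h : R => h^-1 * (h * (i == j)%:R)); last first.
  by apply/funext => h /=; rewrite !mxE eqxx/= addrK [j == i]eq_sym.
apply: cvg_near_cst; rewrite near_withinE; apply: nearW => h h0.
by rewrite mulrA mulVf// mul1r.
Qed.

Lemma Ck_coord k (j : 'I_d) : Ck k (fun y : E => y ord0 j).
Proof.
case: k => [|k]; first by split=> //; exact: coord_continuous.
split; first exact: coord_continuous.
move=> i; split; first by move=> x; have [] := is_derive_coord x i j.
rewrite (_ : pderiv i _ = fun=> (i == j)%:R); first exact: Ck_cst.
by apply/funext => x; have [] := is_derive_coord x i j.
Qed.

(* A family of one-variable functions closed under differentiation up to linear
   combinations; this covers inverses, square roots and the flat functions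
   [s^-p exp(-1/s)]. *)
Lemma Ck_family (P : set R) (g : nat -> R -> R) (l : nat -> seq (R * nat)) :
  (forall j s, P s ->
     is_derive s 1 (g j) (\sum_(q <- l j) q.1 * g q.2 s)) ->
  forall k f, (forall x, P (f x)) -> Ck k f -> forall j, Ck k (g j \o f).
Proof.
move=> hg; elim=> [|k IH] f Pf /[dup] Cf [cf hf] j.
  split=> // x; apply: continuous_comp; first exact: cf.
  have [+ _] := hg j _ (Pf x).
  by move=> /derivable1_diffP/differentiable_continuous.
split.
  move=> x; apply: continuous_comp; first exact: cf.
  have [+ _] := hg j _ (Pf x).
  by move=> /derivable1_diffP/differentiable_continuous.
move=> i; have [df Cf'] := hf i.
have dgf x := is_derive_comp_dir (derivableP (df x)) (hg j _ (Pf x)).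
split; first by move=> x; have [] := dgf x.
rewrite (_ : pderiv i _ =
  fun x => (\sum_(q <- l j) q.1 * (g q.2 \o f) x) * pderiv i f x).
  apply: CkM => //; apply: Ck_sum => q _; apply: CkM; first exact: Ck_cst.
  by apply: IH => //; exact: CkS.
by apply/funext => x; have [_] := dgf x.
Qed.

End Ck.

Section smooth_functions.
Context {R : realType}.

(** All powers [p] occur together because the derivative of [flat p] is
    [flat p.+2 - p * flat p.+1]. *)
Definition flat (p : nat) (s : R) : R :=
  if 0 < s then s ^- p * expR (- s^-1) else 0.

Lemma flat_ge0 p s : 0 <= flat p s.
Proof.
rewrite /flat; case: ifPn => // s0.
by rewrite mulr_ge0 ?expR_ge0// invr_ge0 exprn_ge0// ltW.
Qed.

Lemma flat_gt0 p s : 0 < s -> 0 < flat p s.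
Proof.
move=> s0; rewrite /flat s0.
by rewrite mulr_gt0 ?expR_gt0// invr_gt0 exprn_gt0.
Qed.

Lemma flat_le0 p s : s <= 0 -> flat p s = 0.
Proof. by move=> s0; rewrite /flat ltNge s0. Qed.

(** With [n = p.+1], [exp (-1/s)] is the n-th power of [exp (-1/(n s))], which is at most [n s];
    after division by [s^p] one factor [s] remains. *)
Lemma flat_lin p s : flat p s <= p.+1%:R ^+ p.+1 * `|s|.
Proof.
rewrite /flat; case: ifPn => [s0|_]; last first.
  by rewrite mulr_ge0// exprn_ge0.
rewrite gtr0_norm//; set n := p.+1%:R.
have n0 : 0 < n :> R by rewrite ltr0n.
have h : expR (- s^-1) <= (n * s) ^+ p.+1.
  have -> : s^-1 = p.+1%:R * (n * s)^-1.
    by rewrite invfM mulrA mulfV ?gt_eqF// mul1r.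
  rewrite expRN expRM_natl -exprVn lerXn2r ?nnegrE ?invr_ge0 ?expR_ge0//.
    by rewrite mulr_ge0 ?ltW.
  rewrite -[leRHS]invrK lef_pV2 ?posrE ?expR_gt0 ?invr_gt0 ?mulr_gt0//.
  by rewrite (le_trans _ (expR_ge1Dx _))// lerDr.
apply: le_trans (ler_wpM2l _ h) _; first by rewrite invr_ge0 exprn_ge0 ?ltW.
rewrite exprMn [X in _ * (_ * X)]exprSr mulrCA mulKf//.
by rewrite expf_neq0// gt_eqF.
Qed.

Lemma is_derive_invX (p : nat) (s : R) : s != 0 ->
  is_derive s (1 : R) (fun y : R => y ^- p) (- p%:R * s ^- p.+1).
Proof.
move=> s0; elim: p => [|p IH].
  rewrite oppr0 mul0r (_ : (fun _ => _) = cst 1); first exact: is_derive_cst.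
  by apply/funext => y; rewrite expr0 invr1.
have d1 : is_derive s (1 : R) (fun y : R => y^-1) (- s ^- 2).
  apply: (is_derive_eq (is_deriveV s0 (is_derive_id s 1))).
  by rewrite /GRing.scale /= mulr1.
rewrite (_ : (fun _ => _) = (fun y : R => y^-1) * (fun y => y ^- p)); last first.
  by apply/funext => y; rewrite exprS invfM.
apply: (is_derive_eq (is_deriveM d1 IH)).
rewrite /GRing.scale /= -!exprVn (_ : p.+1%:R = p%:R + 1 :> R) ?exprS; first by ring.
by rewrite -natr1.
Qed.

Lemma flat_derive (p : nat) (s : R) :
  is_derive s (1 : R) (flat p) (flat p.+2 s - p%:R * flat p.+1 s).
Proof.
have [s0|s0|->] := ltgtP s 0.
- rewrite !flat_le0 ?(ltW s0)// mulr0 subr0.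
  apply: (@near_eq_is_derive _ _ _ (cst 0)).
  near=> y; rewrite flat_le0//; apply/ltW.
  by near: y; exact: lt_nbhsl.
- have sn0 : s != 0 by rewrite gt_eqF.
  apply: (@near_eq_is_derive _ _ _
      ((fun y => y ^- p) * (fun y => expR (- y^-1)))).
    near=> y; rewrite /flat; case: ifPn => //.
    by move=> /negP; case; near: y; exact: lt_nbhsr.
  have d1 : is_derive s (1 : R) (fun y : R => - y^-1) (s ^- 2).
    apply: (is_derive_eq (is_deriveN (is_deriveV sn0 (is_derive_id s 1)))).
    by rewrite /GRing.scale /= mulr1 opprK.
  have d2 := @is_derive1_comp _ _ (fun y : R => - y^-1) s _ _
    (is_derive_expR (- s^-1)) d1.
  apply: (is_derive_eq (is_deriveM (is_derive_invX p sn0) d2)).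
  rewrite /flat s0 /GRing.scale /= -!exprVn !exprS.
  by ring.
- rewrite !flat_le0// mulr0 subr0.
  have c : (fun h : R => h^-1 *: ((flat p \o shift 0) (h *: (1 : R)) - flat p 0))
      @ 0^' --> (0 : R).
    apply/cvgrPdist_le => e e0; rewrite near_withinE.
    (* For [h > 0] the difference quotient at 0 equals [flat p.+1 h], so the constant is that of
       [flat_lin] one index higher. *)
    pose C : R := p.+2%:R ^+ p.+2.
    have C0 : 0 < C by rewrite exprn_gt0// ltr0n.
    near=> h => h0; rewrite sub0r normrN /= addr0 [_%:A]mulr1.
    rewrite (flat_le0 p (lexx 0)) subr0.
    have : `|h^-1 *: flat p h| <= C * `|h|.
      have [hp|hn] := ltP 0 h.
        rewrite (_ : _ *: _ = flat p.+1 h).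
          by rewrite ger0_norm ?flat_ge0// flat_lin.
        by rewrite /flat hp /GRing.scale /= exprS invfM mulrA.
      by rewrite flat_le0// scaler0 normr0 mulr_ge0// ltW.
    move=> /le_trans; apply; rewrite -ler_pdivlMl//.
    near: h; apply/nbhs_ballP; exists (C^-1 * e) => /=.
      by rewrite mulr_gt0// invr_gt0.
    by move=> y; rewrite /ball /= sub0r normrN => /ltW.
  by apply: DeriveDef; [apply/cvg_ex; exists 0|exact: cvg_lim c].
Unshelve. all: by end_near. Qed.

Lemma sqrt_invX_derive (j : nat) (s : R) : 0 < s ->
  is_derive s (1 : R) (fun y => y ^- j * Num.sqrt y)
    ((2^-1 - j%:R) * (s ^- j.+1 * Num.sqrt s)).
Proof.
move=> s0; have sn0 : s != 0 by rewrite gt_eqF.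
apply: (is_derive_eq (is_deriveM (is_derive_invX j sn0) (is_derive1_sqrt s0))).
rewrite /GRing.scale /=.
have q0 : Num.sqrt s != 0 by rewrite gt_eqF// sqrtr_gt0.
have -> : (2 * Num.sqrt s)^-1 = 2^-1 * (s^-1 * Num.sqrt s).
  rewrite -{2}(sqr_sqrtr (ltW s0)); field.
  by rewrite q0.
by rewrite exprS invfM; ring.
Qed.

End smooth_functions.

Section smooth_closure.
Context {R : realType} {d : nat}.
Local Notation E := 'rV[R]_d.
Implicit Types f g : E -> R.

Lemma smooth_continuous f : smooth f -> continuous f.
Proof. by move=> /(_ [::])[]. Qed.

Lemma smooth_derivable f i x : smooth f -> derivable f x (dirv i).
Proof. by move=> /(_ [::])[_]; exact. Qed.

Lemma smooth_pderiv f i : smooth f -> smooth (pderiv i f).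
Proof.
by move=> /smoothP Cf; apply/smoothP => k; have [_ /(_ i)[]] := Cf k.+1.
Qed.

Lemma smooth_cst (a : R) : smooth (fun _ : E => a).
Proof. by apply/smoothP => k; exact: Ck_cst. Qed.

Lemma smooth_coord j : smooth (fun x : E => x ord0 j).
Proof. by apply/smoothP => k; exact: Ck_coord. Qed.

Lemma smoothD f g : smooth f -> smooth g -> smooth (fun x => f x + g x).
Proof. by move=> /smoothP F /smoothP G; apply/smoothP => k; exact: CkD. Qed.

Lemma smoothM f g : smooth f -> smooth g -> smooth (fun x => f x * g x).
Proof. by move=> /smoothP F /smoothP G; apply/smoothP => k; exact: CkM. Qed.

Lemma smoothZ (a : R) f : smooth f -> smooth (fun x => a * f x).
Proof. by move=> sf; exact: (smoothM (smooth_cst a) sf). Qed.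

Lemma smoothN f : smooth f -> smooth (fun x => - f x).
Proof.
move=> sf; rewrite (_ : (fun _ => _) = fun x => -1 * f x); first exact: smoothZ.
by apply/funext => x; rewrite mulN1r.
Qed.

Lemma smoothB f g : smooth f -> smooth g -> smooth (fun x => f x - g x).
Proof. by move=> sf sg; exact: (smoothD sf (smoothN sg)). Qed.

Lemma smoothX f n : smooth f -> smooth (fun x => f x ^+ n).
Proof.
move=> sf; elim: n => [|n IH]; first exact: smooth_cst.
rewrite (_ : (fun _ => _) = fun x => f x * f x ^+ n); first exact: smoothM.
by apply/funext => x; rewrite exprS.
Qed.

Lemma smooth_sum (I : Type) (s : seq I) (P : pred I) (F : I -> E -> R) :
  (forall i, P i -> smooth (F i)) -> smooth (fun x => \sum_(i <- s | P i) F i x).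
Proof.
by move=> h; apply/smoothP => k; apply: Ck_sum => i Pi; exact: ((smoothP (F i)).1 (h i Pi) k).
Qed.

Lemma smooth_prod (I : Type) (s : seq I) (P : pred I) (F : I -> E -> R) :
  (forall i, P i -> smooth (F i)) -> smooth (fun x => \prod_(i <- s | P i) F i x).
Proof.
by move=> h; apply/smoothP => k; apply: Ck_prod => i Pi; exact: ((smoothP (F i)).1 (h i Pi) k).
Qed.

Lemma smoothV f : smooth f -> (forall x, f x != 0) -> smooth (fun x => (f x)^-1).
Proof.
move=> /smoothP Cf f0; apply/smoothP => k.
have := @Ck_family R d [set s | s != 0] (fun j y => y ^- j)
  (fun j => [:: (- j%:R, j.+1)]) _ k f f0 (Cf k) 1%N.
apply => j s /= s0; rewrite big_seq1; exact: is_derive_invX.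
Qed.

Lemma smooth_sqrt f : smooth f -> (forall x, 0 < f x) ->
  smooth (fun x => Num.sqrt (f x)).
Proof.
move=> /smoothP Cf f0; apply/smoothP => k.
have := @Ck_family R d [set s | 0 < s] (fun j y => y ^- j * Num.sqrt y)
  (fun j => [:: (2^-1 - j%:R, j.+1)]) _ k f f0 (Cf k) 0%N.
rewrite (_ : _ \o f = fun x => Num.sqrt (f x)); last first.
  by apply/funext => x /=; rewrite expr0 invr1 mul1r.
apply => j s /= s0; rewrite big_seq1; exact: sqrt_invX_derive.
Qed.

Lemma smooth_flat f : smooth f -> smooth (fun x => flat 0 (f x)).
Proof.
move=> /smoothP Cf; apply/smoothP => k.
apply: (@Ck_family R d setT (@flat R)
  (fun j => [:: (1, j.+2); (- j%:R, j.+1)]) _ k f _ (Cf k) 0%N) => // j s _.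
rewrite big_cons big_seq1 mul1r mulNr; exact: flat_derive.
Qed.

End smooth_closure.

(** * Test functions on the cube *)

Lemma intg_supp d (T : measurableType d) (R : realType)
    (mu : {measure set T -> \bar R}) (A : set T) (f : T -> R) (C : R) :
  measurable A -> (mu A < +oo)%E -> measurable_fun setT f ->
  (forall x, `|f x| <= C) -> (forall x, ~ A x -> f x = 0) -> intg mu setT f.
Proof.
move=> mA Aoo mf fC f0.
have fA : intg mu A f.
  by apply: (intg_bounded mA Aoo (M := C)) => //; exact: measurable_funTS.
have : mu.-integrable setT ((EFin \o f) \_ A) by apply/(integrable_mkcond _ mA).
apply: eq_integrable => // x _; rewrite /patch; case: ifPn => // /negP xA /=.
by rewrite f0// => /mem_set.
Qed.

Section cube.
Context {R : realType} {d : nat}.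
Local Notation E := 'rV[R]_d.
Variable L : R.

Lemma cube_compact : compact (@cube R d L).
Proof.
have := @rV_compact _ d (fun=> `[- L, L]%classic) (fun=> @segment_compact _ _ _).
congr (compact _); apply/seteqP; split=> x /= h i; have := h i; by rewrite in_itv.
Qed.

Lemma rV_hausdorff : hausdorff_space E.
Proof. exact: norm_hausdorff. Qed.

Lemma cube_closed : closed (@cube R d L).
Proof. by apply: compact_closed; [exact: rV_hausdorff|exact: cube_compact]. Qed.

Lemma cube_measurable : measurable (@cube R d L).
Proof. exact: closed_measurable_rV cube_closed. Qed.

Lemma cube_finite : (lebesgue d (@cube R d L) < +oo)%E.
Proof.
have -> : @cube R d L = [set x | forall i, `[- L, L]%classic (x ord0 i)].
  by apply/seteqP; split=> x /= h i; have := h i; rewrite in_itv.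
rewrite (@lebesgue_box R d (fun=> `[- L, L]%classic)) => [|i]; last exact: measurable_itv.
suff /andP[] : (0 <= \prod_(i < d) lebesgue_measure `[(- L)%R, L]%classic < +oo)%E by [].
elim/big_ind : _ => [|x y /andP[x0 xoo] /andP[y0 yoo]|i _].
- by rewrite lee_fin ler01 ltry.
- rewrite mule_ge0//= lte_mul_pinfty//.
  by rewrite ge0_fin_numE.
- by rewrite measure_ge0/= lebesgue_measure_itv; case: ifP => _; exact: ltry.
Qed.

Lemma cube_interior : (@cube R d L)° = [set x | forall i, - L < x ord0 i < L].
Proof.
apply/seteqP; split=> x.
  move=> /nbhs_rVP[e e0 h] i.
  have hp (s : R) : `|s| < e -> - L <= x ord0 i + s <= L.
    move=> se; have := h (x + s *: dirv i) _ i; rewrite !mxE !eqxx mulr1; apply.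
    move=> j; rewrite !mxE eqxx/= opprD addrA subrr sub0r normrN normrM.
    by case: (_ == _) => /=; rewrite ?normr1 ?mulr1// normr0 mulr0.
  have e2 : `|e / 2| < e by rewrite gtr0_norm ?divr_gt0// ltr_pdivrMr// ltr_pMr// ltr1n.
  have := hp (e / 2) e2; have := hp (- (e / 2)); rewrite normrN => /(_ e2).
  move=> /andP[h1 _] /andP[_ h2]; apply/andP; split.
    by apply: le_lt_trans h1 _; rewrite ltrBlDr ltrDl divr_gt0.
  by apply: lt_le_trans h2; rewrite ltrDl divr_gt0.
move=> /= h; apply/nbhs_rVP.
(* The distance to the nearest face; the default [1] keeps it positive when [d = 0]. *)
exists (\big[Num.min/1]_i Num.min (L - x ord0 i) (x ord0 i + L)).
  elim/big_ind : _ => // [a b a0 b0|i _]; first by rewrite lt_min a0.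
  by have /andP[] := h i; rewrite lt_min => ? ?; apply/andP; split; lra.
move=> y hy i; have := hy i; rewrite (bigD1 i)//= !lt_min.
by move=> /andP[/andP[]]; rewrite !ltr_norml => /andP[? ?] /andP[? ?] _; lra.
Qed.

End cube.

(** * Integrals of derivatives of compactly supported functions *)

Section integral_derivative.
Context {R : realType}.

Lemma continuous_supp_bounded n (g : 'rV[R]_n -> R) (K : set 'rV[R]_n) :
  compact K -> continuous g -> (forall x, ~ K x -> g x = 0) ->
  exists2 C : R, 0 <= C & forall x, `|g x| <= C.
Proof.
move=> cK cg g0.
have := @continuous_compact _ _ g K (continuous_subspaceT cg) cK.
move=> /compact_bounded[C [Cr hC]].
exists (`|C| + 1) => [|x]; first by rewrite addr_ge0.
have [Kx|/g0->] := pselect (K x); last by rewrite normr0 addr_ge0.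
apply: hC; last by exists x.
by rewrite (le_lt_trans (ler_norm _))// ltrDl.
Qed.

Lemma integral_derive_line (f g : R -> R) M : 0 < M -> continuous g ->
  (forall x, is_derive x (1 : R) f (g x)) ->
  (forall x, ~ (- M <= x <= M) -> f x = 0) ->
  (forall x, ~ (- M <= x <= M) -> g x = 0) ->
  (\int[lebesgue_measure]_x (g x)%:E = 0)%E.
Proof.
move=> M0 cg fg f0 g0.
(* A larger interval is used because [f] is known to vanish only outside [[-M, M]], not at its end
   points. *)
have -> : (\int[lebesgue_measure]_x (g x)%:E =
    \int[lebesgue_measure]_(x in `[(- (M + 1))%R, (M + 1)%R]) (g x)%:E)%E.
  rewrite [RHS]integral_mkcond; apply: eq_integral => x _.
  rewrite patchE; case: ifPn => //; rewrite notin_setE/= in_itv/= => h.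
  by rewrite g0// => /andP[h1 h2]; apply: h; apply/andP; split; lra.
have cf : continuous f.
  by move=> x; have [+ _] := fg x => /derivable1_diffP/differentiable_continuous.
rewrite (@continuous_FTC2 _ g f).
- rewrite !f0 ?subee//; first by move=> /andP[]; lra.
  by move=> /andP[]; lra.
- lra.
- exact: continuous_subspaceT.
- split => [x _||].
  + by have [] := fg x.
  + exact/cvg_at_right_filter/cf.
  + exact/cvg_at_left_filter/cf.
- by move=> x _; rewrite derive1E; have [] := fg x.
Qed.

Lemma vcons_coord n (a : R) (v : 'rV[R]_n) j :
  vcons (a, v) ord0 (lift ord0 j) = v ord0 j.
Proof. by rewrite mxE liftK. Qed.

Lemma vcons_head n (a : R) (v : 'rV[R]_n) : vcons (a, v) ord0 ord0 = a.
Proof. by rewrite mxE unlift_none. Qed.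

Lemma vcons_cube n M (a : R) (v : 'rV[R]_n) :
  cube M (vcons (a, v)) <-> - M <= a <= M /\ cube M v.
Proof.
split=> [h|[ha hv] i].
  by split=> [|j]; [have := h ord0; rewrite vcons_head|
    have := h (lift ord0 j); rewrite vcons_coord].
by have [j ->|->] := unliftP ord0 i; rewrite ?vcons_head ?vcons_coord//.
Qed.

Lemma continuous_vcons_l n (v : 'rV[R]_n) : continuous (fun a : R => vcons (a, v)).
Proof.
move=> a A /nbhs_rVP[e e0 h]; apply/nbhs_ballP; exists e => // b ab /=.
apply: h => i; have [j ->|->] := unliftP ord0 i.
  by rewrite !vcons_coord subrr normr0.
by rewrite !vcons_head.
Qed.

Lemma continuous_vcons_r n (a : R) : continuous (fun v : 'rV[R]_n => vcons (a, v)).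
Proof.
move=> v A /nbhs_rVP[e e0 h]; apply/nbhs_rVP; exists e => // w vw /=.
apply: h => i; have [j ->|->] := unliftP ord0 i.
  by rewrite !vcons_coord.
by rewrite !vcons_head subrr normr0.
Qed.

Lemma vcons_shift_l n (h a : R) (v : 'rV[R]_n) :
  h *: dirv ord0 + vcons (a, v) = vcons (h + a, v).
Proof.
apply/rowP => i; rewrite !mxE eqxx /=.
have [j ->|->] := unliftP ord0 i; first by rewrite eq_sym (negbTE (neq_lift _ _)) mulr0 add0r.
by rewrite eqxx mulr1.
Qed.

Lemma vcons_shift_r n (h a : R) (v : 'rV[R]_n) j :
  h *: dirv (lift ord0 j) + vcons (a, v) = vcons (a, h *: dirv j + v).
Proof.
apply/rowP => i; rewrite !mxE eqxx /=.
have [k ->|->] := unliftP ord0 i.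
  by rewrite !mxE eqxx/= (inj_eq lift_inj).
by rewrite (negbTE (neq_lift _ _)) mulr0 add0r.
Qed.

(** A derivative along [v] only sees [f] on a line, so it can be computed in any parametrisation [k]
    that carries steps along [w] to steps along [v]. *)
Lemma is_derive_section (V W : normedModType R) (f : V -> R) (k : W -> V)
    (x : W) (v : V) (w : W) df :
  (forall h : R, h *: v + k x = k (h *: w + x)) ->
  is_derive (k x) v f df -> is_derive x w (f \o k) df.
Proof.
move=> hk [fd <-].
have e : (fun h : R => f (h *: v + k x)) = (fun h => (f \o k) (h *: w + x)).
  by apply/funext => h; rewrite hk.
apply: DeriveDef.
  by apply/derivable1P; rewrite -e; move/derivable1P : fd.
by rewrite derive_line -e -derive_line.
Qed.

(** One step of the recursion that defines [lebesgue], together with the integrability that Fubini's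
    theorem asks for. *)
Lemma integral_lebesgueS n (g : 'rV[R]_n.+1 -> R) M : 
  continuous g -> (forall x, ~ cube M x -> g x = 0) ->
  intg (lebesgue_measure \x lebesgue n)%E setT (g \o @vcons R n) /\
  (\int[lebesgue n.+1]_x (g x)%:E =
  \int[(lebesgue_measure \x lebesgue n)%E]_p (g (vcons p))%:E)%E.
Proof.
move=> cg g0.
have mg : measurable_fun setT g by exact: continuous_measurable_rV.
have mgv : measurable_fun setT (g \o @vcons R n).
  by apply: measurableT_comp => //; exact: measurable_vcons.
have [C _ hC] := continuous_supp_bounded (@cube_compact _ _ M) cg g0.
have ig : intg (lebesgue_measure \x lebesgue n)%E setT (g \o @vcons R n).
  have := @intg_supp _ _ _ (lebesgue_measure \x lebesgue n)%E
    (`[- M, M]%classic `*` cube M) (g \o @vcons R n) C; apply => //.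
  - by apply: measurableX => //; exact: cube_measurable.
  - have : (lebesgue_measure `[(- M)%R, M]%classic * lebesgue n (cube M) < +oo)%E.
      apply: lte_mul_pinfty => //.
        by rewrite ge0_fin_numE// lebesgue_measure_itv; case: ifP => _; exact: ltry.
      exact: cube_finite.
    rewrite -product_measure1E//; exact: cube_measurable.
  - by move=> x; exact: hC.
  - move=> [a v] /= h; rewrite g0// => /vcons_cube[h1 h2]; apply: h; split=> //=.
split=> //.
have -> : (\int[lebesgue n.+1]_x (g x)%:E =
  \int[pushforward (lebesgue_measure \x lebesgue n)%E (@vcons R n)]_x (g x)%:E)%E.
  by [].
rewrite integral_pushforward//; first exact: measurable_vcons.
exact/measurable_EFinP.
Qed.

(** Fubini: if [i] is the head coordinate, the inner integral runs along that line and vanishes by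
    the fundamental theorem of calculus; otherwise the head is frozen and the induction hypothesis
    makes the inner integral vanish. *)
Lemma integral_derive n (f g : 'rV[R]_n -> R) (i : 'I_n) M : 0 < M ->
  continuous g -> (forall x, is_derive x (dirv i) f (g x)) ->
  (forall x, ~ cube M x -> f x = 0) -> (forall x, ~ cube M x -> g x = 0) ->
  (\int[lebesgue n]_x (g x)%:E = 0)%E.
Proof.
move=> M0; elim: n => [|n IH] in f g i *; first by case: i.
move=> cg fg f0 g0; have [ig ->] := integral_lebesgueS cg g0.
have [j ij|i0] := unliftP ord0 i.
  rewrite -(integral12_prod_meas1 ig) /=.
  rewrite (eq_integral (cst 0%E)) ?integral0// => a _ /=.
  apply: (IH (fun v => f (vcons (a, v))) _ j).
  - move=> v; apply: (@continuous_comp _ _ _ (fun v => vcons (a, v)) g).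
      exact: continuous_vcons_r.
    exact: cg.
  - move=> v.
    apply: (@is_derive_section _ _ f (fun v => vcons (a, v)) v (dirv i)) => //.
    by move=> h; rewrite ij; exact: vcons_shift_r.
  - by move=> v hv; rewrite f0// => /vcons_cube[].
  - by move=> v hv /=; rewrite g0// => /vcons_cube[].
rewrite -(integral21_prod_meas1 ig) /=.
rewrite (eq_integral (cst 0%E)) ?integral0// => v _ /=.
apply: (@integral_derive_line (fun a => f (vcons (a, v))) _ M) => //.
- move=> a; apply: (@continuous_comp _ _ _ (fun a => vcons (a, v)) g).
    exact: continuous_vcons_l.
  exact: cg.
- move=> a.
  apply: (@is_derive_section _ R f (fun a => vcons (a, v)) a (dirv i)) => //.
  by move=> h; rewrite i0 vcons_shift_l [_%:A]mulr1.
- by move=> a ha; rewrite f0// => /vcons_cube[].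
- by move=> a ha /=; rewrite g0// => /vcons_cube[].
Qed.

End integral_derivative.

(** * Functions determined by their integrals over open sets *)

Section open_generation.
Context {R : realType} {d : nat}.
Local Notation E := 'rV[R]_d.
Local Notation mu := (@lebesgue R d).

Lemma measurable_rV_open (A : set E) : measurable A -> <<s @open E >> A.
Proof.
suff : (measurable : set (set E)) `<=` <<s @open E >> by apply.
apply: smallest_sub; first exact: smallest_sigma_algebra.
rewrite -bigcup_seq => B /= [i _ [Y mY <-]] /=; rewrite setTI.
have sa := smallest_sigma_algebra setT (@open E).
suff : (measurable : set (set R)) `<=`
    [set Y | <<s @open E >> ((fun x : E => x ord0 i) @^-1` Y)] by apply.
rewrite (_ : measurable = <<s @measurable_realfun.RGenOpens.G R >>); last first.
  exact: measurable_realfun.RGenOpens.measurableE.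
apply: smallest_sub.
  have [s0 sC sU] := sa; split=> /=.
  - by rewrite preimage_set0.
  - by move=> C sCC; rewrite setTD preimage_setC -setTD; exact: sC.
  - by move=> F sF; rewrite preimage_bigcup; exact: sU.
move=> _ [a [b ->]] /=; apply: sub_sigma_algebra.
apply: open_comp; last exact: interval_open.
by move=> x _; exact: coord_continuous.
Qed.

(** Monotone class argument: the measurable sets over which [g] integrates to zero form a
    lambda-system, and the open sets are a generating pi-system. *)
Lemma ae_eq0_open (D : set E) (g : E -> R) : measurable D ->
  intg (lebesgue d) D g ->
  (forall U : set E, open U -> \int[lebesgue d]_(x in D) (g x * \1_U x) = 0) ->
  {ae (lebesgue d), forall x, D x -> g x = 0}.
Proof.
move=> mD gi gU.
have mg := intg_meas gi.
pose J A := \int[mu]_(x in D) (g x * \1_A x).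
have gA A : measurable A -> intg mu D (fun x => g x * \1_A x).
  move=> mA; apply: (intg_le mD _ _ (intg_abs gi)).
    by apply: measurable_funM => //; exact: measurable_indic.
  by move=> x _; rewrite normrM ler_piMr// ger0_norm// indicE lern1 leq_b1.
have mH : (measurable : set (set E)) `<=` [set A | measurable A /\ J A = 0].
  apply: (subset_trans measurable_rV_open).
  apply: lambda_system_subset => //.
  - by move=> A B oA oB; exact: openI.
  - split => //.
    + split=> //; exact: (gU _ openT).
    + move=> A B BA [mA JA] [mB JB]; split; first exact: measurableD.
      rewrite /J (_ : \1_(A `\` B) = \1_A - \1_B).
        rewrite -[RHS](subrr 0) -{1}JA -{1}JB -RintegralB//.
        - by apply: eq_Rintegral => x _; rewrite -mulrBr.
        - exact: gA.
        - exact: gA.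
      apply/funext => x; rewrite !fctE !indicE in_setD.
      have [xB|xB] := boolP (x \in B).
        by rewrite (mem_set (BA _ (set_mem xB))) subrr.
      by rewrite subr0 andbT.
    + move=> F ndF HF; have mF n : measurable (F n) by have [] := HF n.
      have mU : measurable (\bigcup_n F n) by exact: bigcup_measurable.
      split=> //.
      have [||_ cv] := @Int_dct _ _ R mu D mD
        (fun n x => g x * \1_(F n) x) (fun x => g x * \1_(\bigcup_n F n) x)
        (fun x => `|g x|) (fun n => intg_meas (gA _ (mF n)))
        (intg_meas (gA _ mU)) _ (intg_abs gi).
      * apply: aeW => x Dx; apply: cvgMr; rewrite indicE.
        have [|xU] := boolP (x \in \bigcup_n F n).
          rewrite inE => -[n _ Fnx]; apply: cvg_near_cst; near=> m.
          rewrite indicE mem_set//.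
          have /ndF/subsetPset : (n <= m)%N by near: m; exact: nbhs_infty_ge.
          exact.
        apply: cvg_near_cst; apply: nearW => n.
        rewrite indicE memNset// => Fnx; move: xU; rewrite notin_setE; apply.
        by exists n.
      * by move=> n x Dx; rewrite normrM ler_piMr// ger0_norm// indicE.
      have : J (F n) @[n --> \oo] --> (0 : R).
        by apply: cvg_near_cst; apply: nearW => n; have [] := HF n.
      by move=> c0; exact: (cvg_unique _ cv c0).
  - by move=> U oU; split; [exact: open_measurable_rV|exact: gU].
have := @integral_ae_eq _ _ R mu D mD (cst 0%E) (EFin \o g) gi.
move=> /(_ (measurable_cst _)) H.
have : ae_eq mu D (EFin \o g) (cst 0%E).
  apply: H => A AD mA; rewrite integral0.
  have [_ JA] := mH A mA.
  have giA : intg mu A g by apply: (integrableS mD mA AD).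
  have fin : (\int[mu]_(x in A) (g x)%:E)%E \is a fin_num by exact: integrable_fin_num giA.
  rewrite /= -(fineK fin) -[RHS]/(0%:E); congr EFin; rewrite -[RHS]JA /J.
  rewrite -[LHS]/(\int[mu]_(x in A) g x) -{1}(setIidr AD) Rintegral_mkcondr.
  apply: eq_Rintegral => x _; rewrite patchE indicE.
  by case: (x \in A); rewrite ?mulr1 ?mulr0.
apply: filterS => x h Dx; by have [] := h Dx.
Unshelve. all: by end_near. Qed.

End open_generation.

Section test_functions.
Context {R : realType} {d : nat}.
Variable L : R.
Hypothesis L0 : 0 < L.
Local Notation E := 'rV[R]_d.
Local Notation mu := (@lebesgue R d).
Local Notation D := (@cube R d L).
Local Notation test := (test_function D).
Local Notation Int f := (Rintegral mu D f).
Implicit Types f g phi psi : E -> R.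

Let mD : measurable D := cube_measurable L.
Let muD : (mu D < +oo)%E := cube_finite L.

Lemma pderiv_supp (K : set E) f i x : closed K -> (forall x, ~ K x -> f x = 0) ->
  ~ K x -> pderiv i f x = 0.
Proof.
move=> cK f0 Kx; rewrite /pderiv.
rewrite (@near_eq_derive _ _ _ f (cst 0)) ?derive_cst//.
have : nbhs x (~` K) by apply: open_nbhs_nbhs; split => //; exact: closed_openC.
by apply: filterS => y /f0 ->.
Qed.

Lemma test_smooth phi : test phi -> smooth phi.
Proof. by case. Qed.

Lemma test_out phi x : test phi -> ~ D° x -> phi x = 0.
Proof. by move=> [_ [K [_ KD] h]] Dx; apply: h => /KD. Qed.

Lemma test_outD phi x : test phi -> ~ D x -> phi x = 0.
Proof. by move=> tp Dx; apply: (test_out tp) => /interior_subset. Qed.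

Lemma test_continuous phi : test phi -> continuous phi.
Proof. by move=> /test_smooth/smooth_continuous. Qed.

Lemma test_bounded phi : test phi -> exists2 C : R, 0 <= C & forall x, `|phi x| <= C.
Proof.
move=> tp; apply: (continuous_supp_bounded (@cube_compact _ _ L)).
  exact: test_continuous.
by move=> x; exact: test_outD.
Qed.

Lemma test_pderiv phi i : test phi -> test (pderiv i phi).
Proof.
move=> [sp [K [cK KD] h]]; split; first exact: smooth_pderiv.
exists K => // x; apply: pderiv_supp => //.
by apply: compact_closed => //; exact: rV_hausdorff.
Qed.

Lemma testM phi f : test phi -> smooth f -> test (fun x => phi x * f x).
Proof.
move=> [sp [K [cK KD] h]] sf; split; first exact: smoothM.
by exists K => // x /h ->; rewrite mul0r.
Qed.

Lemma testZ a phi : test phi -> test (fun x => a * phi x).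
Proof.
move=> [sp [K [cK KD] h]]; split; first exact: smoothZ.
by exists K => // x /h ->; rewrite mulr0.
Qed.

(** The union of the two compact sets serves for [h]. Besides sums this covers nonlinear
    combinations such as [qmean]. *)
Lemma test_comb phi psi (h : E -> R) : test phi -> test psi -> smooth h ->
  (forall x, phi x = 0 -> psi x = 0 -> h x = 0) -> test h.
Proof.
move=> [_ [K [cK KD] hK]] [_ [K' [cK' KD'] hK']] sh h0; split=> //.
exists (K `|` K'); first by split; [exact: compactU|move=> x [/KD|/KD']].
by move=> x /not_orP[/hK p0 /hK' q0]; exact: h0.
Qed.

Lemma testB phi psi : test phi -> test psi -> test (fun x => phi x - psi x).
Proof.
move=> tp tq; apply: (test_comb tp tq).
  by apply: smoothB; exact: test_smooth.
by move=> x -> ->; rewrite subrr.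
Qed.

Lemma test0 : test (fun=> 0).
Proof. split; first exact: smooth_cst.
by exists set0 => //; split => //; exact: compact0. Qed.

Lemma test_sum (I : Type) (s : seq I) (F : I -> E -> R) :
  (forall i, test (F i)) -> test (fun x => \sum_(i <- s) F i x).
Proof.
move=> tF; elim: s => [|a s IH].
  rewrite (_ : (fun _ => _) = fun=> 0); first exact: test0.
  by apply/funext => x; rewrite big_nil.
rewrite (_ : (fun _ => _) = fun x => F a x + \sum_(i <- s) F i x); last first.
  by apply/funext => x; rewrite big_cons.
apply: (test_comb (tF a) IH); last by move=> x -> ->; rewrite addr0.
by apply: smoothD; exact: test_smooth.
Qed.

Lemma smooth_meas f (A : set E) : measurable A -> smooth f -> measurable_fun A f.
Proof. by move=> mA sf; apply: continuous_measurable_rV => //; exact: smooth_continuous. Qed.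

Lemma test_sq phi : test phi -> sq_intg mu D phi.
Proof.
move=> tp; have [C _ hC] := test_bounded tp.
apply: (sq_intg_bounded mD muD (M := C)) => [|x _]; last exact: hC.
by apply: smooth_meas => //; exact: test_smooth.
Qed.

Lemma Int_pderiv0 phi i : test phi -> Int (pderiv i phi) = 0.
Proof.
move=> tp; rewrite Rintegral_mkcond.
rewrite (_ : patch _ _ _ = pderiv i phi); last first.
  apply/funext => x; rewrite patchE; case: ifPn => //; rewrite notin_setE => Dx.
  by rewrite (test_outD (test_pderiv i tp) Dx).
have dp x : is_derive x (dirv i) phi (pderiv i phi x).
  by apply: derivableP; apply: smooth_derivable; exact: test_smooth.
have := @integral_derive R d phi (pderiv i phi) i L L0
  (test_continuous (test_pderiv i tp)) dp.
rewrite /Rintegral => ->//; first by move=> x; exact: test_outD.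
by move=> x; exact: test_outD (test_pderiv i tp).
Qed.

Lemma test_pderivM phi f i x : test phi -> smooth f ->
  pderiv i (fun x => phi x * f x) x = phi x * pderiv i f x + f x * pderiv i phi x.
Proof.
move=> tp sf; have dp : derivable phi x (dirv i).
  by apply: smooth_derivable; exact: test_smooth tp.
have df : derivable f x (dirv i) by exact: smooth_derivable.
exact: (deriveM dp df).
Qed.

Lemma test_ibp phi psi i : test phi -> test psi ->
  Int (fun x => phi x * pderiv i psi x) = - Int (fun x => pderiv i phi x * psi x).
Proof.
move=> tp tq; apply/eqP; rewrite -addr_eq0; apply/eqP.
have tp' := test_pderiv i tp; have tq' := test_pderiv i tq.
rewrite -RintegralD//; [|exact: (sq_intgM mD (test_sq _) (test_sq _))..].
rewrite -(Int_pderiv0 i (testM tp (test_smooth tq))).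
apply: eq_Rintegral => x _.
rewrite [RHS](test_pderivM i x tp (test_smooth tq)).
by rewrite [psi x * _]mulrC.
Qed.

Definition bump (a b x : E) : R :=
  \prod_i (flat 0 (x ord0 i - a ord0 i) * flat 0 (b ord0 i - x ord0 i)).

Definition cbox (a b : E) : set E :=
  [set x | forall i, x ord0 i \in `[a ord0 i, b ord0 i]].

Lemma cbox_compact a b : compact (cbox a b).
Proof.
exact: (@rV_compact _ d (fun i => `[a ord0 i, b ord0 i]%classic)
  (fun i => @segment_compact _ _ _)).
Qed.

Lemma smooth_bump a b : smooth (bump a b).
Proof.
apply: smooth_prod => i _; apply: smoothM; apply: smooth_flat; apply: smoothB;
  by [exact: smooth_cst|exact: smooth_coord].
Qed.

Lemma bump_ge0 a b x : 0 <= bump a b x.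
Proof. by apply: prodr_ge0 => i _; rewrite mulr_ge0// flat_ge0. Qed.

Lemma bump_gt0 a b x : obox a b x -> 0 < bump a b x.
Proof.
move=> h; apply: prodr_gt0 => i _; have := h i; rewrite in_itv/= => /andP[? ?].
by rewrite mulr_gt0// flat_gt0// subr_gt0.
Qed.

Lemma bump_out a b x : ~ obox a b x -> bump a b x = 0.
Proof.
move=> /existsNP[i]; rewrite in_itv/= => /negP; rewrite negb_and -!leNgt => h.
apply/eqP/prodf_eq0; exists i => //; rewrite mulf_eq0.
by case/orP: h => h; apply/orP; [left|right]; rewrite flat_le0// subr_le0.
Qed.

Lemma obox_cbox a b : obox a b `<=` cbox a b.
Proof. by move=> x h i; have := h i; rewrite !in_itv/= => /andP[/ltW -> /ltW ->]. Qed.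

Lemma test_bump a b : cbox a b `<=` D° -> test (bump a b).
Proof.
move=> h; split; first exact: smooth_bump.
exists (cbox a b); first by split=> //; exact: cbox_compact.
by move=> x hx; apply: bump_out => /obox_cbox.
Qed.

(** The closed box lies in [U], so that its bump has compact support there; rational corners leave
    countably many boxes. *)
Lemma open_boxes (U : set E) x : open U -> U x ->
  exists p : 'rV[rat]_d * 'rV[rat]_d,
    cbox (map_mx ratr p.1) (map_mx ratr p.2) `<=` U /\
    obox (map_mx ratr p.1) (map_mx ratr p.2) x.
Proof.
move=> oU Ux; have /nbhs_rVP[e e0 he] : nbhs x U by exact: open_nbhs_nbhs.
have H (i : 'I_d) : exists q : rat * rat,
    x ord0 i - e < ratr q.1 < x ord0 i /\ x ord0 i < ratr q.2 < x ord0 i + e.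
  have xe : x ord0 i - e < x ord0 i by rewrite ltrBlDr ltrDl.
  have xe' : x ord0 i < x ord0 i + e by rewrite ltrDl.
  have [q1 hq1] := rat_in_itvoo xe; have [q2 hq2] := rat_in_itvoo xe'.
  by exists (q1, q2); split; [move: hq1|move: hq2]; rewrite in_itv.
have [q hq] := choice H.
exists (\row_i (q i).1, \row_i (q i).2); split => /= [y By|i].
  apply: he => i; have := By i; rewrite !mxE in_itv/=.
  have [/andP[h1 h2] /andP[h3 h4]] := hq i; move=> /andP[h5 h6].
  rewrite ltr_norml; apply/andP; split; lra.
by rewrite !mxE in_itv/=; have [/andP[_ ->] /andP[-> _]] := hq i.
Qed.

(** The closed and the open cube have the same measure, a finite product of interval lengths. *)
Lemma cube_boundary_null : {ae mu, forall x, D x -> D° x}.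
Proof.
exists (D `\` D°); split.
- by apply: measurableD => //; apply: open_measurable_rV; exact: open_interior.
- pose P := (\prod_(i < d) lebesgue_measure (`](- L)%R, L[%classic : set R))%E.
  have lDo : mu D° = P.
    rewrite (_ : D° = [set x : E | forall i, `]- L, L[%classic (x ord0 i)]).
      by apply: (@lebesgue_box R d (fun=> `]- L, L[%classic)) => i; exact: measurable_itv.
    rewrite cube_interior; apply/seteqP.
    by split=> x /= h i; have := h i; rewrite in_itv.
  have lD : mu D = P.
    rewrite (_ : D = [set x : E | forall i, `[- L, L]%classic (x ord0 i)]).
      transitivity (\prod_(i < d) lebesgue_measure (`[(- L)%R, L]%classic : set R))%E.
        by apply: (@lebesgue_box R d (fun=> `[- L, L]%classic)) => i; exact: measurable_itv.
      by apply: eq_bigr => i _; rewrite !lebesgue_measure_itv.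
    by apply/seteqP; split=> x /= h i; have := h i; rewrite in_itv.
  rewrite measureD//; last by apply: open_measurable_rV; exact: open_interior.
  rewrite (setIidr (@interior_subset _ _)) [X in (X - _)%E]lD [X in (_ - X)%E]lDo.
  rewrite subee// /P; elim/big_ind : _ => // [x y|i _]; first exact: fin_numM.
  by rewrite /= lebesgue_measure_itv; case: ifP => // _; rewrite -EFinB.
- by move=> x /= /not_implyP[].
Qed.

(** Reduced to integrals over open sets [W]: the indicator of [W] is a bounded pointwise limit of
    test functions built from countably many bumps inside [W]. *)
Lemma fundamental_lemma g : intg mu D g ->
  (forall phi, test phi -> Int (fun x => g x * phi x) = 0) ->
  {ae mu, forall x, D x -> g x = 0}.
Proof.
move=> gi g0; have mg := intg_meas gi.
suff : {ae mu, forall x, D x -> g x * \1_(D°) x = 0}.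
  apply: filterS2 cube_boundary_null => x Dx h xD.
  by have := h xD; rewrite indicE (mem_set (Dx xD)) mulr1.
have mDo : measurable (D° : set E) by apply: open_measurable_rV; exact: open_interior.
have gA (A : set E) : measurable A -> intg mu D (fun x => g x * \1_A x).
  move=> mA; apply: (intg_le mD _ _ (intg_abs gi)).
    by apply: measurable_funM => //; exact: measurable_indic.
  by move=> x _; rewrite normrM ler_piMr// ger0_norm// indicE lern1 leq_b1.
apply: ae_eq0_open => // [|U oU]; first exact: gA.
pose W := D° `&` U.
have oW : open W by apply: openI => //; exact: open_interior.
(* An enumeration of the rational boxes inside [W]; every other index gets the zero function. *)
pose P (k : nat) : E -> R := if @unpickle ('rV[rat]_d * 'rV[rat]_d)%type k is Some p then
  if `[< cbox (map_mx ratr p.1) (map_mx ratr p.2) `<=` W >] then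
    bump (map_mx ratr p.1) (map_mx ratr p.2) else cst 0 else cst 0.
have tP k : test (P k).
  rewrite /P; case: unpickle => [p|]; last exact: test0.
  case: ifPn => [/asboolP h|_]; last exact: test0.
  by apply: test_bump => x /h[].
have P0 k x : 0 <= P k x.
  rewrite /P; case: unpickle => // p; case: ifP => // _; exact: bump_ge0.
have PW k x : ~ W x -> P k x = 0.
  rewrite /P; case: unpickle => // p; case: ifPn => // /asboolP h Wx.
  by apply: bump_out => /obox_cbox /h.
pose S n x := \sum_(k < n) P k x.
have S0 n x : 0 <= S n x by exact: sumr_ge0.
have tS n : test (S n).
  by apply: (@test_sum _ (index_enum 'I_n) (fun k => P k)) => k; exact: tP.
have Sn n x : S n x + n.+1%:R^-1 != 0.
  by rewrite gt_eqF// ltr_wpDl// invr_gt0 ltr0n.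
(* Lies between 0 and 1, is 0 off [W], and tends to 1 at every point of [W]: some bump is positive
   there and keeps [S n] away from 0. *)
pose Q n x := S n x * (S n x + n.+1%:R^-1)^-1.
have tQ n : test (Q n).
  apply: testM; first exact: tS.
  apply: smoothV; last exact: Sn.
  by apply: smoothD; [exact: test_smooth (tS n)|exact: smooth_cst].
have Q01 n x : 0 <= Q n x <= 1.
  rewrite mulr_ge0 ?invr_ge0 ?addr_ge0//=.
  by rewrite ler_pdivrMr ?mul1r ?lerDl// ltr_wpDl// invr_gt0 ltr0n.
have [|||_ cv] := @Int_dct _ _ R mu D mD
    (fun n x => g x * Q n x) (fun x => g x * \1_W x)
    (fun x => `|g x|) _ (intg_meas (gA _ (open_measurable_rV oW))) _ (intg_abs gi).
- move=> n; apply: measurable_funM => //; apply: smooth_meas => //.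
  exact: test_smooth (tQ n).
- apply: aeW => x Dx; apply: cvgMr; rewrite indicE.
  have [/set_mem Wx|xW] := boolP (x \in W); last first.
    apply: cvg_near_cst; apply: nearW => n; rewrite /Q /S big1 ?mul0r// => k _.
    by apply: PW => /mem_set; apply/negP.
  have [p [pW px]] := open_boxes oW Wx.
  pose k0 := pickle p.
  have Pk0 : 0 < P k0 x.
    rewrite /P /k0 pickleK; case: ifPn => [_|]; first exact: bump_gt0.
    by move=> /asboolP.
  apply/cvgrPdist_le => e e0; near=> n.
  have kn : (k0 < n)%N by near: n; exact: nbhs_infty_gt.
  have SP : P k0 x <= S n x.
    rewrite /S (bigD1 (Ordinal kn))//= lerDl; exact: sumr_ge0.
  have S1 : 0 < S n x by exact: lt_le_trans SP.
  have n0 : 0 < n.+1%:R^-1 :> R by rewrite invr_gt0 ltr0n.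
  have -> : 1 - Q n x = n.+1%:R^-1 / (S n x + n.+1%:R^-1).
    apply: (mulIf (Sn n x)); rewrite mulrBl mul1r /Q !mulfVK//; by ring.
  rewrite ger0_norm ?mulr_ge0 ?invr_ge0 ?addr_ge0//.
  rewrite ler_pdivrMr ?addr_gt0//.
  apply: (@le_trans _ _ (e * P k0 x)); last first.
    by rewrite ler_pM2l// (le_trans SP)// lerDl.
  apply/ltW; near: n; exact: (near_infty_natSinv_lt (PosNum (mulr_gt0 e0 Pk0))).
- move=> n x _; rewrite normrM ler_piMr//.
  by have /andP[h1 h2] := Q01 n x; rewrite ger0_norm.
have : \int[mu]_(x in D) (g x * Q n x) @[n --> \oo] --> (0 : R).
  by apply: cvg_near_cst; apply: nearW => n; exact: g0.
move=> /(cvg_unique _ cv) e; rewrite -e.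
by apply: eq_Rintegral => x _; rewrite /W indicI /= -mulrA.
Unshelve. all: by end_near. Qed.

End test_functions.

(** * Weak gradients *)

Lemma cvg_sumr {R : realType} (T I : Type) (F : set_system T) {FF : Filter F}
    (s : seq I) (f : I -> T -> R) (l : I -> R) :
  (forall i, f i t @[t --> F] --> l i) ->
  \sum_(i <- s) f i t @[t --> F] --> \sum_(i <- s) l i.
Proof.
move=> fl; elim: s => [|a s IH].
  rewrite big_nil (_ : (fun _ => _) = cst 0); first exact: cvg_cst.
  by apply/funext => t; rewrite big_nil.
rewrite big_cons (_ : (fun _ => _) = fun t => f a t + \sum_(i <- s) f i t).
  exact: cvgD.
by apply/funext => t; rewrite big_cons.
Qed.

Section L2_convergence.
Context {disp : measure_display} {T : measurableType disp} {R : realType}.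
Variables (mu : {measure set T -> \bar R}) (D : set T).
Hypothesis mD : measurable D.
Local Notation Int f := (Rintegral mu D f).
Local Notation sq := (sq_intg mu D).
Implicit Types f g h : T -> R.

Definition L2cvg (f_ : nat -> T -> R) f : Prop :=
  Int (fun x => (f_ n x - f x) ^+ 2) @[n --> \oo] --> (0 : R).

Lemma cvg0_le (a b : nat -> R) : (forall n, 0 <= a n <= b n) ->
  b @ \oo --> (0 : R) -> a @ \oo --> (0 : R).
Proof.
move=> ab; apply: (@squeeze_cvgr _ _ _ _ (cst 0)); last exact: cvg_cst.
exact: nearW.
Qed.

Lemma Int_mul_cvg0 (a : nat -> T -> R) b : (forall n, sq (a n)) -> sq b ->
  Int (fun x => a n x ^+ 2) @[n --> \oo] --> (0 : R) ->
  Int (fun x => a n x * b x) @[n --> \oo] --> (0 : R).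
Proof.
move=> sa sb ca; apply/cvgr0Pnorm_le => e e0.
pose B := Int (fun x => b x ^+ 2).
have B0 : 0 <= B by exact: Int_sq_ge0.
(* The weight in Young's inequality that makes the contribution of the fixed factor [b] at most
   [e / 2]; [B + 1] keeps it positive. *)
pose k := 2 * (B + 1) / e.
have k0 : 0 < k by rewrite divr_gt0// mulr_gt0// ltr_wpDl.
near=> n; have := Int_young mD (sa n) sb k0; move/le_trans; apply.
have h1 : k^-1 * B <= e / 2.
  rewrite /k invf_div -mulrA ler_pM2l// mulrC ler_pdivrMr ?mulr_gt0 ?ltr_wpDl//.
  lra.
have h2 : k * Int (fun x => a n x ^+ 2) <= e / 2.
  rewrite -ler_pdivlMl//; apply: le_trans (ler_norm _) _.
  near: n; move/cvgr0Pnorm_le : ca; apply.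
  by rewrite mulr_gt0 ?invr_gt0// divr_gt0.
by rewrite /B in h1; lra.
Unshelve. all: by end_near. Qed.

Lemma L2cvgB (f_ g_ : nat -> T -> R) f g :
  (forall n, sq (f_ n)) -> (forall n, sq (g_ n)) -> sq f -> sq g ->
  L2cvg f_ f -> L2cvg g_ g ->
  L2cvg (fun n x => f_ n x - g_ n x) (fun x => f x - g x).
Proof.
move=> sf_ sg_ sf sg cf cg.
pose b n := 2 * Int (fun x => (f_ n x - f x) ^+ 2) +
  2 * Int (fun x => (g_ n x - g x) ^+ 2).
apply: (@cvg0_le _ b); last first.
  rewrite (_ : 0 = 2 * 0 + 2 * 0 :> R); last by rewrite mulr0 addr0.
  by apply: cvgD; apply: cvgMr.
move=> n; rewrite Int_sq_ge0/=.
have s1 := sq_intgB mD (sf_ n) sf; have s2 := sq_intgB mD (sg_ n) sg.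
rewrite /b -(RintegralZl 2 mD s1.2) -(RintegralZl 2 mD s2.2).
rewrite -RintegralD//; [|exact: intgZ s1.2|exact: intgZ s2.2].
apply: (Int_le mD).
- exact: (sq_intgB mD (sq_intgB mD (sf_ n) (sg_ n)) (sq_intgB mD sf sg)).2.
- by apply: intgD => //; [exact: intgZ s1.2|exact: intgZ s2.2].
move=> x _; rewrite -subr_ge0.
rewrite (_ : _ - _ = (f_ n x - f x + (g_ n x - g x)) ^+ 2) ?sqr_ge0//.
by ring.
Qed.

Lemma L2cvgZ k (f_ : nat -> T -> R) f :
  (forall n, sq (f_ n)) -> sq f -> L2cvg f_ f ->
  L2cvg (fun n x => k * f_ n x) (fun x => k * f x).
Proof.
move=> sf_ sf cf; rewrite /L2cvg.
rewrite (_ : (fun n => _) =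
    fun n => k ^+ 2 * Int (fun x => (f_ n x - f x) ^+ 2)); last first.
  apply/funext => n; rewrite -RintegralZl//; last exact: (sq_intgB mD (sf_ n) sf).2.
  by apply: eq_Rintegral => x _; ring.
by rewrite -(mulr0 (k ^+ 2)); exact: cvgMr.
Qed.

End L2_convergence.

Section weak_gradients.
Context {R : realType} {d : nat}.
Variable L : R.
Hypothesis L0 : 0 < L.
Local Notation E := 'rV[R]_d.
Local Notation mu := (@lebesgue R d).
Local Notation D := (@cube R d L).
Local Notation test := (test_function D).
Local Notation Int f := (Rintegral mu D f).
Local Notation sq := (sq_intg mu D).
Implicit Types (f g phi psi : E -> R) (G H : 'I_d -> E -> R).

Let mD : measurable D := cube_measurable L.
Let muD : (mu D < +oo)%E := cube_finite L.

(** The closure in L^2 of the gradient on test functions, i.e. strong derivatives. [is_grad_H01] and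
    [H01_is_grad] identify it with membership in [H01]; unlike [wderiv] it involves no choice, so
    explicit gradients can be supplied. *)
Definition is_grad f G : Prop :=
  [/\ sq f, forall i, sq (G i) & exists2 phi : nat -> E -> R,
     forall n, test (phi n) &
     L2cvg mu D phi f /\ forall i, L2cvg mu D (fun n => pderiv i (phi n)) (G i)].

Lemma L2P f : L2 D f <-> sq f.
Proof. by split=> /(sq_intgP _ mD). Qed.

(** Subtracting the integration by parts formula for [phi n] leaves an expression that does not
    depend on [n] and tends to zero. *)
Lemma is_wderiv_lim f g (phi : nat -> E -> R) i :
  sq f -> sq g -> (forall n, test (phi n)) -> L2cvg mu D phi f ->
  L2cvg mu D (fun n => pderiv i (phi n)) g -> is_wderiv D i f g.
Proof.
move=> sf sg tp cf cg; split; first exact/L2P.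
move=> psi tq; have tq' := test_pderiv i tq.
have sq' := test_sq tq'; have sqq := test_sq tq.
have sp n := test_sq (tp n); have sp' n := test_sq (test_pderiv i (tp n)).
have c1 := Int_mul_cvg0 mD (fun n => sq_intgB mD (sp n) sf) sq' cf.
have c2 := Int_mul_cvg0 mD (fun n => sq_intgB mD (sp' n) sg) sqq cg.
have c12 : Int (fun x => (phi n x - f x) * pderiv i psi x) +
    Int (fun x => (pderiv i (phi n) x - g x) * psi x) @[n --> \oo] --> (0 + 0 : R).
  exact: cvgD c1 c2.
set A := Int (fun x => f x * pderiv i psi x); set B := Int (fun x => g x * psi x).
have c3 : Int (fun x => (phi n x - f x) * pderiv i psi x) +
    Int (fun x => (pderiv i (phi n) x - g x) * psi x) @[n --> \oo] --> - (A + B).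
  apply: cvg_near_cst; apply: nearW => n.
  have e1 : Int (fun x => (phi n x - f x) * pderiv i psi x) =
      Int (fun x => phi n x * pderiv i psi x) - Int (fun x => f x * pderiv i psi x).
    rewrite -RintegralB//; [|exact: sq_intgM..].
    by apply: eq_Rintegral => x _; ring.
  have e2 : Int (fun x => (pderiv i (phi n) x - g x) * psi x) =
      Int (fun x => pderiv i (phi n) x * psi x) - Int (fun x => g x * psi x).
    rewrite -RintegralB//; [|exact: sq_intgM..].
    by apply: eq_Rintegral => x _; ring.
  by rewrite e1 e2 (test_ibp L0 i (tp n) tq) /A /B; ring.
have e : - (A + B) = 0 + 0 by exact: (cvg_unique _ c3 c12).
lra.
Qed.

Lemma wderiv_unique f g1 g2 i : is_wderiv D i f g1 -> is_wderiv D i f g2 ->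
  {ae mu, forall x, D x -> g1 x = g2 x}.
Proof.
move=> [/L2P s1 h1] [/L2P s2 h2].
have s := sq_intgB mD s1 s2.
have : {ae mu, forall x, D x -> g1 x - g2 x = 0}.
  apply: fundamental_lemma.
    exact: sq_intg_intg s.
  move=> phi tp; have sp := test_sq tp.
  transitivity (Int (fun x => g1 x * phi x) - Int (fun x => g2 x * phi x)).
    rewrite -RintegralB//; [|exact: sq_intgM..].
    by apply: eq_Rintegral => x _; ring.
  apply/eqP; rewrite subr_eq0 -eqr_opp; apply/eqP.
  by rewrite -(h1 _ tp) -(h2 _ tp).
by apply: filterS => x h Dx; apply/eqP; rewrite -subr_eq0 h.
Qed.

Lemma wderivP f i : (exists g, is_wderiv D i f g) -> is_wderiv D i f (wderiv D i f).
Proof. by move=> h; apply: (xgetPex (cst 0)). Qed.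

(** [wderiv] is a chosen representative, so a computed derivative can be identified with it only
    almost everywhere. *)
Lemma wderiv_ae f g i : is_wderiv D i f g ->
  {ae mu, forall x, D x -> wderiv D i f x = g x}.
Proof. by move=> h; apply: (wderiv_unique _ h); apply: wderivP; exists g. Qed.

Lemma is_wderiv_sq f g i : is_wderiv D i f g -> sq g.
Proof. by move=> [/L2P]. Qed.

Lemma is_grad_wderiv f G i : is_grad f G -> is_wderiv D i f (G i).
Proof.
by move=> [sf sG [phi tp [cf cG]]]; apply: (is_wderiv_lim sf (sG i) tp cf (cG i)).
Qed.

Lemma is_wderivB f g f' g' i : sq f -> sq f' ->
  is_wderiv D i f g -> is_wderiv D i f' g' ->
  is_wderiv D i (f \- f') (fun x => g x - g' x).
Proof.
move=> sf sf' [/L2P s1 h1] [/L2P s2 h2].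
split; first by apply/L2P; exact: sq_intgB.
move=> phi tp; have sp := test_sq tp; have sp' := test_sq (test_pderiv i tp).
transitivity (Int (fun x => f x * pderiv i phi x) - Int (fun x => f' x * pderiv i phi x)).
  rewrite -RintegralB//; [|exact: sq_intgM..].
  by apply: eq_Rintegral => x _ /=; ring.
rewrite h1// h2// -opprD; congr (- _).
rewrite -RintegralB//; [|exact: sq_intgM..].
by apply: eq_Rintegral => x _; ring.
Qed.

Lemma Int_sum_sq (F : 'I_d -> E -> R) : (forall i, sq (F i)) ->
  intg mu D (fun x => \sum_i F i x ^+ 2) /\
  Int (fun x => \sum_i F i x ^+ 2) = \sum_i Int (fun x => F i x ^+ 2).
Proof.
move=> sF; split; first by apply: intg_sum => // i _; exact: (sF i).2.
by rewrite Int_sum// => i _; exact: (sF i).2.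
Qed.

Lemma H1norm_wderiv f G : sq f -> (forall i, is_wderiv D i f (G i)) ->
  H1norm D f = Num.sqrt (Int (fun x => f x ^+ 2) + \sum_i Int (fun x => G i x ^+ 2)).
Proof.
move=> sf wG; rewrite /H1norm; congr Num.sqrt.
have sG i := is_wderiv_sq (wG i).
have sw i : sq (wderiv D i f) by apply: is_wderiv_sq; apply: wderivP; exists (G i).
have [iw ew] := Int_sum_sq sw; have [iG eG] := Int_sum_sq sG.
rewrite RintegralD//; last exact: sf.2.
rewrite ew; congr (_ + _); apply: eq_bigr => i _.
apply: Int_ae_eq => //; [exact: intg_meas (sw i).2|exact: intg_meas (sG i).2|].
by apply: filterS (wderiv_ae (wG i)) => x h Dx; rewrite h.
Qed.

Lemma H1norm_grad f G : is_grad f G ->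
  H1norm D f = Num.sqrt (Int (fun x => f x ^+ 2) + \sum_i Int (fun x => G i x ^+ 2)).
Proof.
move=> gf; apply: H1norm_wderiv; first by case: gf.
by move=> i; exact: is_grad_wderiv.
Qed.

Lemma test_is_grad phi : test phi -> is_grad phi (fun i => pderiv i phi).
Proof.
move=> tp; split; first exact: test_sq.
  by move=> i; exact: test_sq (test_pderiv i tp).
exists (fun=> phi) => //; split=> [|i]; rewrite /L2cvg; under eq_fun do
  under eq_Rintegral do rewrite subrr expr0n/=.
  by rewrite Rintegral_cst// mul0r; exact: cvg_cst.
by rewrite Rintegral_cst// mul0r; exact: cvg_cst.
Qed.

Lemma is_gradB f G g H : is_grad f G -> is_grad g H ->
  is_grad (f \- g) (fun i x => G i x - H i x).
Proof.
move=> [sf sG [phi tp [cf cG]]] [sg sH [psi tq [cg cH]]]; split.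
- exact: sq_intgB.
- by move=> i; exact: sq_intgB.
exists (fun n x => phi n x - psi n x); first by move=> n; exact: testB.
split.
  by apply: L2cvgB => // n; exact: test_sq.
move=> i; rewrite (_ : (fun n => _) =
    fun n x => pderiv i (phi n) x - pderiv i (psi n) x).
  by apply: L2cvgB => // n; apply: test_sq; exact: test_pderiv.
apply/funext => n; apply/funext => x.
have d1 : derivable (phi n) x (dirv i) by apply: smooth_derivable; exact: test_smooth (tp n).
have d2 : derivable (psi n) x (dirv i) by apply: smooth_derivable; exact: test_smooth (tq n).
exact: (deriveB d1 d2).
Qed.

Lemma is_gradZ k f G : is_grad f G ->
  is_grad (fun x => k * f x) (fun i x => k * G i x).
Proof.
move=> [sf sG [phi tp [cf cG]]]; split.
- exact: sq_intgZ.
- by move=> i; exact: sq_intgZ.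
exists (fun n x => k * phi n x); first by move=> n; exact: testZ.
split; first by apply: L2cvgZ => // n; exact: test_sq.
move=> i; rewrite (_ : (fun n => _) = fun n x => k * pderiv i (phi n) x).
  by apply: L2cvgZ => // n; apply: test_sq; exact: test_pderiv.
apply/funext => n; apply/funext => x.
have d1 : derivable (phi n) x (dirv i) by apply: smooth_derivable; exact: test_smooth (tp n).
exact: (deriveZ k d1).
Qed.

Lemma is_grad_H01 f G : is_grad f G -> H01 D f.
Proof.
move=> gf; have [sf sG [phi tp [cf cG]]] := gf; split.
  split; first exact/L2P.
  by move=> i; exists (G i); exact: is_grad_wderiv.
exists phi => //.
have e n : H1norm D (phi n \- f) = Num.sqrt (Int (fun x => (phi n x - f x) ^+ 2) +
    \sum_i Int (fun x => (pderiv i (phi n) x - G i x) ^+ 2)).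
  by rewrite (H1norm_grad (is_gradB (test_is_grad (tp n)) gf)).
have c : Int (fun x => (phi n x - f x) ^+ 2) +
    \sum_i Int (fun x => (pderiv i (phi n) x - G i x) ^+ 2) @[n --> \oo] --> (0 : R).
  have c2 := @cvg_sumr R _ _ _ _ (index_enum 'I_d) _ _ cG; rewrite big1// in c2.
  by rewrite -[X in _ --> X](addr0 (0 : R)); exact: (cvgD cf (c2 _)).
rewrite (_ : (fun n => _) = fun n => Num.sqrt (Int (fun x => (phi n x - f x) ^+ 2) +
    \sum_i Int (fun x => (pderiv i (phi n) x - G i x) ^+ 2))); last exact/funext.
have := @continuous_cvg _ _ _ _ _ _ (@Num.sqrt R) 0 (@sqrt_continuous R 0) c.
by rewrite sqrtr0 => h; exact: (h _).
Qed.

Lemma H01_is_grad f : H01 D f -> is_grad f (fun i => wderiv D i f).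
Proof.
move=> [[/L2P sf ef] [phi tp cp]].
have wf i := wderivP (ef i); have sw i := is_wderiv_sq (wf i).
have e n : H1norm D (phi n \- f) ^+ 2 = Int (fun x => (phi n x - f x) ^+ 2) +
    \sum_i Int (fun x => (pderiv i (phi n) x - wderiv D i f x) ^+ 2).
  have sp := test_sq (tp n).
  rewrite (@H1norm_wderiv _ (fun i x => pderiv i (phi n) x - wderiv D i f x)).
  - rewrite sqr_sqrtr// addr_ge0 ?Int_sq_ge0// sumr_ge0// => i _.
    exact: Int_sq_ge0.
  - exact: sq_intgB.
  - move=> i; apply: is_wderivB => //.
    exact: is_grad_wderiv (test_is_grad (tp n)).
have c2 : H1norm D (phi n \- f) ^+ 2 @[n --> \oo] --> (0 : R).
  rewrite -(mulr0 (0 : R)); under eq_fun do rewrite expr2.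
  exact: cvgM.
have S0 n : 0 <= \sum_i Int (fun x => (pderiv i (phi n) x - wderiv D i f x) ^+ 2).
  by apply: sumr_ge0 => i _; exact: Int_sq_ge0.
split=> //; exists phi => //; split.
  apply: cvg0_le c2 => n; rewrite Int_sq_ge0 e lerDl; exact: S0.
move=> i; apply: cvg0_le c2 => n; rewrite Int_sq_ge0/= e.
rewrite (bigD1 i)//= addrCA lerDl addr_ge0 ?Int_sq_ge0// sumr_ge0// => j _.
exact: Int_sq_ge0.
Qed.

End weak_gradients.

(** * Euclidean geometry and simplices *)

Section euclidean.
Context {R : realType} {d : nat}.
Local Notation E := 'rV[R]_d.
Implicit Types (u v x y : E) (a : R).

Lemma dotvC u v : dotv u v = dotv v u.
Proof. by apply: eq_bigr => i _; rewrite mulrC. Qed.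

Lemma dotvDl u v x : dotv (u + v) x = dotv u x + dotv v x.
Proof. by rewrite /dotv -big_split; apply: eq_bigr => i _; rewrite mxE mulrDl. Qed.

Lemma dotvZl a u x : dotv (a *: u) x = a * dotv u x.
Proof. by rewrite /dotv mulr_sumr; apply: eq_bigr => i _; rewrite mxE mulrA. Qed.

Lemma dotvDr u v x : dotv x (u + v) = dotv x u + dotv x v.
Proof. by rewrite dotvC dotvDl !(dotvC x). Qed.

Lemma dotvZr a u x : dotv x (a *: u) = a * dotv x u.
Proof. by rewrite dotvC dotvZl (dotvC x). Qed.

Lemma dotvNr u x : dotv x (- u) = - dotv x u.
Proof. by rewrite -scaleN1r dotvZr mulN1r. Qed.

Lemma dotvBr u v x : dotv x (u - v) = dotv x u - dotv x v.
Proof. by rewrite dotvDr dotvNr. Qed.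

Lemma dotvBl u v x : dotv (u - v) x = dotv u x - dotv v x.
Proof. by rewrite dotvC dotvBr !(dotvC x). Qed.

Lemma dotv0r x : dotv x 0 = 0.
Proof. by rewrite -(scale0r 0) dotvZr mul0r. Qed.

Lemma dotv0l x : dotv 0 x = 0.
Proof. by rewrite dotvC dotv0r. Qed.

Lemma dotv_sumr (I : Type) (s : seq I) (P : pred I) (F : I -> E) x :
  dotv x (\sum_(i <- s | P i) F i) = \sum_(i <- s | P i) dotv x (F i).
Proof.
elim/big_ind2 : _ => [|a u b v <- <-|//]; first by rewrite dotv0r.
by rewrite dotvDr.
Qed.

Lemma dotvv_ge0 u : 0 <= dotv u u.
Proof. by apply: sumr_ge0 => i _; rewrite -expr2 sqr_ge0. Qed.

Lemma dotvv_eq0 u : dotv u u = 0 -> u = 0.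
Proof.
move=> h; apply/rowP => i; rewrite mxE; apply/eqP; rewrite -sqrf_eq0 expr2.
have /eqP := h; rewrite psumr_eq0 => [/allP/(_ i)|j _]; last by rewrite -expr2 sqr_ge0.
by rewrite mem_index_enum => /(_ isT).
Qed.

Lemma dotv_sum_sq u : dotv u u = \sum_i u ord0 i ^+ 2.
Proof. by apply: eq_bigr => i _; rewrite expr2. Qed.

Lemma normv_ge0 u : 0 <= normv u.
Proof. exact: sqrtr_ge0. Qed.

Lemma normv_sq u : normv u ^+ 2 = dotv u u.
Proof. by rewrite sqr_sqrtr// dotvv_ge0. Qed.

Lemma dotv_sq_le u v : dotv u v ^+ 2 <= dotv u u * dotv v v.
Proof.
have [v0|v0] := eqVneq (dotv v v) 0.
  by rewrite (dotvv_eq0 v0) !dotv0r expr0n/= mulr0.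
have vp : 0 < dotv v v by rewrite lt_def v0 dotvv_ge0.
have := dotvv_ge0 (dotv v v *: u - dotv u v *: v).
rewrite dotvBl !dotvBr !dotvZl !dotvZr (dotvC v u).
move: (dotv u v) (dotv u u) (dotv v v) vp => p q r r0.
have -> : r * (r * q) - r * (p * p) - (p * (r * p) - p * (p * r)) = r * (q * r - p ^+ 2).
  by ring.
by rewrite pmulr_rge0// subr_ge0.
Qed.

Lemma dotv_le u v : `|dotv u v| <= normv u * normv v.
Proof.
rewrite -(@ler_pXn2r _ 2)// ?nnegrE ?mulr_ge0 ?normv_ge0//.
by rewrite real_normK ?num_real// exprMn !normv_sq dotv_sq_le.
Qed.

Lemma normvN u : normv (- u) = normv u.
Proof. by rewrite /normv dotvNr dotvC dotvNr opprK. Qed.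

Lemma normvZ a u : normv (a *: u) = `|a| * normv u.
Proof.
rewrite /normv dotvZl dotvZr mulrA -expr2 sqrtrM ?sqr_ge0//.
by rewrite sqrtr_sqr.
Qed.

Lemma normv_coord u i : `|u ord0 i| <= normv u.
Proof.
rewrite -(@ler_pXn2r _ 2)// ?nnegrE ?normv_ge0// real_normK ?num_real//.
rewrite normv_sq dotv_sum_sq (bigD1 i)//= lerDl sumr_ge0// => j _.
exact: sqr_ge0.
Qed.

Lemma normv_le_sum u : normv u <= \sum_i `|u ord0 i|.
Proof.
have S0 : 0 <= \sum_i `|u ord0 i| by exact: sumr_ge0.
rewrite -(@ler_pXn2r _ 2)// ?nnegrE ?normv_ge0// normv_sq dotv_sum_sq.
rewrite expr2 mulr_suml; apply: ler_sum => i _.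
rewrite -real_normK ?num_real// expr2 ler_wpM2l// (bigD1 i)//= lerDl.
exact: sumr_ge0.
Qed.

Lemma normv_coord_le u (r : R) : 0 <= r -> (forall i, `|u ord0 i| <= r) -> normv u <= d%:R * r.
Proof.
move=> r0 h; apply: (le_trans (normv_le_sum u)).
apply: (@le_trans _ _ (\sum_(i < d) r)); first exact: ler_sum.
by rewrite sumr_const card_ord -[leLHS]mulr_natl.
Qed.

Lemma continuous_affine (a : R) (g : E) : continuous (fun x => a + dotv g x).
Proof.
move=> x; apply: (@continuousD _ _ _ (fun=> a) (fun x => dotv g x)); first exact: cst_continuous.
rewrite /dotv.
apply: (@cvg_sumr R _ _ (nbhs x) _ (index_enum 'I_d)
  (fun i y => g ord0 i * y ord0 i) (fun i => g ord0 i * x ord0 i)) => i.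
by apply: cvgMr; exact: coord_continuous.
Qed.

End euclidean.

(** * Hyperplanes *)

Section affine_null.
Context {R : realType}.

Lemma dotv_vcons n (g : 'rV[R]_n.+1) (x : R) (v : 'rV[R]_n) :
  dotv g (vcons (x, v)) = g ord0 ord0 * x + dotv (vuncons g).2 v.
Proof.
rewrite /dotv big_ord_recl vcons_head; congr (_ + _).
by apply: eq_bigr => i _; rewrite vcons_coord mxE.
Qed.

(** Induction on the dimension: if [g] has only a head component, the set is a point times the
    remaining space; otherwise every slice with fixed head is a hyperplane one dimension lower. *)
Lemma affine_null n (a : R) (g : 'rV[R]_n) : g != 0 ->
  lebesgue n [set x | a + dotv g x = 0] = 0%E.
Proof.
elim: n => [|n IH] in a g *; first by rewrite thinmx0 eqxx.
move=> g0.
have mA : measurable [set x : 'rV[R]_n.+1 | a + dotv g x = 0].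
  apply: closed_measurable_rV.
  apply: (@preimage_closed _ _ (fun x => a + dotv g x) [set 0]) => //.
    by move=> x _; exact: continuous_affine.
rewrite -[LHS]/((lebesgue_measure \x lebesgue n)%E
  (@vcons R n @^-1` [set x | a + dotv g x = 0])).
have [h0|h0] := eqVneq (vuncons g).2 0.
  have gn0 : g ord0 ord0 != 0.
    apply: contra_neq g0 => e; apply/rowP => i; rewrite mxE.
    have [j ->|->] := unliftP ord0 i; last exact: e.
    by have /rowP/(_ j) := h0; rewrite !mxE.
  rewrite (_ : _ @^-1` _ = [set - a / g ord0 ord0] `*` setT).
    have := @product_measure1E _ _ _ _ R lebesgue_measure (lebesgue n)
      [set - a / g ord0 ord0] setT (measurable_set1 _) measurableT.
    have e0 := lebesgue_measure_set1 (- a / g ord0 ord0).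
    by move=> ->; rewrite [X in (X * _)%E]e0 mul0e.
  apply/seteqP; split=> -[x v] /=; rewrite dotv_vcons h0 dotv0l addr0.
    move=> e; split=> //; apply: (mulfI gn0); rewrite mulrCA mulfV// mulr1.
    by apply/eqP; rewrite -addr_eq0 addrC e.
  by move=> [-> _]; rewrite mulrCA mulfV// mulr1 subrr.
rewrite /product_measure1 /= (eq_integral (cst 0%E)) ?integral0// => x _ /=.
rewrite (_ : xsection _ _ = [set v | (a + g ord0 ord0 * x) + dotv (vuncons g).2 v = 0]).
  exact: IH.
by apply/seteqP; split=> v; rewrite /xsection /= inE /= dotv_vcons addrA.
Qed.

End affine_null.

(** * Barycentric coordinates *)

Section simplex.
Context {R : realType} {d nv : nat}.
Local Notation E := 'rV[R]_d.
Local Notation mu := (@lebesgue R d).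
Variables (vtx : 'I_nv -> E) (K : {set 'I_nv}).

(** The [b i + dotv (l i) x] are the barycentric coordinates of [x], kept as affine functions on the
    whole space. *)
Definition is_bary (b : 'I_nv -> R) (l : 'I_nv -> E) : Prop :=
  [/\ forall x, \sum_(i in K) (b i + dotv (l i) x) = 1,
      forall x, \sum_(i in K) (b i + dotv (l i) x) *: vtx i = x &
      forall i j, i \in K -> j \in K -> b i + dotv (l i) (vtx j) = (i == j)%:R].

Hypotheses (Kcard : #|K| = d.+1) (Kfree : affinely_free vtx K).

Lemma affinely_free_eq (c c' : 'I_nv -> R) : \sum_(i in K) c i = \sum_(i in K) c' i ->
  \sum_(i in K) c i *: vtx i = \sum_(i in K) c' i *: vtx i ->
  forall i, i \in K -> c i = c' i.
Proof.
move=> h1 h2 i iK; apply/eqP; rewrite -subr_eq0; apply/eqP.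
apply: (Kfree (c := fun i => c i - c' i)) => //.
  by rewrite sumrB h1 subrr.
under eq_bigr do rewrite scalerBl.
by rewrite sumrB h2 subrr.
Qed.

(** Affine independence makes the square matrix with rows [(1, vtx i)] invertible; the columns of
    its inverse hold the coefficients of the barycentric coordinates. *)
Lemma bary_exists : exists b l, is_bary b l.
Proof.
pose e (k : 'I_d.+1) : 'I_nv := enum_val (cast_ord (esym Kcard) k).
have eK k : e k \in K by exact: enum_valP.
have e_inj : injective e by move=> k k' /enum_val_inj /cast_ord_inj.
have sumK (V : zmodType) (F : 'I_nv -> V) : \sum_(i in K) F i = \sum_k F (e k).
  rewrite (reindex e) /=; last first.
    have h i : i \in K -> exists k, e k = i.
      move=> iK; exists (cast_ord Kcard (enum_rank_in iK i)).
      by rewrite /e cast_ord_comp cast_ord_id enum_rankK_in.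
    exists (fun i => odflt ord0 [pick k | e k == i]) => [k _|i iK].
      by case: pickP => [k' /eqP/e_inj//|/(_ k)]; rewrite eqxx.
    have [k <-] := h i iK.
    by case: pickP => [k' /eqP//|/(_ k)]; rewrite eqxx.
  by apply: eq_bigl => k; rewrite eK.
pose A : 'M[R]_d.+1 := \matrix_(k, j) vcons (1, vtx (e k)) ord0 j.
have vA (v : 'rV[R]_d.+1) : v *m A = vcons (\sum_k v ord0 k, \sum_k v ord0 k *: vtx (e k)).
  apply/rowP => j; rewrite !mxE /=.
  have [i ->|->] := unliftP ord0 j.
    by rewrite summxE; apply: eq_bigr => k _; rewrite !mxE liftK.
  by apply: eq_bigr => k _; rewrite !mxE unlift_none mulr1.
have uA : A \in unitmx.
  rewrite -row_free_unit; apply: inj_row_free => v; rewrite vA => h.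
  have h1 : \sum_k v ord0 k = 0.
    by have /rowP/(_ ord0) := h; rewrite vcons_head mxE.
  have h2 : \sum_k v ord0 k *: vtx (e k) = 0.
    by apply/rowP => j; have /rowP/(_ (lift ord0 j)) := h; rewrite vcons_coord => ->; rewrite !mxE.
  pose c i := \sum_(k | e k == i) v ord0 k.
  have ce k : c (e k) = v ord0 k.
    rewrite /c (big_pred1 k)// => k' /=; exact: inj_eq.
  apply/rowP => k; rewrite mxE -ce; apply: Kfree => //.
    by rewrite sumK -[RHS]h1; apply: eq_bigr => k' _; rewrite ce.
  by rewrite sumK -[RHS]h2; apply: eq_bigr => k' _; rewrite ce.
pose B := invmx A.
pose b i := \sum_(k | e k == i) B ord0 k.
pose l i := \sum_(k | e k == i) \row_j B (lift ord0 j) k.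
have bl k x : b (e k) + dotv (l (e k)) x = (vcons (1, x) *m B) ord0 k.
  rewrite /b /l !(big_pred1 k); try by move=> k' /=; exact: inj_eq.
  rewrite mxE big_ord_recl vcons_head mul1r; congr (_ + _).
  by apply: eq_bigr => j _; rewrite vcons_coord mxE mulrC.
have xBA x : (vcons (1, x) *m B) *m A = vcons (1, x) by rewrite mulmxKV.
exists b, l; split => [x|x|i j iK jK].
- rewrite sumK; have /rowP/(_ ord0) := xBA x; rewrite vA !vcons_head => <-.
  by apply: eq_bigr => k _; rewrite bl.
- rewrite sumK; apply/rowP => j.
  have /rowP/(_ (lift ord0 j)) := xBA x; rewrite vA !vcons_coord => <-.
  congr (fun_of_matrix _ _ _).
  by apply: eq_bigr => k _; rewrite bl.
- have [k <-] : exists k, e k = i.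
    exists (cast_ord Kcard (enum_rank_in iK i)).
    by rewrite /e cast_ord_comp cast_ord_id enum_rankK_in.
  have [k' <-] : exists k, e k = j.
    exists (cast_ord Kcard (enum_rank_in jK j)).
    by rewrite /e cast_ord_comp cast_ord_id enum_rankK_in.
  rewrite bl (_ : vcons (1, vtx (e k')) = row k' A); last first.
    by apply/rowP => q; rewrite !mxE.
  by rewrite -row_mul mulmxV// !mxE (inj_eq e_inj) eq_sym.
Qed.

Definition bary := projT1 (cid bary_exists).
Definition baryl := projT1 (cid (projT2 (cid bary_exists))).
Definition lam i x : R := bary i + dotv (baryl i) x.

Lemma baryP : is_bary bary baryl.
Proof. exact: (projT2 (cid (projT2 (cid bary_exists)))). Qed.

Lemma lam_sum1 x : \sum_(i in K) lam i x = 1.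
Proof. by have [h _ _] := baryP; exact: h. Qed.

Lemma lam_comb x : \sum_(i in K) lam i x *: vtx i = x.
Proof. by have [_ h _] := baryP; exact: h. Qed.

Lemma lam_vtx i j : i \in K -> j \in K -> lam i (vtx j) = (i == j)%:R.
Proof. by have [_ _ h] := baryP; exact: h. Qed.

Lemma lam_unique (c : 'I_nv -> R) x : \sum_(i in K) c i = 1 ->
  x = \sum_(i in K) c i *: vtx i -> forall i, i \in K -> c i = lam i x.
Proof.
move=> h1 h2; apply: affinely_free_eq; first by rewrite h1 lam_sum1.
by rewrite lam_comb h2.
Qed.

Lemma hullP x : hull vtx K x <-> forall i, i \in K -> 0 <= lam i x.
Proof.
split=> [[c [c0 c1 cx]] i iK|h]; first by rewrite -(lam_unique c1 cx).
exists (fun i => if i \in K then lam i x else 0); split.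
- by move=> i; case: ifP => // /h.
- by rewrite -[RHS](lam_sum1 x); apply: eq_bigr => i ->.
- by rewrite -[LHS]lam_comb; apply: eq_bigr => i ->.
Qed.

Lemma vtx_hull (A : {set 'I_nv}) i : i \in A -> hull vtx A (vtx i).
Proof.
move=> iA; exists (fun j => (j == i)%:R); split=> //.
- rewrite (bigD1 i)//= eqxx big1 ?addr0// => j /andP[_ /negbTE ->].
  by [].
- rewrite (bigD1 i)//= eqxx scale1r big1 ?addr0// => j /andP[_ /negbTE ->].
  by rewrite scale0r.
Qed.

Lemma lam_continuous i : continuous (lam i).
Proof. exact: continuous_affine. Qed.

Lemma hull_closed : closed (hull vtx K).
Proof.
have -> : hull vtx K = \bigcap_(i in [set` K]) (lam i @^-1` [set r | 0 <= r]).
  apply/seteqP; split=> x; first by move=> /hullP h i /= /h.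
  by move=> h; apply/hullP => i iK; exact: (h i iK).
apply: closed_bigI => i _; apply: preimage_closed => //.
by move=> x _; exact: lam_continuous.
Qed.

Lemma hull_measurable : measurable (hull vtx K).
Proof. exact: closed_measurable_rV hull_closed. Qed.

Lemma affine_comb (a : R) (g : E) x (c : 'I_nv -> R) (A : {set 'I_nv}) :
  \sum_(i in A) c i = 1 -> x = \sum_(i in A) c i *: vtx i ->
  a + dotv g x = \sum_(i in A) c i * (a + dotv g (vtx i)).
Proof.
move=> h1 ->; under [RHS]eq_bigr do rewrite mulrDr.
rewrite big_split/= -mulr_suml h1 mul1r dotv_sumr; congr (_ + _).
by apply: eq_bigr => i _; rewrite dotvZr.
Qed.

Lemma affine_lam (a : R) (g : E) x :
  a + dotv g x = \sum_(i in K) lam i x * (a + dotv g (vtx i)).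
Proof. by apply: affine_comb; rewrite ?lam_sum1 ?lam_comb. Qed.

(** The difference pairs equally with all vertices, hence, through barycentric coordinates, equally
    with all points of the space, in particular with itself and with 0. *)
Lemma grad_unique (g g' : E) :
  (forall x y, hull vtx K x -> hull vtx K y -> dotv g (x - y) = dotv g' (x - y)) -> g = g'.
Proof.
move=> h; apply/eqP; rewrite -subr_eq0; apply/eqP; apply: dotvv_eq0.
pose q := g - g'; rewrite -/q.
have [i0 i0K] : exists i, i \in K by apply/set0Pn; rewrite -card_gt0 Kcard.
have qv i : i \in K -> dotv q (vtx i) = dotv q (vtx i0).
  move=> iK; apply/eqP; rewrite -subr_eq0 -dotvBr /q dotvBl.
  by rewrite h ?subrr//; exact: vtx_hull.
have qx x : dotv q x = dotv q (vtx i0).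
  rewrite -[LHS]add0r affine_lam.
  under eq_bigr => i iK do rewrite add0r qv//.
  by rewrite -mulr_suml lam_sum1 mul1r.
by rewrite (qx q) -(qx 0) dotv0r.
Qed.

Lemma baryl_neq0 i : (0 < d)%N -> i \in K -> baryl i != 0.
Proof.
move=> d0 iK; apply/eqP => h.
have [j] : exists j, j \in K :\ i.
  apply/set0Pn; rewrite -card_gt0.
  by have := cardsD1 i K; rewrite iK Kcard add1n => -[<-].
rewrite !inE => /andP[ji jK].
have := lam_vtx iK jK; have := lam_vtx iK iK; rewrite /lam h !dotv0l !addr0 eqxx => ->.
by rewrite eq_sym (negbTE ji) => /eqP; rewrite oner_eq0.
Qed.

(** The face opposite to [i] lies in the zero set of the nonconstant affine function [lam i]. *)
Lemma face_null i : (0 < d)%N -> i \in K ->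
  exists N, [/\ measurable N, mu N = 0%E & hull vtx (K :\ i) `<=` N].
Proof.
move=> d0 iK; exists [set x | bary i + dotv (baryl i) x = 0]; split.
- apply: closed_measurable_rV.
  apply: (@preimage_closed _ _ (lam i) [set 0]) => //.
  by move=> x _; exact: lam_continuous.
- exact: affine_null (baryl_neq0 d0 iK).
- move=> x [c [c0 c1 cx]] /=; rewrite (affine_comb _ _ c1 cx) big1// => j.
  rewrite !inE => /andP[ji jK]; rewrite -/(lam i (vtx j)) lam_vtx//.
  by rewrite eq_sym (negbTE ji) mulr0.
Qed.

(** At the centroid every barycentric coordinate is [1 / (d + 1)]; the radius is so small, compared
    with the gradients of these coordinates, that they stay nonnegative. *)
Lemma hull_ball : exists c r, 0 < r /\ [set x | normv (x - c) <= r] `<=` hull vtx K.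
Proof.
pose c : E := \sum_(i in K) d.+1%:R^-1 *: vtx i.
have d1 : 0 < d.+1%:R :> R by rewrite ltr0n.
have lc i : i \in K -> lam i c = d.+1%:R^-1.
  move=> iK; rewrite -(@lam_unique (fun=> d.+1%:R^-1) c)//.
  by rewrite sumr_const Kcard -[LHS]mulr_natl mulfV// gt_eqF.
pose N := 1 + \sum_(i in K) normv (baryl i).
have N0 : 0 < N by rewrite ltr_wpDr// sumr_ge0// => i _; exact: normv_ge0.
exists c, (N^-1 / d.+1%:R); split; first by rewrite divr_gt0// invr_gt0.
move=> x /= xc; apply/hullP => i iK.
have : lam i x = lam i c + dotv (baryl i) (x - c).
  by rewrite /lam dotvBr; ring.
rewrite lc// => ->.
have : `|dotv (baryl i) (x - c)| <= d.+1%:R^-1.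
  apply: le_trans (dotv_le _ _) _.
  apply: (@le_trans _ _ (N * (N^-1 / d.+1%:R))); last by rewrite mulrA mulfV ?mul1r// gt_eqF.
  rewrite ler_pM ?normv_ge0// /N (bigD1 i)//= addrCA lerDl addr_ge0// sumr_ge0//.
  by move=> j _; exact: normv_ge0.
by rewrite ler_norml => /andP[+ _]; rewrite -subr_ge0 opprK addrC.
Qed.

End simplex.

(** * Meshes *)

Section mesh.
Context {R : realType} {d : nat}.
Variable L : R.
Hypotheses (L0 : 0 < L) (d0 : (0 < d)%N).
Local Notation E := 'rV[R]_d.
Local Notation mu := (@lebesgue R d).
Local Notation D := (@cube R d L).
Variable M : mesh D.
Local Notation vertex := ('I_(nvtx M)).
Local Notation vtx := (@vtx R d D M).
Local Notation simp := (simplices M).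
Local Notation hullM := (hull vtx).
Local Notation Int f := (Rintegral mu D f).
Implicit Types (K : {set vertex}) (f : E -> R).

Let mD : measurable D := cube_measurable L.
Let muD : (mu D < +oo)%E := cube_finite L.

Lemma hull_mono (A B : {set vertex}) : A \subset B -> hullM A `<=` hullM B.
Proof.
move=> AB x [c [c0 c1 cx]]; exists (fun i => if i \in A then c i else 0).
have e (V : nmodType) (F : vertex -> V) :
    \sum_(i in B) (if i \in A then F i else 0) = \sum_(i in A) F i.
  rewrite -big_mkcondr /=; apply: eq_bigl => i.
  by case: (boolP (i \in A)) => iA; rewrite ?andbF// (fintype.subsetP AB).
split.
- by move=> i; case: ifP.
- by rewrite e.
- rewrite cx -e; apply: eq_bigr => i _; case: ifP => // _.
  by rewrite scale0r.
Qed.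

Lemma hull_subD K : K \in simp -> hullM K `<=` D.
Proof.
move=> KS x Kx.
suff : (\bigcup_(K in [set` simp]) hullM K) x by rewrite (mesh_cover M).
by exists K.
Qed.

Lemma mesh_mem x : D x -> exists2 K, K \in simp & hullM K x.
Proof.
move=> Dx; have : (\bigcup_(K in [set` simp]) hullM K) x by rewrite (mesh_cover M).
by move=> [K]; exists K.
Qed.

Lemma vtx_D i : D (vtx i).
Proof.
have [K KS iK] := mesh_vtx_used i.
by apply: (hull_subD KS); exact: vtx_hull.
Qed.

Lemma mhull K : K \in simp -> measurable (hullM K).
Proof.
move=> KS; exact: hull_measurable (simplex_card KS) (simplex_free KS).
Qed.

(** Both simplices have [d + 1] vertices, so some vertex [i] of [K] is not in [K']; by conformity
    the overlap lies in the face of [K] opposite to [i]. *)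
Lemma overlap_null K K' : K \in simp -> K' \in simp -> K != K' ->
  {ae mu, forall x, ~ (hullM K x /\ hullM K' x)}.
Proof.
move=> KS KS' KK'.
have [i iK iK'] : exists2 i, i \in K & i \notin K'.
  apply/subsetPn; apply: contra KK' => sub; rewrite eqEcard sub/=.
  by rewrite (simplex_card KS) (simplex_card KS').
have [N [mN N0 sN]] := face_null (simplex_card KS) (simplex_free KS) d0 iK.
exists N; split=> // x /= /contrapT h; apply: sN.
have : (hullM K `&` hullM K') x by [].
rewrite mesh_conforming//; apply: hull_mono.
apply/fintype.subsetP => j; rewrite !inE => /andP[jK jK']; rewrite jK andbT.
by apply: contraNneq iK' => <-.
Qed.

Lemma ae_unique_simplex :
  {ae mu, forall x, forall K K', K \in simp -> K' \in simp ->
     hullM K x -> hullM K' x -> K = K'}.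
Proof.
have h (p : {set vertex} * {set vertex}) : {ae mu, forall x, p.1 \in simp ->
    p.2 \in simp -> hullM p.1 x -> hullM p.2 x -> p.1 = p.2}.
  have [h1|h1] := boolP [&& p.1 \in simp, p.2 \in simp & p.1 != p.2]; last first.
    apply: aeW => x a b _ _; apply/eqP; move: h1; rewrite a b/=.
    by rewrite negbK.
  have /and3P[a b ab] := h1.
  apply: filterS (overlap_null a b ab) => x hx _ _ k1 k2.
  by case: hx.
have := @filter_forall _ _ _ _ (ae_filter_ringOfSetsType mu) h; apply: filterS => x hx K K' KS KS'.
exact: (hx (K, K')).
Qed.

Lemma mesh_Int_sum f : intg mu D f ->
  Int f = \sum_(K in simp) Rintegral mu (hullM K) f.
Proof.
move=> fi; have mf := intg_meas fi.
have iK K : K \in simp -> intg mu D (fun x => f x * \1_(hullM K) x).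
  move=> KS; apply: (intg_le mD _ _ (intg_abs fi)).
    by apply: measurable_funM => //; apply: measurable_indic; exact: mhull.
  by move=> x _; rewrite normrM ler_piMr// ger0_norm// indicE lern1 leq_b1.
have iS := intg_sum mD (index_enum {set vertex}) iK.
transitivity (Int (fun x => \sum_(K in simp) f x * \1_(hullM K) x)).
  apply: Int_ae_eq => //; first exact: intg_meas iS.
  apply: filterS ae_unique_simplex => x h Dx.
  have [K KS Kx] := mesh_mem Dx.
  rewrite (bigD1 K)//= indicE mem_set// mulr1 big1 ?addr0// => K' /andP[KS' nK].
  rewrite indicE memNset ?mulr0// => Kx'; move/negP: nK; apply.
  by apply/eqP; exact: h.
rewrite (Int_sum mD (index_enum {set vertex}) iK); apply: eq_bigr => K KS.
rewrite -[in RHS](setIidr (hull_subD KS)) Rintegral_mkcondr.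
apply: eq_Rintegral => x _; rewrite patchE indicE.
by case: (x \in hullM K); rewrite ?mulr1 ?mulr0.
Qed.

Lemma intg_hull K f : K \in simp -> intg mu D f -> intg mu (hullM K) f.
Proof.
by move=> KS fi; apply: (integrableS mD) fi; [exact: mhull|exact: hull_subD].
Qed.

Lemma volume_ge0 K : 0 <= volume K.
Proof. by rewrite fine_ge0. Qed.

Lemma hull_finite K : K \in simp -> (mu (hullM K) < +oo)%E.
Proof.
move=> KS; apply: le_lt_trans muD; apply: le_measure; rewrite ?inE//.
  exact: mhull.
exact: hull_subD.
Qed.

Lemma Int_cst_hull K (a : R) : K \in simp -> Rintegral mu (hullM K) (fun=> a) = a * volume K.
Proof. by move=> KS; rewrite Rintegral_cst//; exact: mhull. Qed.

Lemma cube_dist x y : D x -> D y -> normv (x - y) <= d%:R * (2 * L).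
Proof.
move=> Dx Dy; apply: normv_coord_le => [|i]; first by rewrite mulr_ge0// ltW.
rewrite !mxE ler_norml; have /andP[? ?] := Dx i; have /andP[? ?] := Dy i.
by apply/andP; split; lra.
Qed.

Lemma diam_dist K x y : K \in simp -> hullM K x -> hullM K y ->
  normv (x - y) <= diam (hullM K).
Proof.
move=> KS Kx Ky; apply: ub_le_sup; last by exists (x, y).
exists (d%:R * (2 * L)) => _ [[a b] /= [Ka Kb] <-].
by apply: cube_dist; exact: (hull_subD KS).
Qed.

Lemma simplex_mem K : K \in simp -> exists i, i \in K.
Proof. by move=> KS; apply/set0Pn; rewrite -card_gt0 (simplex_card KS). Qed.

Lemma diam_ge0 K : K \in simp -> 0 <= diam (hullM K).
Proof.
move=> KS; have [i iK] := simplex_mem KS.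
apply: le_trans (diam_dist KS (vtx_hull vtx iK) (vtx_hull vtx iK)).
exact: normv_ge0.
Qed.

Lemma diam_le_size K : K \in simp -> diam (hullM K) <= mesh_size M.
Proof. by move=> KS; rewrite /mesh_size; apply: le_bigmax_cond. Qed.

Lemma mesh_size_ge0 : 0 <= mesh_size M.
Proof. exact: bigmax_ge_id. Qed.

(** The ball contains the cube of half-side [r / d], whose measure is explicit; the measure of the
    ball itself is never computed. *)
Lemma ball_volume K c (r : R) : K \in simp -> 0 <= r ->
  [set x | normv (x - c) <= r] `<=` hullM K -> (2 * r / d%:R) ^+ d <= volume K.
Proof.
move=> KS r0 sub; have d1 : 0 < d%:R :> R by rewrite ltr0n.
pose s := r / d%:R; have s0 : 0 <= s by rewrite divr_ge0// ltW.
pose B := [set x : E | forall i, `[c ord0 i - s, c ord0 i + s]%classic (x ord0 i)].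
have mB : measurable B.
  by apply: (@measurable_box _ _ (fun i => `[c ord0 i - s, c ord0 i + s]%classic)) => i;
    exact: measurable_itv.
have BK : B `<=` hullM K.
  move=> x Bx; apply: sub => /=; have -> : r = d%:R * s.
    by rewrite /s mulrCA mulfV ?mulr1// gt_eqF.
  apply: normv_coord_le => // i; rewrite !mxE; have := Bx i; rewrite /= in_itv/=.
  by move=> /andP[? ?]; rewrite ler_norml; apply/andP; split; lra.
have vB : mu B = ((2 * s) ^+ d)%:E.
  rewrite /B (@lebesgue_box R d (fun i => `[c ord0 i - s, c ord0 i + s]%classic)); last first.
    by move=> i; exact: measurable_itv.
  rewrite (eq_bigr (fun=> (2 * s)%:E)); last first.
    move=> i _; rewrite lebesgue_measure_itv /= lte_fin.
    case: ifPn => [_|]; first by rewrite -EFinD; congr EFin; ring.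
    rewrite -leNgt => h; have -> : s = 0 by lra.
    by rewrite mulr0.
  by rewrite prodEFin prodr_const card_ord.
rewrite -mulrA -/s -lee_fin -vB /volume fineK.
  by apply: le_measure; rewrite ?inE//; exact: mhull.
by rewrite ge0_fin_numE//; exact: hull_finite.
Qed.

(** The supremum defining [inball_diam] is not known to be attained, so a ball with more than half
    the extremal diameter is taken; hence the factor 4 between diameter and radius. *)
Lemma inball_ball K : K \in simp -> exists c (r : R),
  [/\ 0 < inball_diam (hullM K), 0 < r, inball_diam (hullM K) <= 4 * r &
    [set x | normv (x - c) <= r] `<=` hullM K].
Proof.
move=> KS.
pose S := [set 2 * r | r in [set r : R | 0 <= r /\
        exists c : E, [set x | normv (x - c) <= r] `<=` hullM K]].
have [c [r [r0 sub]]] := hull_ball (simplex_card KS) (simplex_free KS).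
have S2 : S (2 * r) by exists r => //=; split; [exact: ltW|exists c].
have ubS : has_ubound S.
  exists (2 * L * 2) => _ [s /= [s0 [c' sub']] <-].
  have [i _] : exists i : 'I_d, true by exists (Ordinal d0).
  have nd : normv (dirv i : E) = 1.
    rewrite /normv /dotv (bigD1 i)//= big1 ?addr0 ?mxE ?eqxx ?mulr1 ?sqrtr1//.
    by move=> j ji; rewrite !mxE (negbTE ji) andbF mulr0.
  have Dp : D (c' + s *: dirv i).
    apply: (hull_subD KS); apply: sub' => /=; rewrite addrAC subrr add0r normvZ nd mulr1.
    by rewrite ger0_norm.
  have Dm : D (c' - s *: dirv i).
    apply: (hull_subD KS); apply: sub' => /=; rewrite addrAC subrr add0r normvN normvZ nd mulr1.
    by rewrite ger0_norm.
  have := Dp i; have := Dm i; rewrite !mxE !eqxx/= mulr1.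
  by move=> /andP[? ?] /andP[? ?]; lra.
have sp : 0 < inball_diam (hullM K).
  by apply: (@lt_le_trans _ _ (2 * r)); [rewrite mulr_gt0|exact: ub_le_sup].
have hs : has_sup S by split=> //; exists (2 * r).
have sp2 : 0 < inball_diam (hullM K) / 2 by rewrite divr_gt0.
have [_ [s [s0 [c' sub']] <-] h] := sup_adherent sp2 hs.
have h2 : inball_diam (hullM K) - inball_diam (hullM K) / 2 < 2 * s by exact: h.
exists c', s; split => //; move: sp h2; move: (inball_diam _) => p p0 h2; lra.
Qed.

Variable sigma : R.
Hypotheses (sigma0 : 0 < sigma) (reg : shape_regular M sigma).

Lemma reg_ball K : K \in simp -> exists c (r : R),
  [/\ 0 < r, diam (hullM K) <= 4 * sigma * r & [set x | normv (x - c) <= r] `<=` hullM K].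
Proof.
move=> KS; have [c [r [ip r0 h sub]]] := inball_ball KS.
exists c, r; split=> //.
have := reg KS; rewrite ler_pdivrMr// => /le_trans; apply.
by rewrite -mulrA mulrCA ler_pM2l.
Qed.

(** With [r] from [reg_ball], [4 sigma r = (2 sigma d) (2 r / d)], and [(2 r / d)^d] is at most the
    volume by [ball_volume]. *)
Lemma diam_volume K : K \in simp ->
  diam (hullM K) ^+ d <= (2 * sigma * d%:R) ^+ d * volume K.
Proof.
move=> KS; have [c [r [r0 h sub]]] := reg_ball KS.
have d1 : 0 < d%:R :> R by rewrite ltr0n.
apply: (@le_trans _ _ ((2 * sigma * d%:R) ^+ d * (2 * r / d%:R) ^+ d)).
  rewrite -exprMn lerXn2r ?nnegrE ?diam_ge0//.
    by rewrite !mulr_ge0 ?invr_ge0// ltW.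
  apply: (le_trans h); rewrite le_eqVlt; apply/orP; left; apply/eqP.
  by field; rewrite gt_eqF.
rewrite ler_pM2l; first exact: ball_volume (ltW r0) sub.
by rewrite exprn_gt0// !mulr_gt0.
Qed.

(** From the centre of a large ball in [K], a step of length [r] along [g] stays in [K] and sees the
    oscillation [r * normv g]; shape regularity compares [r] with the diameter. *)
Lemma grad_bound K (w : R) (g : E) : K \in simp -> 0 <= w ->
  (forall x y, hullM K x -> hullM K y -> `|dotv g (x - y)| <= w * diam (hullM K)) ->
  normv g <= 4 * sigma * w.
Proof.
move=> KS w0 hw; have [c [r [r0 h sub]]] := reg_ball KS.
have [->|g0] := eqVneq (normv g) 0; first by rewrite !mulr_ge0// ltW.
have gp : 0 < normv g by rewrite lt_def g0 normv_ge0.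
pose x := c + (r / normv g) *: g.
have Kx : hullM K x.
  apply: sub; rewrite /= /x addrAC subrr add0r normvZ ger0_norm ?divr_ge0 ?normv_ge0 ?(ltW r0)//.
  by rewrite mulfVK.
have Kc : hullM K c.
  by apply: sub; rewrite /= subrr /normv dotv0r sqrtr0 ltW.
have := hw _ _ Kx Kc; rewrite /x addrAC subrr add0r dotvZr -normv_sq.
rewrite expr2 mulrA mulfVK// ger0_norm ?mulr_ge0 ?normv_ge0 ?(ltW r0)// => h2.
rewrite -(ler_pM2l r0) (le_trans h2)// (le_trans (ler_wpM2l w0 h))//.
by rewrite le_eqVlt; apply/orP; left; apply/eqP; ring.
Qed.

End mesh.

(** * Locality of smoothness and rules for partial derivatives *)

Section local_smooth.
Context {R : realType} {d : nat}.
Local Notation E := 'rV[R]_d.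

(** For functions defined by cases that agree near each point with a single smooth expression, such
    as a thresholded function extended by zero. *)
Lemma Ck_local k (f : E -> R) :
  (forall x : E, exists2 g, Ck k g & \forall y \near x, g y = f y) -> Ck k f.
Proof.
have hx j (f' : E -> R) : (forall x : E, exists2 g, Ck j g & \forall y \near x, g y = f' y) ->
    continuous f'.
  move=> h x; have [g Cg gf] := h x; have cg : continuous g := Ck_continuous Cg.
  have := cg x.
  rewrite /continuous_at (nbhs_singleton gf).
  move=> cgx A Af; have gA : nbhs x (g @^-1` A) by exact: cgx.
  suff : nbhs x (f' @^-1` A) by [].
  by move: gf gA; apply: filterS2 => y /= <-.
elim: k f => [|k IH] f h; first by split=> //; exact: (hx 0%N).
split; first exact: (hx k.+1).
move=> i; split=> [x|].
  have [g [_ /(_ i)[dg _]] gf] := h x.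
  exact: near_eq_derivable (dg x).
apply: IH => x; have [g [_ /(_ i)[dg Cg]] gf] := h x.
exists (pderiv i g) => //.
have := nbhs_interior gf.
by apply: filterS => y gfy; rewrite /pderiv; exact: near_eq_derive.
Qed.

Lemma smooth_local (f : E -> R) :
  (forall x : E, exists2 g, smooth g & \forall y \near x, g y = f y) -> smooth f.
Proof.
move=> h; apply/smoothP => k; apply: Ck_local => x; have [g sg gf] := h x.
by exists g => //; exact: (smoothP g).1.
Qed.

Lemma pderivD (f g : E -> R) i x : smooth f -> smooth g ->
  pderiv i (fun x => f x + g x) x = pderiv i f x + pderiv i g x.
Proof.
move=> sf sg.
have df : derivable f x (dirv i) by exact: smooth_derivable.
have dg : derivable g x (dirv i) by exact: smooth_derivable.
exact: (deriveD df dg).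
Qed.

Lemma pderivM (f g : E -> R) i x : smooth f -> smooth g ->
  pderiv i (fun x => f x * g x) x = f x * pderiv i g x + g x * pderiv i f x.
Proof.
move=> sf sg.
have df : derivable f x (dirv i) by exact: smooth_derivable.
have dg : derivable g x (dirv i) by exact: smooth_derivable.
exact: (deriveM df dg).
Qed.

Lemma pderiv_cst (a : R) i (x : E) : pderiv i (fun=> a) x = 0.
Proof. exact: derive_cst. Qed.

Lemma pderivZ (f : E -> R) a i x : smooth f ->
  pderiv i (fun x => a * f x) x = a * pderiv i f x.
Proof.
move=> sf; have df : derivable f x (dirv i) by exact: smooth_derivable.
exact: (deriveZ a df).
Qed.

Lemma pderivB (f g : E -> R) i x : smooth f -> smooth g ->
  pderiv i (fun x => f x - g x) x = pderiv i f x - pderiv i g x.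
Proof.
move=> sf sg.
have df : derivable f x (dirv i) by exact: smooth_derivable.
have dg : derivable g x (dirv i) by exact: smooth_derivable.
exact: (deriveB df dg).
Qed.

Lemma pderiv_comp (g : R -> R) (f : E -> R) (dg : R) i x : smooth f ->
  is_derive (f x) 1 g dg -> pderiv i (fun x => g (f x)) x = dg * pderiv i f x.
Proof.
move=> sf hg.
have df : derivable f x (dirv i) by exact: smooth_derivable.
by have [_] := is_derive_comp_dir (derivableP df) hg.
Qed.

Lemma pderiv_sqrt (f : E -> R) i x : smooth f -> 0 < f x ->
  pderiv i (fun x => Num.sqrt (f x)) x = (2 * Num.sqrt (f x))^-1 * pderiv i f x.
Proof. by move=> sf f0; apply: pderiv_comp => //; exact: is_derive1_sqrt. Qed.

Lemma pderiv_flat (f : E -> R) p i x : smooth f ->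
  pderiv i (fun x => flat p (f x)) x =
  (flat p.+2 (f x) - p%:R * flat p.+1 (f x)) * pderiv i f x.
Proof. by move=> sf; apply: pderiv_comp => //; exact: flat_derive. Qed.

Lemma pderivX2 (f : E -> R) i x : smooth f ->
  pderiv i (fun x => f x ^+ 2) x = 2 * f x * pderiv i f x.
Proof.
move=> sf; rewrite (_ : (fun _ => _) = fun x => f x * f x).
  by rewrite pderivM//; ring.
by apply/funext => y; rewrite expr2.
Qed.

Lemma smooth_affine (a : R) (g : E) : smooth (fun x => a + dotv g x).
Proof.
apply: smoothD; first exact: smooth_cst.
by apply: smooth_sum => i _; apply: smoothZ; exact: smooth_coord.
Qed.

Lemma pderiv_affine (a : R) (g : E) i x : pderiv i (fun x => a + dotv g x) x = g ord0 i.
Proof.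
have h : is_derive x (dirv i) (fun x => a + dotv g x) (g ord0 i).
  rewrite (_ : (fun _ => _) = cst a + \sum_j (g ord0 j *: (fun y : E => y ord0 j))).
    have hj (j : 'I_d) := is_deriveZ (g ord0 j) (is_derive_coord x i j).
    apply: (is_derive_eq (is_deriveD (is_derive_cst a x (dirv i)) (is_derive_sum _))).
    rewrite add0r (bigD1 i)//= eqxx big1 ?addr0 => [|j /negbTE].
      by rewrite /GRing.scale /= mulr1.
    by rewrite eq_sym => ->; rewrite scaler0.
  by apply/funext => y; rewrite /= fct_sumE.
by have [_] := h.
Qed.

End local_smooth.

(** * Smoothing lattice polynomials of affine functions *)

Section sequences.
Context {R : realType}.

Lemma cvg_rate (u : nat -> R) (l C : R) :
  (forall n, `|u n - l| <= C * n.+1%:R^-1) -> u @ \oo --> l.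
Proof.
move=> h; apply/subr_cvg0/norm_cvg0P.
apply: (@cvg0_le _ _ (fun n => C * n.+1%:R^-1)) => [n|].
  by rewrite normr_ge0 h.
by rewrite -(mulr0 C); apply: cvgMr; exact: cvg_harmonic.
Qed.

Lemma cvg0_bounded (b c : nat -> R) : (forall n, `|b n| <= 1) ->
  c @ \oo --> (0 : R) -> b n * c n @[n --> \oo] --> (0 : R).
Proof.
move=> hb c0; have hc : `|c n| @[n --> \oo] --> (0 : R) by exact: (norm_cvg0P c).2.
apply/norm_cvg0P.
apply: (cvg0_le _ hc) => n; rewrite normr_ge0/= normrM.
by rewrite ler_piMl.
Qed.

End sequences.

Section lattice.
Context {R : realType} {d : nat} {T : finType}.
Local Notation E := 'rV[R]_d.
Variables (a : T -> R) (g : T -> E).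

Definition ell k (x : E) : R := a k + dotv (g k) x.

(* Off a null set, affine pieces that agree at a point are the same. *)
Definition untied (x : E) : Prop := forall k k', ell k x = ell k' x -> g k = g k'.

(** These properties survive [max] and [min]: uniform convergence at rate [1 / (n + 1)], uniformly
    bounded gradients, and, off ties, convergence of the gradients to that of any active piece. The
    last two are what dominated convergence of the gradients needs. *)
Definition lattice_approx (P : E -> R) : Prop :=
  exists (Pn : nat -> E -> R) (C : R), [/\ 0 <= C, forall n, smooth (Pn n),
    forall n i x, `|pderiv i (Pn n) x| <= C,
    forall n x, `|Pn n x - P x| <= C * n.+1%:R^-1 &
    forall x, (exists k, P x = ell k x) /\
      (untied x -> forall k, P x = ell k x -> forall i,
         pderiv i (Pn n) x @[n --> \oo] --> g k ord0 i)].

Lemma lattice_ell k : lattice_approx (ell k).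
Proof.
exists (fun=> ell k), (normv (g k)); split.
- exact: normv_ge0.
- by move=> _; exact: smooth_affine.
- by move=> _ i x; rewrite pderiv_affine normv_coord.
- by move=> n x; rewrite subrr normr0 mulr_ge0 ?normv_ge0.
- move=> x; split; first by exists k.
  move=> ux k' /ux <- i; apply: cvg_near_cst; apply: nearW => n.
  exact: pderiv_affine.
Qed.

Lemma soft_smooth (e : R) (P Q : E -> R) : 0 < e -> smooth P -> smooth Q ->
  smooth (fun x => Num.sqrt ((P x - Q x) ^+ 2 + e ^+ 2)).
Proof.
move=> e0 sP sQ; apply: smooth_sqrt.
  by apply: smoothD; [apply: smoothX; exact: smoothB|exact: smooth_cst].
by move=> x; rewrite ltr_wpDl ?sqr_ge0// exprn_gt0.
Qed.

Lemma sqrt_soft_bounds (y e : R) : 0 < e ->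
  [/\ 0 < Num.sqrt (y ^+ 2 + e ^+ 2), `|y| <= Num.sqrt (y ^+ 2 + e ^+ 2) &
   Num.sqrt (y ^+ 2 + e ^+ 2) <= `|y| + e].
Proof.
move=> e0; have p : 0 < y ^+ 2 + e ^+ 2 by rewrite ltr_wpDl ?sqr_ge0// exprn_gt0.
split; first by rewrite sqrtr_gt0.
  by rewrite -sqrtr_sqr ler_wsqrtr// lerDl sqr_ge0.
have q : 0 <= `|y| + e by rewrite addr_ge0// ltW.
rewrite -[leRHS]ger0_norm// -sqrtr_sqr ler_wsqrtr// sqrrD real_normK ?num_real//.
by rewrite -addrA lerD2l lerDr mulrn_wge0// mulr_ge0// ltW.
Qed.

(** The maximum for [s = 1] and the minimum for [s = -1], so that both are treated at once. *)
Definition soft (s u v : R) : R := 2^-1 * (u + v + s * `|u - v|).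

(** The absolute value of [y = P - Q] is smoothed to [sqrt (y^2 + e^2)], whose derivative carries
    the factor [y / sqrt (y^2 + e^2)] of modulus at most 1. Where [P] and [Q] differ this factor
    tends to the sign of [y], which selects the active function. *)
Lemma lattice_soft (s : R) P Q : s = 1 \/ s = -1 ->
  lattice_approx P -> lattice_approx Q ->
  lattice_approx (fun x => soft s (P x) (Q x)).
Proof.
move=> s1 [Pn [CP [CP0 sP dP eP lP]]] [Qn [CQ [CQ0 sQ dQ eQ lQ]]].
have s2 : `|s| = 1 by case: s1 => ->; rewrite ?normrN normr1.
pose e n : R := n.+1%:R^-1.
have e0 n : 0 < e n by rewrite invr_gt0 ltr0n.
pose r n x := Num.sqrt ((Pn n x - Qn n x) ^+ 2 + e n ^+ 2).
have sr n : smooth (r n) by exact: soft_smooth.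
have sb n x := @sqrt_soft_bounds (Pn n x - Qn n x) (e n) (e0 n).
pose F n x := 2^-1 * (Pn n x + Qn n x + s * r n x).
have sPQ n : smooth (fun x => Pn n x - Qn n x) by exact: smoothB.
have dr n i x : pderiv i (r n) x =
    (Pn n x - Qn n x) / r n x * (pderiv i (Pn n) x - pderiv i (Qn n) x).
  have r0 : r n x != 0 by have [h _ _] := sb n x; rewrite gt_eqF.
  rewrite /r pderiv_sqrt; last by rewrite ltr_wpDl ?sqr_ge0// exprn_gt0.
    rewrite pderivD; [|exact: smoothX|exact: smooth_cst].
    rewrite pderiv_cst addr0 pderivX2// pderivB// -/(r n x).
    by field.
  by apply: smoothD; [exact: smoothX|exact: smooth_cst].
have dF n i x : pderiv i (F n) x = 2^-1 * (pderiv i (Pn n) x + pderiv i (Qn n) x +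
    s * ((Pn n x - Qn n x) / r n x * (pderiv i (Pn n) x - pderiv i (Qn n) x))).
  rewrite /F pderivZ; last first.
    by apply: smoothD; [exact: smoothD|exact: smoothZ].
  rewrite pderivD; [|exact: smoothD|exact: smoothZ].
  by rewrite pderivD// pderivZ// dr.
have dFn i x : (fun n => pderiv i (F n) x) = fun n => 2^-1 * (pderiv i (Pn n) x +
    pderiv i (Qn n) x +
    s * ((Pn n x - Qn n x) / r n x * (pderiv i (Pn n) x - pderiv i (Qn n) x))).
  by apply/funext => n; exact: dF.
have rho n x : `|(Pn n x - Qn n x) / r n x| <= 1.
  have [h1 h2 _] := sb n x.
  by rewrite normrM normfV (gtr0_norm h1) ler_pdivrMr// mul1r.
(* [CP + CQ] bounds the gradients; the [1] pays for smoothing the absolute value with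
   [e n = 1 / (n + 1)]. *)
exists F, (CP + CQ + 1); split.
- by rewrite !addr_ge0.
- move=> n; apply: smoothZ; apply: smoothD; [exact: smoothD|exact: smoothZ].
- move=> n i x; rewrite dF normrM ger0_norm ?invr_ge0//.
  have h := rho n x; have h1 := dP n i x; have h2 := dQ n i x.
  rewrite ler_pdivrMl//.
  apply: le_trans (ler_normD _ _) _; apply: le_trans (lerD (ler_normD _ _) _) _.
    rewrite normrM s2 mul1r normrM; exact: (ler_pM _ _ h (ler_normB _ _)).
  rewrite mul1r; lra.
- move=> n x; have [h1 h2 h3] := sb n x; have h4 := eP n x; have h5 := eQ n x.
  rewrite /F /soft -mulrBr normrM ger0_norm ?invr_ge0// ler_pdivrMl//.
  have h6 : `|r n x - `|Pn n x - Qn n x| | <= e n.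
    by rewrite ger0_norm ?subr_ge0// lerBlDl.
  have h7 : `| `|Pn n x - Qn n x| - `|P x - Q x| | <= `|Pn n x - P x| + `|Qn n x - Q x|.
    apply: le_trans (ler_dist_dist _ _) _.
    rewrite (_ : _ - _ = (Pn n x - P x) - (Qn n x - Q x)); last by ring.
    exact: ler_normB.
  have -> : Pn n x + Qn n x + s * r n x - (P x + Q x + s * `|P x - Q x|) =
    (Pn n x - P x) + (Qn n x - Q x) + s * ((r n x - `|Pn n x - Qn n x|) +
      (`|Pn n x - Qn n x| - `|P x - Q x|)) by ring.
  apply: le_trans (ler_normD _ _) _; apply: le_trans (lerD (ler_normD _ _) (lexx _)) _.
  rewrite normrM s2 mul1r.
  have h8 := le_trans (ler_normD _ _) (lerD h6 h7).
  have -> : 2 * ((CP + CQ + 1) * e n) = 2 * (CP * e n) + 2 * (CQ * e n) + 2 * e n by ring.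
  rewrite -/(e n) in h4 h5; have := e0 n; lra.
move=> x; have [[kP hP] gP] := lP x; have [[kQ hQ] gQ] := lQ x.
have cP : Pn n x @[n --> \oo] --> P x by exact: cvg_rate (fun n => eP n x).
have cQ : Qn n x @[n --> \oo] --> Q x by exact: cvg_rate (fun n => eQ n x).
(* When [P x = Q x] the sign factor need not converge, but off ties the gradients of [Pn] and [Qn]
   have the same limit, so the term with that bounded factor vanishes. *)
have [PQ|PQ] := eqVneq (P x) (Q x).
  have sP' : soft s (P x) (Q x) = P x.
    by rewrite /soft PQ subrr normr0 mulr0 addr0; field.
  rewrite sP'; split; first by exists kP.
  move=> ux k hk i; have c1 := gP ux k hk i.
  have c2 : pderiv i (Qn n) x @[n --> \oo] --> g k ord0 i.
    by apply: gQ => //; rewrite -PQ.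
  have c3 : pderiv i (Pn n) x - pderiv i (Qn n) x @[n --> \oo] --> (0 : R).
    by rewrite -(subrr (g k ord0 i)); exact: cvgB.
  have c4 := cvg0_bounded (fun n => rho n x) c3.
  rewrite dFn.
  have -> : g k ord0 i = 2^-1 * (g k ord0 i + g k ord0 i + s * 0) by field.
  by apply: cvgMr; apply: cvgD; [exact: cvgD|exact: cvgMr].
pose y := P x - Q x; have y0 : y != 0 by rewrite subr_eq0.
have ny0 : 0 < `|y| by rewrite normr_gt0.
have crho : (Pn n x - Qn n x) / r n x @[n --> \oo] --> y / `|y|.
  apply: cvgM; first exact: cvgB.
  apply: cvgV; first by rewrite gt_eqF.
  rewrite -sqrtr_sqr -[y ^+ 2]addr0 -[X in _ + X](expr0n R 2).
  apply: (@continuous_cvg _ _ _ _ _ _ (@Num.sqrt R)); first exact: sqrt_continuous.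
  apply: cvgD; rewrite !expr2; apply: cvgM; try exact: cvgB; exact: cvg_harmonic.
have lim i : pderiv i (F n) x @[n --> \oo] -->
    2^-1 * (g kP ord0 i + g kQ ord0 i + s * (y / `|y| * (g kP ord0 i - g kQ ord0 i)))
    \/ ~ untied x.
  have [ux|] := pselect (untied x); last by right.
  left; rewrite dFn.
  have c1 := gP ux kP hP i; have c2 := gQ ux kQ hQ i.
  apply: cvgMr; apply: cvgD; first exact: cvgD.
  by apply: cvgMr; apply: cvgM => //; exact: cvgB.
have W : soft s (P x) (Q x) = P x /\ s * (y / `|y|) = 1 \/
    soft s (P x) (Q x) = Q x /\ s * (y / `|y|) = -1.
  rewrite /soft -/y; have ye : P x = Q x + y by rewrite /y addrC subrK.
  case: s1 => ->; rewrite ?mul1r ?mulN1r; case: (ltrgtP y 0) y0 => // yn _.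
  - right; rewrite ltr0_norm// ye; split; first by field.
    by rewrite invrN mulrN mulfV// lt_eqF.
  - left; rewrite gtr0_norm// ye; split; first by field.
    by rewrite mulfV// gt_eqF.
  - left; rewrite ltr0_norm// ye; split; first by field.
    by rewrite invrN mulrN mulfV ?opprK// lt_eqF.
  - right; rewrite gtr0_norm// ye; split; first by field.
    by rewrite mulfV// gt_eqF.
split; first by case: W => -[-> _]; [exists kP|exists kQ].
move=> ux k hk i; case: (lim i) => // c.
suff <- : 2^-1 * (g kP ord0 i + g kQ ord0 i +
  s * (y / `|y| * (g kP ord0 i - g kQ ord0 i))) = g k ord0 i by [].
rewrite mulrA; case: W => -[e1 ->].
  have -> : g k = g kP by apply: ux; rewrite -hk e1 hP.
  by field.
have -> : g k = g kQ by apply: ux; rewrite -hk e1 hQ.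
by field.
Unshelve. all: by end_near. Qed.

Lemma lattice_max P Q : lattice_approx P -> lattice_approx Q ->
  lattice_approx (fun x => Num.max (P x) (Q x)).
Proof.
move=> lP lQ; rewrite (_ : (fun _ => _) = fun x => soft 1 (P x) (Q x)).
  by apply: lattice_soft => //; left.
apply/funext => x; rewrite /soft mul1r.
case: (leP (P x) (Q x)) => h.
  by rewrite ler0_norm ?subr_le0//; field.
by rewrite gtr0_norm ?subr_gt0//; field.
Qed.

Lemma lattice_min P Q : lattice_approx P -> lattice_approx Q ->
  lattice_approx (fun x => Num.min (P x) (Q x)).
Proof.
move=> lP lQ; rewrite (_ : (fun _ => _) = fun x => soft (-1) (P x) (Q x)).
  by apply: lattice_soft => //; right.
apply/funext => x; rewrite /soft mulN1r.
case: (leP (P x) (Q x)) => h.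
  by rewrite ler0_norm ?subr_le0//; field.
by rewrite gtr0_norm ?subr_gt0//; field.
Qed.

Lemma lattice_bigmin (s : seq T) k0 :
  lattice_approx (fun x => \big[Num.min/ell k0 x]_(k <- s) ell k x).
Proof.
elim: s => [|k s IH].
  rewrite (_ : (fun _ => _) = ell k0); first exact: lattice_ell.
  by apply/funext => x; rewrite big_nil.
rewrite (_ : (fun _ => _) = fun x => Num.min (ell k x) (\big[Num.min/ell k0 x]_(k <- s) ell k x)).
  by apply: lattice_min => //; exact: lattice_ell.
by apply/funext => x; rewrite big_cons.
Qed.

Lemma lattice_bigmax (I : Type) (s : seq I) (F : I -> E -> R) (F0 : E -> R) :
  (forall i, lattice_approx (F i)) -> lattice_approx F0 ->
  lattice_approx (fun x => \big[Num.max/F0 x]_(i <- s) F i x).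
Proof.
move=> hF hF0; elim: s => [|k s IH].
  rewrite (_ : (fun _ => _) = F0)//.
  by apply/funext => x; rewrite big_nil.
rewrite (_ : (fun _ => _) = fun x => Num.max (F k x) (\big[Num.max/F0 x]_(k <- s) F k x)).
  exact: lattice_max.
by apply/funext => x; rewrite big_cons.
Qed.

End lattice.

(** * Finite element functions as limits of test functions *)

Section piecewise_affine.
Context {R : realType} {d : nat}.
Variable L : R.
Hypotheses (L0 : 0 < L) (d0 : (0 < d)%N).
Local Notation E := 'rV[R]_d.
Local Notation mu := (@lebesgue R d).
Local Notation D := (@cube R d L).
Variable M : mesh D.
Local Notation vertex := ('I_(nvtx M)).
Local Notation simp := (simplices M).
Local Notation hullM := (hull (@vtx R d D M)).
Implicit Types (K : {set vertex}) (f : E -> R).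

Definition seg (p q : E) (t : R) : E := p + t *: (q - p).

Lemma seg_D p q t : D p -> D q -> 0 <= t <= 1 -> D (seg p q t).
Proof.
move=> Dp Dq /andP[t0 t1] i; rewrite !mxE.
have /andP[p1 p2] := Dp i; have /andP[q1 q2] := Dq i.
apply/andP; split; nra.
Qed.

Lemma seg_affine (a : R) (g : E) p q t :
  a + dotv g (seg p q t) = (1 - t) * (a + dotv g p) + t * (a + dotv g q).
Proof. by rewrite /seg dotvDr dotvZr dotvBr; ring. Qed.

Lemma seg_continuous p q : continuous (seg p q).
Proof.
move=> t; apply: cvgD; first exact: cvg_cst.
by apply: cvgZl; exact: cvg_id.
Qed.

(** Otherwise each of the finitely many simplices misses the segment on some interval to the right
    of 0: those not containing [p] because they are closed, the others by assumption. A time common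
    to these intervals contradicts the covering. *)
Lemma simplex_right p q : D p -> D q -> exists K, [/\ K \in simp, hullM K p &
  forall e : R, 0 < e -> exists t, [/\ 0 < t, t < e, t <= 1 & hullM K (seg p q t)]].
Proof.
move=> Dp Dq; apply: contrapT => /forallNP h.
have hK K : \forall t \near (0 : R)^'+, K \in simp -> t <= 1 -> ~ hullM K (seg p q t).
  have [KS|KS] := boolP (K \in simp); last by apply: nearW.
  have [Kp|Kp] := pselect (hullM K p).
    have /not_and3P[//|//|/existsNP[e /not_implyP[e0 /forallNP he]]] := h K.
    have h1 := nbhs_right_gt (0 : R); have h2 := nbhs_right_lt e0.
    by apply: filterS2 h1 h2 => t t0 te _ t1 Kt; apply: (he t).
  have hn : nbhs (seg p q 0) (~` hullM K).
    rewrite /seg scale0r addr0; apply: open_nbhs_nbhs; split => //.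
    apply: closed_openC; exact: hull_closed (simplex_card KS) (simplex_free KS).
  have cs : seg p q t @[t --> (0 : R)] --> seg p q 0 by exact: seg_continuous.
  have hr : \forall t \near (0 : R)^'+, ~ hullM K (seg p q t).
    exact: (cvg_at_right_filter cs hn).
  by apply: filterS hr => t Kt _ _.
have hall := @filter_forall _ _ _ _ (at_right_proper_filter (0 : R)) hK.
have h1 := nbhs_right_gt (0 : R); have h2 := nbhs_right_le (ltr01 : 0 < 1 :> R).
have [t [t0 [t1 ht]]] := @filter_ex _ _ (at_right_proper_filter (0 : R)) _
  (filterI h1 (filterI h2 hall)).
have Dt : D (seg p q t) by apply: seg_D => //; rewrite ltW.
have [K KS Kt] := mesh_mem M Dt.
by have := ht K KS t1.
Qed.

Variables (f : E -> R) (a : {set vertex} -> R) (g : {set vertex} -> E).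
Hypothesis fK : forall K, K \in simp -> forall x, hullM K x -> f x = a K + dotv (g K) x.

(* The separation lemma behind Ovchinnikov's max-min representation. *)
Lemma piece_between p q : D p -> D q -> exists K, [/\ K \in simp,
  a K + dotv (g K) p <= f p & f q <= a K + dotv (g K) q].
Proof.
move=> Dp Dq; apply: contrapT => /forallNP H.
pose al K := a K + dotv (g K) p - f p; pose be K := a K + dotv (g K) q - f q.
(* The negated claim in terms of the deviations from [f] at the end points: a piece not above [f] at
   [p] is strictly below [f] at [q]. *)
have {}H K : K \in simp -> al K <= 0 -> be K < 0.
  move=> KS; rewrite /al /be subr_le0 subr_lt0 => h1; rewrite ltNge; apply/negP => h2.
  by apply: (H K); split.
(* [f] along the segment minus its chord; inside one simplex it interpolates linearly between [al K]
   and [be K]. *)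
pose h t := f (seg p q t) - ((1 - t) * f p + t * f q).
have hE K t : K \in simp -> hullM K (seg p q t) -> h t = (1 - t) * al K + t * be K.
  by move=> KS Kt; rewrite /h (fK KS Kt) seg_affine /al /be; ring.
have segC t : seg p q (1 - t) = seg q p t by apply/rowP => i; rewrite !mxE; ring.
(* Close to [q]: a piece active at [q] has [be K = 0], hence [al K > 0]. *)
have [t1 [t10 t11 ht1]] : exists t, [/\ 0 <= t, t < 1 & 0 < h t].
  have [K [KS Kq]] := simplex_right Dq Dp.
  move=> /(_ 1 ltr01) [t [t0 t1 _ Kt]]; exists (1 - t); split; [lra|lra|].
  have be0 : be K = 0 by rewrite /be -(fK KS Kq) subrr.
  rewrite (hE K) ?segC// be0 mulr0 addr0 mulr_gt0//; first lra.
  by rewrite ltNge; apply/negP => /(H K KS); rewrite be0 ltxx.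
pose S := [set t : R | [/\ 0 <= t, t <= t1 & h t <= 0]].
have S0 : S 0.
  split=> //; rewrite /h /seg scale0r addr0; lra.
have ubS : has_ubound S by exists t1 => t [].
have SE : S = \bigcup_(K in [set` simp])
    (`[0, t1]%classic `&` (seg p q @^-1` hullM K `&`
      [set t : R | (1 - t) * al K + t * be K <= 0])).
  apply/seteqP; split=> t.
    move=> [h1 h2 h3]; have Dt : D (seg p q t) by apply: seg_D => //; lra.
    have [K KS Kt] := mesh_mem M Dt; exists K => //; split.
      by rewrite /= in_itv/= h1.
    by split=> //=; rewrite -(hE K).
  move=> [K /= KS [/=]]; rewrite in_itv/= => /andP[h1 h2] [Kt h3].
  by split=> //; rewrite (hE K).
have cS : closed S.
  rewrite SE; apply: closed_bigcup => [|K KS]; first exact: finite_finset.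
  apply: closedI; first exact: interval_closed.
  apply: closedI.
    apply: preimage_closed; last first.
      by exact: hull_closed (simplex_card KS) (simplex_free KS).
    by move=> t _; exact: seg_continuous.
  apply: (@preimage_closed _ _ (fun t : R => (1 - t) * al K + t * be K) [set r | r <= 0]).
    move=> t _; apply: cvgD; apply: cvgM => //; try exact: cvg_cst.
    by apply: cvgB; [exact: cvg_cst|exact: cvg_id].
  exact: closed_le.
(* The last time before [t1] at which [f] is not above its chord. A piece active at [z] and just
   after it increases relative to the chord, so it starts below [f] at [p] and ends above [f] at
   [q], against the negated claim. *)
pose z := sup S.
have Sz : S z.
  have := closure_sup (ex_intro _ _ S0) ubS.
  by move/closure_id : cS => <-.
have [z0 zt1 hz] := Sz.
have zt : z < t1.
  rewrite lt_neqAle zt1 andbT; apply/eqP => e; move: ht1; rewrite -e; lra.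
have Dz : D (seg p q z) by apply: seg_D => //; lra.
have [K [KS Kz]] := simplex_right Dz Dq.
have dz : 0 < t1 - z by lra.
move=> /(_ _ dz) [t [t0 tt tle Kt]].
have segz : seg (seg p q z) q t = seg p q (z + t * (1 - z)).
  by apply/rowP => i; rewrite !mxE; ring.
rewrite segz in Kt; set t' := z + t * (1 - z) in Kt.
have zt' : z < t' by rewrite /t' ltrDl mulr_gt0//; lra.
have t't : t' <= t1 by rewrite /t'; nra.
have ht' : 0 < h t'.
  rewrite ltNge; apply/negP => ht; have : S t' by split => //; lra.
  by move=> /(ub_le_sup ubS); rewrite -/z leNgt zt'.
have := H K KS; rewrite (hE K) in hz => //; rewrite (hE K) in ht' => //.
move=> HH; have slope : 0 < be K - al K by nra.
have : al K <= 0 by nra.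
by move=> /HH; nra.
Qed.

End piecewise_affine.

(** * Thresholding *)

Section threshold.
Context {R : realType} {d : nat}.
Local Notation E := 'rV[R]_d.

(* Turns a function that vanishes on the boundary into a compactly supported one. *)
Definition thr (e s : R) : R := s * flat 0 ((s - e) / e).

Lemma flat0_le1 (z : R) : flat 0 z <= 1.
Proof.
rewrite /flat; case: ifP => // z0.
by rewrite expr0 invr1 mul1r -expR0 ler_expR oppr_le0 invr_ge0 ltW.
Qed.

Lemma thr_le0 e s : 0 < e -> s <= e -> thr e s = 0.
Proof.
by move=> e0 se; rewrite /thr flat_le0 ?mulr0// mulr_le0_ge0 ?subr_le0// invr_ge0 ltW.
Qed.

Lemma thr_norm e s : `|thr e s| <= `|s|.
Proof. by rewrite /thr normrM ler_piMr// ger0_norm ?flat_ge0// flat0_le1. Qed.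

(** The derivative of [thr e], as [thr_pderiv] shows. *)
Definition dthr (e s : R) : R :=
  flat 0 ((s - e) / e) + (s / e) * flat 2 ((s - e) / e).

Lemma dthr_expE e s : 0 < e -> e < s ->
  dthr e s = expR (- (e / (s - e))) * (1 + e / (s - e) + (e / (s - e)) ^+ 2).
Proof.
move=> e0 es; have z0 : 0 < (s - e) / e by rewrite divr_gt0// subr_gt0.
have en : e != 0 by rewrite gt_eqF.
have sn : s - e != 0 by rewrite gt_eqF// subr_gt0.
by rewrite /dthr /flat z0 invf_div; field; rewrite en sn.
Qed.

(** With [y = e / (s - e)] the value is [exp (-y) (1 + y + y^2)], and both [1 + y] and [y^2 / 2] are
    at most [exp y]. The bound does not depend on [e], as dominated convergence requires. *)
Lemma dthr_bound e s : 0 < e -> `|dthr e s| <= 3.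
Proof.
move=> e0; have [se|es] := leP s e.
  rewrite /dthr !flat_le0 ?mulr0 ?addr0 ?normr0//;
  by rewrite mulr_le0_ge0 ?subr_le0// invr_ge0 ltW.
rewrite dthr_expE//; set y := e / (s - e).
have y0 : 0 <= y by rewrite divr_ge0 ?ltW// subr_gt0.
rewrite ger0_norm; last by rewrite mulr_ge0 ?expR_ge0// !addr_ge0// sqr_ge0.
rewrite expRN mulrC ler_pdivrMr ?expR_gt0//.
have h1 := expR_ge1Dx y; have h2 := expR_ge1Dxn 1 y0.
rewrite (_ : 2`!%:R = 2 :> R) in h2 => //; lra.
Qed.

Lemma thr_smooth e (P : E -> R) : 0 < e -> smooth P -> smooth (fun x => thr e (P x)).
Proof.
move=> e0 sP; apply: (smoothM sP); apply: smooth_flat.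
exact: (smoothM (smoothB sP (smooth_cst _)) (smooth_cst _)).
Qed.

Lemma thr_pderiv e (P : E -> R) i x : 0 < e -> smooth P ->
  pderiv i (fun x => thr e (P x)) x = dthr e (P x) * pderiv i P x.
Proof.
move=> e0 sP; have en : e != 0 by rewrite gt_eqF.
have sz : smooth (fun x => (P x - e) / e).
  exact: (smoothM (smoothB sP (smooth_cst _)) (smooth_cst _)).
rewrite /thr (pderivM _ _ sP (smooth_flat sz)).
rewrite (pderiv_flat _ _ _ sz) mul0r subr0.
have -> : pderiv i (fun x => (P x - e) / e) x = e^-1 * pderiv i P x.
  rewrite (_ : (fun x => _) = fun x => e^-1 * (P x - e)).
    rewrite (pderivZ _ _ _ (smoothB sP (smooth_cst _))).
    by rewrite (pderivB _ _ sP (smooth_cst _)) pderiv_cst subr0.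
  by apply/funext => y; rewrite mulrC.
by rewrite /dthr; field.
Qed.

(** For [l > 0] the ratio [e / (s - e)] tends to 0 and the cutoff factor to 1; for [l = 0] the bound
    [thr_norm] is enough. *)
Lemma thr_cvg (e s : nat -> R) (l : R) : (forall n, 0 < e n) ->
  e @ \oo --> (0 : R) -> s @ \oo --> l -> 0 <= l ->
  thr (e n) (s n) @[n --> \oo] --> l /\
  (0 < l -> dthr (e n) (s n) @[n --> \oo] --> (1 : R)).
Proof.
move=> e0 ce cs; rewrite le_eqVlt => /predU1P[l0|l0].
  split; last by rewrite -l0 ltxx.
  rewrite -l0; apply/norm_cvg0P.
  have : `|s n| @[n --> \oo] --> (0 : R) by apply/norm_cvg0P; rewrite l0.
  by apply: cvg0_le => n; rewrite normr_ge0 thr_norm.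
have cse : s n - e n @[n --> \oo] --> l by rewrite -(subr0 l); exact: cvgB.
have cy : e n / (s n - e n) @[n --> \oo] --> (0 : R).
  rewrite -(mul0r l^-1); apply: cvgM => //; apply: cvgV => //.
  by rewrite gt_eqF.
have cexp : expR (- (e n / (s n - e n))) @[n --> \oo] --> (1 : R).
  rewrite -expR0 -oppr0; apply: (@continuous_cvg _ _ _ _ _ _ (@expR R)).
    exact: continuous_expR.
  exact: cvgN.
have nr : \forall n \near \oo, e n < s n.
  have : \forall n \near \oo, 0 < s n - e n by exact: (cvgr_gt _ cse).
  by apply: filterS => n; rewrite subr_gt0.
split=> [|_].
  have : s n * expR (- (e n / (s n - e n))) @[n --> \oo] --> l.
    by rewrite -(mulr1 l); exact: cvgM.
  apply: cvg_trans; apply: near_eq_cvg; apply: filterS nr => n h.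
  rewrite /thr /flat ifT; last by rewrite divr_gt0// subr_gt0.
  by rewrite expr0 invr1 mul1r invf_div.
have : expR (- (e n / (s n - e n))) *
    (1 + e n / (s n - e n) + (e n / (s n - e n)) ^+ 2) @[n --> \oo] --> (1 : R).
  rewrite [X in _ --> X](_ : 1 = 1 * (1 + 0 + 0 * 0)); last by ring.
  apply: cvgM => //; apply: cvgD; first by apply: cvgD => //; exact: cvg_cst.
  by under eq_fun do rewrite expr2; exact: cvgM.
apply: cvg_trans; apply: near_eq_cvg; apply: filterS nr => n h.
by rewrite dthr_expE.
Qed.

End threshold.

(** * The max-min representation *)

Section max_min.
Context {R : realType} {d : nat}.
Variable L : R.
Hypotheses (L0 : 0 < L) (d0 : (0 < d)%N).
Local Notation E := 'rV[R]_d.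
Local Notation mu := (@lebesgue R d).
Local Notation D := (@cube R d L).
Variable M : mesh D.
Local Notation vertex := ('I_(nvtx M)).
Local Notation simp := (simplices M).
Local Notation hullM := (hull (@vtx R d D M)).
Variables (f : E -> R) (a : {set vertex} -> R) (g : {set vertex} -> E).
Hypothesis fK : forall K, K \in simp -> forall x, hullM K x -> f x = a K + dotv (g K) x.

(** [None] stands for the zero function, added to the affine pieces of [f]. At an untied point where
    [f] vanishes the active piece ties with it and must therefore have gradient zero. *)
Definition piece_a (k : option {set vertex}) : R := if k is Some K then a K else 0.
Definition piece_g (k : option {set vertex}) : E := if k is Some K then g K else 0.
Local Notation l := (ell piece_a piece_g).

(** [f] is the maximum over base points [b] of the minimum of the pieces that lie above [f] at [b]:
    such a minimum is at most [f] everywhere by [piece_between], and for [b = x] it is at least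
    [f x]. *)
Lemma max_min_repr : exists2 P : E -> R, lattice_approx piece_a piece_g P &
  forall x, D x -> P x = f x.
Proof.
pose S b : {set option {set vertex}} :=
  [set k | if k is Some K then (K \in simp) && (f b <= l (Some K) b) else false]%SET.
have D00 : D 0 by move=> i; rewrite mxE oppr_le0 (ltW L0).
have nS b : D b -> exists k, k \in S b.
  move=> Db; have [K KS Kb] := mesh_mem M Db; exists (Some K).
  by rewrite inE KS /l/= /ell/= -(fK KS Kb) lexx.
pose k0 b := odflt None [pick k | k \in S b].
have k0S b : D b -> k0 b \in S b.
  move=> /nS[k kS]; rewrite /k0; case: pickP => [k' //|/(_ k)].
  by rewrite kS.
pose m b x := \big[Num.min/l (k0 b) x]_(k <- enum (S b)) l k x.
have mle b x : D b -> D x -> m b x <= f x.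
  move=> Db Dx; have [K [KS h1 h2]] := piece_between fK Dx Db.
  apply: le_trans h1; rewrite -[leRHS]/(l (Some K) x).
  apply: (@bigmin_inf_seq _ _ _ _ _ (Some K)) => //.
  by rewrite mem_enum inE KS.
have mge b b' x : D b' -> S b' = S b -> (forall k, k \in S b -> f x <= l k x) -> f x <= m b' x.
  move=> Db' e h; rewrite /m big_seq; apply: le_bigmin.
    by apply: h; rewrite -e; exact: k0S.
  by move=> k; rewrite mem_enum e => /h.
(* Only finitely many sets [S b] occur, so the maximum runs over sets of pieces, each with a
   representative base point. A set that does not occur gets the point 0 of the cube, whose minimum
   is still at most [f]. *)
pose rep s : E := xget 0 [set b | D b /\ S b = s].
have repD s : D (rep s).
  rewrite /rep; case: xgetP => [y -> []//|_]; exact: D00.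
exists (fun x => \big[Num.max/m 0 x]_(s : {set option {set vertex}}) m (rep s) x).
  apply: lattice_bigmax => [s|]; exact: lattice_bigmin.
move=> x Dx; apply/eqP; rewrite eq_le; apply/andP; split.
  by apply: bigmax_le => [|s _]; apply: mle.
apply: (@bigmax_sup _ _ _ _ (S x)) => //.
have [Db Sb] : D (rep (S x)) /\ S (rep (S x)) = S x.
  by rewrite /rep; case: xgetP => [y -> //|/(_ x)]; case; split.
apply: (mge x) => // k; rewrite inE; case: k => // K /andP[_].
by [].
Qed.

End max_min.

Section bounded_convergence.
Context {disp : measure_display} {T : measurableType disp} {R : realType}.
Variables (mu : {measure set T -> \bar R}) (D : set T).
Hypotheses (mD : measurable D) (muD : (mu D < +oo)%E).

Lemma L2cvg_bounded (f_ : nat -> T -> R) (f : T -> R) (C : R) :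
  (forall n, measurable_fun D (f_ n)) -> measurable_fun D f ->
  (forall n x, D x -> `|f_ n x - f x| <= C) ->
  {ae mu, forall x, D x -> f_ ^~ x @ \oo --> f x} ->
  L2cvg mu D f_ f.
Proof.
move=> mf_ mf bd cv; rewrite /L2cvg.
have [|||||_] := @Int_dct _ _ R mu D mD (fun n x => (f_ n x - f x) ^+ 2) (fun=> 0) (fun=> C ^+ 2).
- by move=> n; apply: measurable_funX; exact: measurable_funB.
- exact: measurable_cst.
- apply: filterS cv => x h Dx; rewrite /=.
  have c0 : f_ n x - f x @[n --> \oo] --> (0 : R).
    by rewrite -(subrr (f x)); apply: cvgB; [exact: h|exact: cvg_cst].
  rewrite (_ : (fun n => _) = fun n => (f_ n x - f x) * (f_ n x - f x)).
    by rewrite -(mulr0 0); exact: cvgM.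
  by apply/funext => n; rewrite expr2.
- exact: intg_cst.
- move=> n x Dx; rewrite ger0_norm ?sqr_ge0//.
  by rewrite -(real_normK (num_real (_ - _))) lerXn2r ?nnegrE//; [exact: le_trans (bd n x Dx)|exact: bd].
- by rewrite Rintegral_cst// mul0r.
Qed.

End bounded_convergence.

Section within.
Context {R : realType} {d : nat}.

Lemma within_bounded (D : set 'rV[R]_d) (f : 'rV[R]_d -> R) : compact D ->
  {within D, continuous f} -> exists2 C : R, 0 <= C & forall x, D x -> `|f x| <= C.
Proof.
move=> cD cf; have /compact_bounded[C [_ h]] := continuous_compact cf cD.
exists (`|C| + 1) => // x Dx.
by apply: (h (`|C| + 1)); [rewrite ltr_pwDr// ler_norm|exists x].
Qed.

End within.

Section untied.
Context {R : realType} {d : nat} {T : finType}.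
Variables (a : T -> R) (g : T -> 'rV[R]_d).

(** Two pieces with different gradients agree on a hyperplane only, and there are finitely many
    pairs. *)
Lemma ae_untied : {ae (lebesgue d), forall x, untied a g x}.
Proof.
have h (p : T * T) : {ae (lebesgue d), forall x, ell a g p.1 x = ell a g p.2 x -> g p.1 = g p.2}.
  have [e|ne] := eqVneq (g p.1) (g p.2); first exact: aeW.
  exists [set x | a p.1 - a p.2 + dotv (g p.1 - g p.2) x = 0]; split.
  - apply: closed_measurable_rV.
    apply: (@preimage_closed _ _ (fun x => a p.1 - a p.2 + dotv (g p.1 - g p.2) x) [set 0]) => //.
    by move=> x _; exact: continuous_affine.
  - by apply: affine_null; rewrite subr_eq0.
  - move=> x /= /not_implyP[e _]; move: e; rewrite /ell dotvBl => e.
    by rewrite addrACA e -opprD subrr.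
have := @filter_forall _ _ _ _ (ae_filter_ringOfSetsType (lebesgue d)) h.
by apply: filterS => x hx k k' e; exact: (hx (k, k')).
Qed.

End untied.

(** * Nonnegative piecewise affine functions and their gradients *)

Section piecewise_gradient.
Context {R : realType} {d : nat}.
Variable L : R.
Hypotheses (L0 : 0 < L) (d0 : (0 < d)%N).
Local Notation E := 'rV[R]_d.
Local Notation mu := (@lebesgue R d).
Local Notation D := (@cube R d L).
Variable M : mesh D.
Local Notation vertex := ('I_(nvtx M)).
Local Notation simp := (simplices M).
Local Notation hullM := (hull (@vtx R d D M)).
Let mD : measurable D := cube_measurable L.
Let muD : (mu D < +oo)%E := cube_finite L.
Variables (f : E -> R) (a : {set vertex} -> R) (g : {set vertex} -> E).
Hypothesis fK : forall K, K \in simp -> forall x, hullM K x -> f x = a K + dotv (g K) x.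
Hypothesis fc : {within D, continuous f}.
Hypothesis fout : forall x, ~ D° x -> f x = 0.
Hypothesis f0 : forall x, D x -> 0 <= f x.

(** On overlaps of simplices, which are null, the contributions add up; this avoids choosing a
    simplex for each point. *)
Definition pgrad (h : {set vertex} -> E) (i : 'I_d) (x : E) : R :=
  \sum_(K in simp) h K ord0 i * \1_(hullM K) x.

Lemma pgrad_meas h i : measurable_fun D (pgrad h i).
Proof.
apply: (@intg_meas _ _ _ mu); apply: (intg_sum mD) => K KS.
apply: (intg_le mD _ _ (intg_cst mD muD `|h K ord0 i|)).
  by apply: measurable_funM => //; apply: measurable_indic; exact: mhull.
by move=> x _; rewrite normrM ler_piMr// ger0_norm// indicE lern1 leq_b1.
Qed.

Lemma pgrad_bound h i : exists2 C : R, 0 <= C & forall x, `|pgrad h i x| <= C.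
Proof.
exists (\sum_(K in simp) `|h K ord0 i|); first exact: sumr_ge0.
move=> x; apply: le_trans (ler_norm_sum _ _ _) _; apply: ler_sum => K _.
by rewrite normrM ler_piMr// ger0_norm// indicE lern1 leq_b1.
Qed.

Lemma ae_pgrad h : {ae mu, forall x, D x -> exists K,
  [/\ K \in simp, hullM K x & forall i, pgrad h i x = h K ord0 i]}.
Proof.
apply: filterS (ae_unique_simplex d0 M) => x u Dx.
have [K KS Kx] := mesh_mem M Dx; exists K; split=> // i.
rewrite /pgrad (bigD1 K)//= indicE mem_set// mulr1 big1 ?addr0// => K' /andP[KS' nK].
rewrite indicE memNset ?mulr0// => Kx'; move/negP: nK; apply.
by rewrite (u _ _ KS' KS Kx' Kx).
Qed.

(** The smoothed max-min form is thresholded above its approximation error and so vanishes near the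
    boundary of the cube, where [f] is zero. Nonnegativity enters because thresholding also removes
    negative values. *)
Lemma pl_is_grad_ge0 : is_grad L f (pgrad g).
Proof.
have [P [Pn [C [C0 sP dP eP lP]]] Pf] := max_min_repr L0 fK.
(* Strictly larger than the uniform error [C / (n + 1)], so that within the cube [Pn n] reaches
   [e n] only where [f] is positive. *)
pose e n : R := 2 * (C + 1) * n.+1%:R^-1.
have C1 : 0 < C + 1 by rewrite ltr_wpDl.
have e0 n : 0 < e n by rewrite mulr_gt0// ?mulr_gt0// invr_gt0 ltr0n.
pose S n := D `&` [set x | e n <= Pn n x].
have cS n : compact (S n).
  apply: (@subclosed_compact E (S n) D _ (@cube_compact R d L)); last by move=> x [].
  apply: closedI; first exact: cube_closed.
  apply: (@preimage_closed _ _ (Pn n) [set y | e n <= y]); last exact: closed_ge.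
  by move=> x _; exact: smooth_continuous.
have SD n : S n `<=` D°.
  move=> x [Dx /= h]; apply: contrapT => nx.
  have := eP n x; rewrite (Pf _ Dx) (fout nx) subr0 => /(le_trans (ler_norm _)) h2.
  have := le_trans h h2; rewrite /e; apply/negP; rewrite -ltNge ltr_pM2r ?invr_gt0 ?ltr0n//.
  by lra.
(* Cut off by hand outside the cube, where the max-min form need not agree with [f]. *)
pose fn n x := if x \in D then thr (e n) (Pn n x) else 0.
have fnS n x : ~ S n x -> fn n x = 0.
  move=> h; rewrite /fn; case: ifPn => //; rewrite inE => Dx.
  by apply: thr_le0 => //; rewrite leNgt; apply/negP => h2; apply: h; split=> //=; exact: ltW.
have fnI n x : D° x -> \forall y \near x, thr (e n) (Pn n y) = fn n y.
  move=> Ix; have : \near x, D x by exact: Ix.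
  by apply: filterS => y Dy; rewrite /fn mem_set.
have tfn n : test_function D (fn n).
  split; last by exists (S n) => //; exact: fnS.
  apply: smooth_local => x; have [Sx|Sx] := pselect (S n x).
    exists (fun x => thr (e n) (Pn n x)); first exact: thr_smooth.
    by apply: fnI; exact: SD Sx.
  exists (fun=> 0); first exact: smooth_cst.
  have oS : open (~` S n) by apply: closed_openC; apply: compact_closed (cS n); exact: rV_hausdorff.
  by have := open_nbhs_nbhs (conj oS Sx); apply: filterS => y /fnS ->.
have dfn n i x : D x -> pderiv i (fn n) x = dthr (e n) (Pn n x) * pderiv i (Pn n) x.
  move=> Dx; have [Sx|Sx] := pselect (S n x).
    rewrite -thr_pderiv//; apply: near_eq_derive.
    by have := fnI n x (SD n _ Sx); apply: filterS => y ->.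
  rewrite (@pderiv_supp _ _ (S n))//; first last.
  - exact: fnS.
  - by apply: compact_closed (cS n); exact: rV_hausdorff.
  have h : Pn n x <= e n.
    by rewrite leNgt; apply/negP => h2; apply: Sx; split=> //=; exact: ltW.
  have z : (Pn n x - e n) / e n <= 0 by rewrite mulr_le0_ge0 ?subr_le0// invr_ge0 ltW.
  by rewrite /dthr !flat_le0// mulr0 addr0 mul0r.
have ce : e @ \oo --> (0 : R).
  by rewrite -(mulr0 (2 * (C + 1))); apply: cvgMr; exact: cvg_harmonic.
have cP x : Pn ^~ x @ \oo --> P x by exact: cvg_rate (fun n => eP n x).
have mf : measurable_fun D f by exact: within_continuous_measurable_rV.
have [B B0 fB] := within_bounded (@cube_compact R d L) fc.
split.
- exact: (sq_intg_bounded mD muD mf fB).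
- move=> i; have [B' _ h] := pgrad_bound g i.
  by apply: (sq_intg_bounded mD muD (pgrad_meas g i)) => x _; exact: h.
exists fn => //; split=> [|i].
  apply: (@L2cvg_bounded _ _ _ mu D mD muD _ _ (B + C + B)) => //.
  - by move=> n; apply: smooth_meas => //; exact: test_smooth (tfn n).
  - move=> n x Dx; apply: le_trans (ler_normB _ _) _; apply: lerD; last exact: fB.
    rewrite /fn mem_set//; apply: le_trans (thr_norm _ _) _.
    rewrite -(subrK (P x) (Pn n x)) addrC; apply: le_trans (ler_normD _ _) _.
    apply: lerD; first by rewrite Pf// fB.
    apply: le_trans (eP n x) _; rewrite ler_piMr// invf_le1 ?ltr0n// ler1n//.
  - apply: aeW => x Dx; rewrite -(Pf _ Dx).
    rewrite (_ : (fun n => _) = fun n => thr (e n) (Pn n x)); last first.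
      by apply/funext => n; rewrite /fn mem_set.
    by have [] := thr_cvg e0 ce (cP x) _; first by rewrite Pf// f0.
have [B' B'0 gB'] := pgrad_bound g i.
apply: (@L2cvg_bounded _ _ _ mu D mD muD _ _ (3 * C + B')).
- by move=> n; apply: smooth_meas => //; exact: test_smooth (test_pderiv i (tfn n)).
- exact: pgrad_meas.
- move=> n x Dx; apply: le_trans (ler_normB _ _) _; apply: lerD => //.
  by rewrite dfn// normrM ler_pM//; exact: dthr_bound.
have ut := @ae_untied R d _ (piece_a a) (piece_g g).
apply: filterS2 ut (ae_pgrad g) => x ux hx Dx.
have [K [KS Kx ->]] := hx Dx.
rewrite (_ : (fun n => _) = fun n => dthr (e n) (Pn n x) * pderiv i (Pn n) x); last first.
  by apply/funext => n; exact: dfn.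
have ePK : P x = ell (piece_a a) (piece_g g) (Some K) x by rewrite Pf//; exact: fK KS _ Kx.
have cg := (lP x).2 ux (Some K) ePK i.
have := f0 Dx; rewrite le_eqVlt => /predU1P[fz|fz]; last first.
  have P0 : 0 <= P x by rewrite Pf// f0.
  have [_ h] := thr_cvg e0 ce (cP x) P0.
  by rewrite -[X in _ --> X]mul1r; apply: cvgM => //; apply: h; rewrite Pf.
have e00 : ell (piece_a a) (piece_g g) None x = 0 by rewrite /ell/= dotv0l addr0.
(* At a zero of [f] the factor [dthr] need not converge, but it is bounded, and the partial
   derivative it multiplies tends to 0. *)
have gK0 : g K = 0 by apply: (ux (Some K) None); rewrite -ePK e00 Pf.
move: cg; rewrite /= gK0 mxE => cg.
have cg3 : 3 * pderiv i (Pn n) x @[n --> \oo] --> (0 : R).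
  by rewrite -(mulr0 3); exact: cvgMr.
rewrite (_ : (fun n => _) = fun n => (dthr (e n) (Pn n x) / 3) * (3 * pderiv i (Pn n) x)).
  apply: cvg0_bounded => // n; rewrite normrM (ger0_norm (_ : 0 <= 3^-1)) ?invr_ge0//.
  by rewrite ler_pdivrMr// mul1r; exact: dthr_bound.
by apply/funext => n; field.
Qed.

End piecewise_gradient.

(** * Vertex quadrature *)

Section discrete_functions.
Context {R : realType} {d : nat}.
Variable L : R.
Hypotheses (L0 : 0 < L) (d0 : (0 < d)%N).
Local Notation E := 'rV[R]_d.
Local Notation mu := (@lebesgue R d).
Local Notation D := (@cube R d L).
Variable M : mesh D.
Local Notation vertex := ('I_(nvtx M)).
Local Notation vtx := (@vtx R d D M).
Local Notation simp := (simplices M).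
Local Notation hullM := (hull vtx).
Local Notation Int f := (Rintegral mu D f).
Implicit Types (K : {set vertex}) (f : E -> R).
Let mD : measurable D := cube_measurable L.
Let muD : (mu D < +oo)%E := cube_finite L.

Lemma affine_grad_on K f : K \in simp -> affine_on K f ->
  exists a, forall x, hullM K x -> f x = a + dotv (grad_on K f) x.
Proof.
move=> KS [g [a fa]]; exists a => x Kx; rewrite fa//; congr (_ + dotv _ _).
have Pg : forall x y, hullM K x -> hullM K y -> f x - f y = dotv g (x - y).
  by move=> p q Kp Kq; rewrite !fa// dotvBr; ring.
rewrite /grad_on; case: xgetP => [g' _ Pg'|/(_ g)]; last by case.
apply: (grad_unique (simplex_card KS) (simplex_free KS)) => p q Kp Kq.
by rewrite -Pg// Pg'.
Qed.

Lemma V0h_affine f : V0h M f -> exists a : {set vertex} -> R,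
  forall K, K \in simp -> forall x, hullM K x -> f x = a K + dotv (grad_on K f) x.
Proof.
move=> [_ _ fA]; pose a K := xget 0 [set a | forall x, hullM K x -> f x = a + dotv (grad_on K f) x].
exists a => K KS; rewrite /a; case: xgetP => [b _ //|h].
by have [b hb] := affine_grad_on KS (fA K KS); have := h b hb.
Qed.

Lemma grad_onE K f g (a : R) : K \in simp -> (forall x, hullM K x -> f x = a + dotv g x) ->
  grad_on K f = g.
Proof.
move=> KS h; have [b hb] : exists b, forall x, hullM K x -> f x = b + dotv (grad_on K f) x.
  by apply: affine_grad_on => //; exists g, a.
apply: (grad_unique (simplex_card KS) (simplex_free KS)) => p q Kp Kq.
have h1 := h _ Kp; have h2 := h _ Kq; rewrite hb// in h1; rewrite hb// in h2.
rewrite !dotvBr.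
by rewrite (_ : _ - _ = (b + dotv (grad_on K f) p) - (b + dotv (grad_on K f) q)); [rewrite h1 h2; ring|ring].
Qed.

Lemma vtx_hullM K i : K \in simp -> i \in K -> hullM K (vtx i).
Proof. by move=> _; exact: vtx_hull. Qed.

Lemma V0h_lam f K x (c : vertex -> R) : V0h M f -> K \in simp ->
  (forall i, i \in K -> 0 <= c i) ->
  \sum_(i in K) c i = 1 -> x = \sum_(i in K) c i *: vtx i ->
  f x = \sum_(i in K) c i * f (vtx i).
Proof.
move=> /V0h_affine[a fa] KS c0 c1 cx.
have Kx : hullM K x.
  exists (fun i => if i \in K then c i else 0); split.
  - by move=> i; case: ifP => // /c0.
  - by rewrite -c1; apply: eq_bigr => i ->.
  - by rewrite cx; apply: eq_bigr => i ->.
rewrite (fa _ KS _ Kx) (affine_comb _ _ c1 cx); apply: eq_bigr => i iK.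
by rewrite -(fa _ KS)//; exact: vtx_hullM.
Qed.

Lemma V0h_ge0 f : V0h M f -> (forall i, 0 <= f (vtx i)) -> forall x, D x -> 0 <= f x.
Proof.
move=> Vf f0 x Dx; have [K KS [c [c0 c1 cx]]] := mesh_mem M Dx.
rewrite (V0h_lam Vf KS _ c1 cx); last by move=> i _; exact: c0.
by apply: sumr_ge0 => i _; rewrite mulr_ge0.
Qed.

Lemma V0h_vtx_ge0 f : V0h M f -> (forall k : 'I_(nb_nodes M), 0 <= f (node k)) ->
  forall i, 0 <= f (vtx i).
Proof.
move=> [_ f0 _] h i; have [Di|Di] := pselect (D° (vtx i)); last by rewrite f0.
have iN : i \in interior_vertices M by rewrite inE; apply/asboolP.
by have := h (enum_rank_in iN i); rewrite /node enum_rankK_in.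
Qed.

Lemma V0h_is_grad f : V0h M f -> (forall x, D x -> 0 <= f x) ->
  is_grad L f (@pgrad _ _ _ M (fun K => grad_on K f)).
Proof.
move=> Vf f0; have [a fa] := V0h_affine Vf; have [fc fo _] := Vf.
exact: (@pl_is_grad_ge0 _ _ _ L0 d0 M f a).
Qed.

Definition quad f : R := quadrature (fun (K : {set vertex}) i => f (vtx i)).

Lemma qdotE f g : qdot M f g = quad (fun x => f x * g x).
Proof. by []. Qed.

Definition psum (c : {set vertex} -> R) (x : E) : R := \sum_(K in simp) c K * \1_(hullM K) x.

Lemma psum_intg c : intg mu D (psum c).
Proof.
apply: (intg_sum mD) => K KS.
apply: (intg_le mD _ _ (intg_cst mD muD `|c K|)).
  by apply: measurable_funM => //; apply: measurable_indic; exact: mhull.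
by move=> x _; rewrite normrM ler_piMr// ger0_norm// indicE lern1 leq_b1.
Qed.

Lemma psum_Int c : Int (psum c) = \sum_(K in simp) c K * volume K.
Proof.
rewrite Int_sum//; last first.
  move=> K KS; apply: (intg_le mD _ _ (intg_cst mD muD `|c K|)).
    by apply: measurable_funM => //; apply: measurable_indic; exact: mhull.
  by move=> x _; rewrite normrM ler_piMr// ger0_norm// indicE lern1 leq_b1.
apply: eq_bigr => K KS; rewrite RintegralZl//; last first.
  apply: (intg_le mD _ _ (intg_cst mD muD 1)).
    by apply: measurable_indic; exact: mhull.
  by move=> x _; rewrite ger0_norm// indicE lern1 leq_b1.
rewrite /volume /Rintegral integral_indic//; last exact: mhull.
by rewrite (setIidl (hull_subD KS)).
Qed.

Lemma ae_psum c : {ae mu, forall x, D x -> exists K,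
  [/\ K \in simp, hullM K x & psum c x = c K]}.
Proof.
apply: filterS (ae_unique_simplex d0 M) => x u Dx.
have [K KS Kx] := mesh_mem M Dx; exists K; split=> //.
rewrite /psum (bigD1 K)//= indicE mem_set// mulr1 big1 ?addr0// => K' /andP[KS' nK].
rewrite indicE memNset ?mulr0// => Kx'; move/negP: nK; apply.
by rewrite (u _ _ KS' KS Kx' Kx).
Qed.

Lemma qdot_gradE f : qdot_grad M f f = \sum_(K in simp) volume K * dotv (grad_on K f) (grad_on K f).
Proof.
apply: eq_bigr => K KS; rewrite sumr_const (simplex_card KS) -[X in _ * X]mulr_natl.
by rewrite mulrA divfK ?pnatr_eq0.
Qed.

(** Off the null overlaps the squared gradient is constant on each simplex, so vertex quadrature is
    exact for it. *)
Lemma qdot_grad_Int f : intg mu D (fun x => \sum_i @pgrad _ _ _ M (fun K => grad_on K f) i x ^+ 2) /\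
  Int (fun x => \sum_i @pgrad _ _ _ M (fun K => grad_on K f) i x ^+ 2) = qdot_grad M f f.
Proof.
have ae : {ae mu, forall x, D x -> psum (fun K => dotv (grad_on K f) (grad_on K f)) x =
    \sum_i @pgrad _ _ _ M (fun K => grad_on K f) i x ^+ 2}.
  apply: filterS2 (ae_psum (fun K => dotv (grad_on K f) (grad_on K f))) (ae_unique_simplex d0 M).
  move=> x hx u Dx; have [K [KS Kx ->]] := hx Dx.
  rewrite dotv_sum_sq; apply: eq_bigr => i _; congr (_ ^+ 2).
  rewrite /pgrad (bigD1 K)//= indicE mem_set// mulr1 big1 ?addr0// => K' /andP[KS' nK].
  rewrite indicE memNset ?mulr0// => Kx'; move/negP: nK; apply.
  by rewrite (u _ _ KS' KS Kx' Kx).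
have me : measurable_fun D (fun x => \sum_i @pgrad _ _ _ M (fun K => grad_on K f) i x ^+ 2).
  apply: (@intg_meas _ _ _ mu); apply: (intg_sum mD) => i _.
  have [B _ h] := @pgrad_bound _ _ _ M (fun K => grad_on K f) i.
  by have [] := sq_intg_bounded mD muD (@pgrad_meas _ _ _ M (fun K => grad_on K f) i) (fun x _ => h x).
split; first exact: intg_ae_eq me ae (psum_intg _).
rewrite qdot_gradE -(Int_ae_eq mD (intg_meas (psum_intg _)) me ae) psum_Int.
by apply: eq_bigr => K _; rewrite mulrC.
Qed.

(** It suffices to compare the value at any point of a simplex with the value at any of its
    vertices: averaging over the [d + 1] vertices and integrating produces the quadrature, with the
    errors [c K] weighted by volume. *)
Lemma Int_le_quad f (G : {set vertex} -> vertex -> R) (c : {set vertex} -> R) : intg mu D f ->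
  (forall K x i, K \in simp -> hullM K x -> i \in K -> f x <= G K i + c K) ->
  Int f <= quadrature G + \sum_(K in simp) c K * volume K.
Proof.
move=> fi h; rewrite (mesh_Int_sum d0 M)// -big_split/=; apply: ler_sum => K KS.
have N0 : 0 < d.+1%:R :> R by rewrite ltr0n.
rewrite [leRHS](_ : _ = (d.+1%:R^-1 * \sum_(i in K) (G K i + c K)) * volume K); last first.
  rewrite big_split/= sumr_const (simplex_card KS) -[c K *+ _]mulr_natl.
  by rewrite mulrDr mulKf ?gt_eqF//; ring.
rewrite -Int_cst_hull//; apply: Int_le => //.
- exact: mhull.
- exact: intg_hull.
- by apply: intg_cst; [exact: mhull|exact: hull_finite].
move=> x Kx; rewrite mulrC ler_pdivlMr// mulr_natr -(simplex_card KS) -sumr_const.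
by apply: ler_sum => i iK; exact: h.
Qed.

Lemma quad_le_Int f (G : {set vertex} -> vertex -> R) (c : {set vertex} -> R) : intg mu D f ->
  (forall K x i, K \in simp -> hullM K x -> i \in K -> G K i <= f x + c K) ->
  quadrature G <= Int f + \sum_(K in simp) c K * volume K.
Proof.
move=> fi h.
have := @Int_le_quad (fun x => - f x) (fun K i => - G K i) c (intgN fi).
rewrite IntN//; rewrite (_ : quadrature (fun K i => - G K i) = - quadrature G); last first.
  rewrite /quadrature -sumrN; apply: eq_bigr => K _.
  by rewrite -mulrN sumrN.
move=> H; have {}H : - Int f <= - quadrature G + \sum_(K in simp) c K * volume K.
  by apply: H => K x i KS Kx iK; have := h K x i KS Kx iK; lra.
by move: H; set A := Int f; set B := quadrature G; set C := \sum_(_ in _) _; lra.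
Qed.

Lemma sum_volume : \sum_(K in simp) volume K = Int (fun=> 1).
Proof.
rewrite (mesh_Int_sum d0 M); last exact: intg_cst.
by apply: eq_bigr => K KS; rewrite Int_cst_hull// mul1r.
Qed.

End discrete_functions.

Section uniform_continuity.
Context {R : realType} {d : nat}.
Local Notation E := 'rV[R]_d.

(** The condition [P r x] spreads from each point to its neighbours for all small [r], and
    compactness of [D] yields a common [r]. *)
Lemma within_unif_continuous (D : set E) (f : E -> R) (eta : R) : compact D ->
  {within D, continuous f} -> 0 < eta ->
  exists2 r : R, 0 < r & forall x y, D x -> D y ->
    (forall i, `|x ord0 i - y ord0 i| < r) -> `|f x - f y| < eta.
Proof.
move=> cD /subspace_continuousP cf eta0.
pose P (r : R) (x : E) := forall y, D y ->
  (forall i, `|x ord0 i - y ord0 i| < r) -> `|f x - f y| < eta.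
suff : \forall r \near (0 : R)^'+, D `<=` P r.
  move=> H; have : \forall r \near (0 : R)^'+, 0 < r /\ D `<=` P r.
    by apply: filterS2 (nbhs_right_gt 0) H.
  by move=> /filter_ex[r [r0 h]]; exists r => // x y /h; exact.
suff : \forall r \near (0 : R)^'+, D `<=` [set x | D x -> P r x].
  by apply: filterS => r h x Dx; exact: h.
apply: (compact_near_coveringP D).1 => //.
move=> x Dx.
have e20 : 0 < eta / 2 by rewrite divr_gt0.
have : \forall y \near within D (nbhs x), `|f x - f y| < eta / 2.
  by have := cf x Dx => /cvgrPdist_lt /(_ _ e20).
move=> /nbhs_rVP[e e0 h].
have e2 : 0 < e / 2 by rewrite divr_gt0.
exists ([set y : E | forall i, `|x ord0 i - y ord0 i| < e / 2], [set r : R | r < e / 2]).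
  split=> /=; last exact: nbhs_right_lt.
  by apply/nbhs_rVP; exists (e / 2).
move=> [y r] /= [yx re] Dy z Dz yz.
have h1 : `|f x - f y| < eta / 2.
  by apply: h => // i; apply: lt_le_trans (yx i) _; rewrite [leRHS]splitr lerDl ltW.
have h2 : `|f x - f z| < eta / 2.
  apply: h => // i; rewrite -(subrK (y ord0 i) (x ord0 i)) -addrA.
  apply: le_lt_trans (ler_normD _ _) _; rewrite [ltRHS]splitr ltrD//.
  by apply: lt_trans (yz i) re.
rewrite -(subrK (f x) (f y)) -addrA; apply: le_lt_trans (ler_normD _ _) _.
by rewrite [ltRHS]splitr ltrD// distrC.
Qed.

(** For [s = (a - b)^2] the two sides differ by the square of [delta b - (a - b)] divided by
    [delta]. The main term keeps a factor near 1, the error a large but fixed one. *)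
Lemma sq_young (a b s delta : R) : 0 < delta -> (a - b) ^+ 2 <= s ->
  a ^+ 2 <= (1 + delta) * b ^+ 2 + (1 + delta^-1) * s.
Proof.
move=> d0 h; have dn : delta != 0 by rewrite gt_eqF.
have h1 : 0 <= delta^-1 by rewrite invr_ge0 ltW.
apply: (@le_trans _ _ ((1 + delta) * b ^+ 2 + (1 + delta^-1) * (a - b) ^+ 2)); last first.
  by rewrite lerD2l ler_wpM2l// addr_ge0.
rewrite -subr_ge0 (_ : _ - _ = delta^-1 * (delta * b - (a - b)) ^+ 2).
  by rewrite mulr_ge0// sqr_ge0.
by field.
Qed.

(** [sq_young] applied once more, to the sum in the hypothesis: squaring gives two of the three
    powers, the inequality itself the third. *)
Lemma sq_young2 (p q s delta : R) : 0 < delta -> 0 <= p -> 0 <= q -> 0 <= s ->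
  p <= (1 + delta) * q + (1 + delta^-1) * s ->
  p ^+ 2 <= (1 + delta) ^+ 3 * q ^+ 2 + (1 + delta^-1) ^+ 3 * s ^+ 2.
Proof.
move=> d0 p0 q0 s0 h; have dn : delta != 0 by rewrite gt_eqF.
have h1 : 0 <= delta^-1 by rewrite invr_ge0 ltW.
have h2 : 0 <= (1 + delta^-1) * s by rewrite mulr_ge0// addr_ge0.
have := @sq_young ((1 + delta) * q + (1 + delta^-1) * s) ((1 + delta) * q)
  (((1 + delta^-1) * s) ^+ 2) delta d0 _.
rewrite addrAC subrr add0r lexx => /(_ isT).
move=> H; have : p ^+ 2 <= ((1 + delta) * q + (1 + delta^-1) * s) ^+ 2.
  by rewrite lerXn2r ?nnegrE// (le_trans p0).
move=> /le_trans/(_ H); congr (_ <= _).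
by ring.
Qed.

End uniform_continuity.

(** * Consistency of the quadrature for finite element functions *)

Section consistency.
Context {R : realType} {d : nat}.
Variable L : R.
Hypotheses (L0 : 0 < L) (d0 : (0 < d)%N) (d3 : (d <= 3)%N).
Local Notation E := 'rV[R]_d.
Local Notation mu := (@lebesgue R d).
Local Notation D := (@cube R d L).
Local Notation Int f := (Rintegral mu D f).
Let mD : measurable D := cube_measurable L.
Let muD : (mu D < +oo)%E := cube_finite L.
Variable sigma : R.
Hypothesis sigma0 : 0 < sigma.

Section single_mesh.
Variable M : mesh D.
Hypothesis reg : shape_regular M sigma.
Local Notation vertex := ('I_(nvtx M)).
Local Notation vtx := (@vtx R d D M).
Local Notation simp := (simplices M).
Local Notation hullM := (hull vtx).
Variable f : E -> R.
Hypothesis Vf : V0h M f.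

(** A bound for the squared oscillation of [f] within the single simplex [K]; nothing is compared
    across faces. *)
Definition jump (K : {set vertex}) : R :=
  dotv (grad_on K f) (grad_on K f) * diam (hullM K) ^+ 2.

Lemma jump_ge0 K : 0 <= jump K.
Proof. by rewrite mulr_ge0 ?dotvv_ge0 ?sqr_ge0. Qed.

Lemma sq_diff_jump K x i : K \in simp -> hullM K x -> i \in K ->
  (f x - f (vtx i)) ^+ 2 <= jump K.
Proof.
move=> KS Kx iK; have [a fa] := V0h_affine Vf; have Ki := vtx_hullM KS iK.
rewrite (fa _ KS _ Kx) (fa _ KS _ Ki) opprD addrACA subrr add0r -dotvBr /jump.
apply: le_trans (dotv_sq_le _ _) _; rewrite ler_wpM2l ?dotvv_ge0//.
rewrite -normv_sq lerXn2r ?nnegrE ?normv_ge0 ?(diam_ge0 L0 KS)//.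
exact: (diam_dist L0 KS Kx Ki).
Qed.

Lemma sum_jump : \sum_(K in simp) jump K * volume K <=
  mesh_size M ^+ 2 * qdot_grad M f f.
Proof.
rewrite qdot_gradE mulr_sumr; apply: ler_sum => K KS; rewrite /jump.
rewrite (_ : _ * _ * _ = diam (hullM K) ^+ 2 * (volume K * dotv (grad_on K f) (grad_on K f))).
  by apply: ler_wpM2r; rewrite ?mulr_ge0 ?volume_ge0 ?dotvv_ge0// lerXn2r ?nnegrE ?(diam_ge0 L0 KS) ?mesh_size_ge0 ?diam_le_size.
by ring.
Qed.

Lemma qdot_grad_ge0 : 0 <= qdot_grad M f f.
Proof. by rewrite qdot_gradE; apply: sumr_ge0 => K _; rewrite mulr_ge0 ?volume_ge0 ?dotvv_ge0. Qed.

(* The dimension enters here: [diam K ^ (4 - d)] has to tend to zero. *)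
Lemma sum_jump_sq : mesh_size M <= 1 -> \sum_(K in simp) jump K ^+ 2 * volume K <=
  (2 * sigma * d%:R) ^+ d * mesh_size M * qdot_grad M f f ^+ 2.
Proof.
move=> h1; set h := mesh_size M; set C := _ ^+ d.
have C0 : 0 <= C by rewrite exprn_ge0// !mulr_ge0// ltW.
set A := qdot_grad M f f.
have A0 : 0 <= A := qdot_grad_ge0.
(* Of the two factors of the energy, one is summed over the simplices and the other is bounded on
   each simplex by the total. *)
have gA K : K \in simp -> volume K * dotv (grad_on K f) (grad_on K f) <= A.
  move=> KS; rewrite /A qdot_gradE (bigD1 K)//= lerDl.
  by apply: sumr_ge0 => K' _; rewrite mulr_ge0 ?volume_ge0 ?dotvv_ge0.
rewrite expr2 mulrA {2}/A qdot_gradE mulr_sumr; apply: ler_sum => K KS.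
set G := dotv _ _; set v := volume K; set D' := diam (hullM K).
have D0 : 0 <= D' := diam_ge0 L0 KS.
have Dh : D' <= h by exact: diam_le_size.
have v0 : 0 <= v := volume_ge0 K.
have G0 : 0 <= G := dotvv_ge0 _.
have D4 : D' ^+ 4 <= C * v * h.
  have DC : D' ^+ d <= C * v by exact: (diam_volume L0 d0 sigma0 reg KS).
  have DD : D' ^+ (4 - d) <= h.
    apply: (le_trans _ Dh); rewrite -[leRHS]expr1; apply: ler_wiXn2l => //; last by rewrite subn_gt0 ltnS.
    exact: le_trans Dh h1.
  rewrite -(subnKC (leq_trans d3 (leqnSn 3))) exprD; apply: ler_pM => //.
  - exact: exprn_ge0.
  - exact: exprn_ge0.
rewrite /jump -/G -/D' (_ : (G * D' ^+ 2) ^+ 2 * v = (v * G) * (G * D' ^+ 4)); last by ring.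
rewrite mulrC; apply: ler_wpM2r; first exact: mulr_ge0.
apply: le_trans (ler_wpM2l G0 D4) _.
rewrite (_ : G * (C * v * h) = C * h * (v * G)); last by ring.
by apply: ler_wpM2l; [rewrite mulr_ge0 ?mesh_size_ge0|exact: gA].
Qed.

Lemma sum_jump_le (delta A : R) : 0 < delta -> qdot_grad M f f <= A ->
  mesh_size M <= 1 ->
  \sum_(K in simp) ((1 + delta^-1) * jump K) * volume K <= (1 + delta^-1) * A * mesh_size M.
Proof.
move=> delta0 fA h1; have dV : 0 <= delta^-1 by rewrite invr_ge0 ltW.
under eq_bigr do rewrite -mulrA.
rewrite -mulr_sumr -mulrA ler_wpM2l ?addr_ge0//.
apply: le_trans sum_jump _; rewrite mulrC ler_pM ?qdot_grad_ge0 ?sqr_ge0//.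
by rewrite expr2 ler_piMl// mesh_size_ge0.
Qed.

Lemma V0h_sq_intg : sq_intg mu D f.
Proof.
have [cf _ _] := Vf; have [B B0 fB] := within_bounded (@cube_compact R d L) cf.
exact: (sq_intg_bounded mD muD (within_continuous_measurable_rV mD cf) fB).
Qed.

Lemma V0h_X4_intg : intg mu D (fun x => f x ^+ 4).
Proof.
have [cf _ _] := Vf; have [B B0 fB] := within_bounded (@cube_compact R d L) cf.
have mf := within_continuous_measurable_rV mD cf.
apply: (intg_bounded (M := B ^+ 4) mD muD); first exact: measurable_funX.
by move=> x Dx; rewrite normrX lerXn2r ?nnegrE// fB.
Qed.

Lemma Int_sq_le_quad (delta A : R) : 0 < delta -> qdot_grad M f f <= A ->
  mesh_size M <= 1 ->
  Int (fun x => f x ^+ 2) <= (1 + delta) * quad M (fun x => f x ^+ 2) +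
    (1 + delta^-1) * A * mesh_size M.
Proof.
move=> delta0 fA h1; have [_ i2] := V0h_sq_intg.
apply: le_trans (lerD (lexx _) (sum_jump_le delta0 fA h1)).
rewrite (_ : (1 + delta) * _ = quadrature (fun (K : {set vertex}) i => (1 + delta) * f (vtx i) ^+ 2)).
  by apply: Int_le_quad => // K x i KS Kx iK; apply: sq_young => //; exact: sq_diff_jump.
rewrite /quad /quadrature mulr_sumr; apply: eq_bigr => K _.
by rewrite -mulr_sumr; ring.
Qed.

Lemma quad_le_Int_sq (delta A : R) : 0 < delta -> qdot_grad M f f <= A ->
  mesh_size M <= 1 ->
  quad M (fun x => f x ^+ 2) <= (1 + delta) * Int (fun x => f x ^+ 2) +
    (1 + delta^-1) * A * mesh_size M.
Proof.
move=> delta0 fA h1; have [_ i2] := V0h_sq_intg.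
apply: le_trans (lerD (lexx _) (sum_jump_le delta0 fA h1)).
rewrite -RintegralZl//; apply: quad_le_Int => //; first exact: intgZ.
move=> K x i KS Kx iK; apply: sq_young => //.
by rewrite -sqrrN opprB; exact: sq_diff_jump.
Qed.

Lemma sum_jump_sq_le (delta A : R) : 0 < delta -> qdot_grad M f f <= A ->
  mesh_size M <= 1 ->
  \sum_(K in simp) ((1 + delta^-1) ^+ 3 * jump K ^+ 2) * volume K <=
    (1 + delta^-1) ^+ 3 * ((2 * sigma * d%:R) ^+ d * A ^+ 2) * mesh_size M.
Proof.
move=> delta0 fA h1; have dV : 0 <= delta^-1 by rewrite invr_ge0 ltW.
under eq_bigr do rewrite -mulrA.
rewrite -mulr_sumr -mulrA ler_wpM2l ?exprn_ge0 ?addr_ge0//.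
apply: le_trans (sum_jump_sq h1) _.
have s0 : 0 <= (2 * sigma * d%:R) ^+ d by rewrite exprn_ge0// !mulr_ge0// ltW.
rewrite mulrAC ler_wpM2r ?mesh_size_ge0// ler_wpM2l//.
by rewrite lerXn2r ?nnegrE ?(le_trans qdot_grad_ge0 fA) ?qdot_grad_ge0.
Qed.

Lemma X4E (a : R) : a ^+ 4 = (a ^+ 2) ^+ 2.
Proof. by rewrite -exprM. Qed.

Lemma Int_X4_le_quad (delta A : R) : 0 < delta -> qdot_grad M f f <= A ->
  mesh_size M <= 1 ->
  Int (fun x => f x ^+ 4) <= (1 + delta) ^+ 3 * quad M (fun x => f x ^+ 4) +
    (1 + delta^-1) ^+ 3 * ((2 * sigma * d%:R) ^+ d * A ^+ 2) * mesh_size M.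
Proof.
move=> delta0 fA h1; have i4 := V0h_X4_intg.
apply: le_trans (lerD (lexx _) (sum_jump_sq_le delta0 fA h1)).
rewrite (_ : (1 + delta) ^+ 3 * _ =
    quadrature (fun (K : {set vertex}) i => (1 + delta) ^+ 3 * f (vtx i) ^+ 4)).
  apply: Int_le_quad => // K x i KS Kx iK; rewrite !X4E.
  apply: sq_young2 => //; rewrite ?sqr_ge0 ?jump_ge0//.
  by apply: sq_young => //; exact: sq_diff_jump.
rewrite /quad /quadrature mulr_sumr; apply: eq_bigr => K _.
by rewrite -mulr_sumr; ring.
Qed.

Lemma quad_le_Int_X4 (delta A : R) : 0 < delta -> qdot_grad M f f <= A ->
  mesh_size M <= 1 ->
  quad M (fun x => f x ^+ 4) <= (1 + delta) ^+ 3 * Int (fun x => f x ^+ 4) +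
    (1 + delta^-1) ^+ 3 * ((2 * sigma * d%:R) ^+ d * A ^+ 2) * mesh_size M.
Proof.
move=> delta0 fA h1; have i4 := V0h_X4_intg.
apply: le_trans (lerD (lexx _) (sum_jump_sq_le delta0 fA h1)).
rewrite -RintegralZl//; apply: quad_le_Int => //; first exact: intgZ.
move=> K x i KS Kx iK; rewrite !X4E.
apply: sq_young2 => //; rewrite ?sqr_ge0 ?jump_ge0//.
by apply: sq_young => //; rewrite -sqrrN opprB; exact: sq_diff_jump.
Qed.

(** Two errors arise: the oscillation of [V], at most [eta], multiplies vertex values of [f], and
    the oscillation of [f] is multiplied by the upper bound [B] of [V]. *)
Lemma Int_V_le_quad (V : E -> R) (B eta delta A : R) : {within D, continuous V} ->
  (forall x, D x -> 0 <= V x <= B) -> 0 <= eta ->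
  (forall K x i, K \in simp -> hullM K x -> i \in K -> `|V x - V (vtx i)| <= eta) ->
  0 < delta -> qdot_grad M f f <= A -> mesh_size M <= 1 ->
  Int (fun x => V x * f x ^+ 2) <=
    (1 + delta) * quad M (fun x => V x * f x ^+ 2) +
    (1 + delta) * eta * quad M (fun x => f x ^+ 2) + B * ((1 + delta^-1) * A * mesh_size M).
Proof.
move=> cV VB eta0 Veta delta0 fA h1; have [mf i2] := V0h_sq_intg.
have dV : 0 <= delta^-1 by rewrite invr_ge0 ltW.
have B0 : 0 <= B.
  have [x Dx] : exists x, D x by exists 0 => i; rewrite mxE oppr_le0 (ltW L0).
  by have /andP[a b] := VB x Dx; exact: le_trans a b.
apply: le_trans (lerD (lexx _) (ler_wpM2l B0 (sum_jump_le delta0 fA h1))).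
have -> : B * (\sum_(K in simp) (1 + delta^-1) * jump K * volume K) =
    \sum_(K in simp) (B * ((1 + delta^-1) * jump K)) * volume K.
  by rewrite mulr_sumr; apply: eq_bigr => K _; rewrite mulrA.
rewrite (_ : (1 + delta) * _ + _ = quadrature (fun (K : {set vertex}) i =>
   (1 + delta) * (V (vtx i) * f (vtx i) ^+ 2) + (1 + delta) * eta * f (vtx i) ^+ 2)).
  apply: Int_le_quad => //.
    have mV := within_continuous_measurable_rV mD cV.
    apply: (intg_le mD _ _ (intgZ mD B i2)).
      by apply: measurable_funM => //; exact: measurable_funX.
    move=> x Dx; rewrite normrM (ger0_norm (sqr_ge0 _)) ler_wpM2r ?sqr_ge0//.
    by have /andP[a b] := VB x Dx; rewrite ger0_norm.
  move=> K x i KS Kx iK; have Dx := hull_subD KS Kx.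
  have /andP[V0 V1] := VB x Dx.
  have h2 := sq_young delta0 (sq_diff_jump KS Kx iK).
  apply: le_trans (ler_wpM2l V0 h2) _; rewrite mulrDr; apply: lerD; last first.
    have J0 : 0 <= (1 + delta^-1) * jump K by rewrite mulr_ge0 ?jump_ge0// addr_ge0.
    exact: ler_wpM2r.
  rewrite [leRHS](_ : _ = (V (vtx i) + eta) * ((1 + delta) * f (vtx i) ^+ 2)); last by ring.
  apply: ler_wpM2r; first by rewrite mulr_ge0 ?sqr_ge0// addr_ge0// ltW.
  have := le_trans (ler_norm _) (Veta K x i KS Kx iK); lra.
rewrite /quad /quadrature !mulr_sumr -big_split/=; apply: eq_bigr => K _.
by rewrite big_split/= -!mulr_sumr; ring.
Qed.

End single_mesh.
End consistency.

(** * Nodal interpolation *)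

Section nodal_interpolation.
Context {R : realType} {d : nat}.
Variable L : R.
Hypotheses (L0 : 0 < L) (d0 : (0 < d)%N).
Local Notation E := 'rV[R]_d.
Local Notation mu := (@lebesgue R d).
Local Notation D := (@cube R d L).
Variable M : mesh D.
Local Notation vertex := ('I_(nvtx M)).
Local Notation vtx := (@vtx R d D M).
Local Notation simp := (simplices M).
Local Notation hullM := (hull vtx).
Local Notation Int f := (Rintegral mu D f).
Implicit Types (K : {set vertex}) (f : E -> R).

Lemma nodal_pieces (w : vertex -> R) : exists (a : {set vertex} -> R) (g : {set vertex} -> E),
  forall K, K \in simp -> forall i, i \in K -> a K + dotv (g K) (vtx i) = w i.
Proof.
have h K : exists p : R * E, K \in simp -> forall i, i \in K -> p.1 + dotv p.2 (vtx i) = w i.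
  have [KS|] := boolP (K \in simp); last by exists (0, 0).
  have [b [l [_ _ bl]]] := bary_exists (simplex_card KS) (simplex_free KS).
  exists (\sum_(j in K) w j * b j, \sum_(j in K) w j *: l j) => _ i iK /=.
  rewrite dotvC dotv_sumr -big_split/= (bigD1 i)//= big1 => [|j /andP[jK ji]].
    by rewrite dotvZr dotvC -mulrDr bl// eqxx mulr1 addr0.
  by rewrite dotvZr dotvC -mulrDr bl// (negbTE ji) mulr0.
have [p hp] := choice h.
by exists (fun K => (p K).1), (fun K => (p K).2).
Qed.

(** A convex combination with positive weight at an interior point of the cube is interior: in each
    coordinate inequality one summand is strict. *)
Lemma face_boundary K x (c : vertex -> R) i : D x -> ~ D° x ->
  (forall i, 0 <= c i) -> \sum_(j in K) c j = 1 -> x = \sum_(j in K) c j *: vtx j ->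
  i \in K -> c i = 0 \/ ~ D° (vtx i).
Proof.
move=> Dx nDx c0 c1 cx iK.
have [z|cn] := eqVneq (c i) 0; [by left|right; move=> Di; apply: nDx].
have ci : 0 < c i by rewrite lt_neqAle eq_sym cn c0.
rewrite cube_interior in Di *; move=> k /=.
have Dv j : - L <= vtx j ord0 k <= L by exact: (vtx_D (M := M) j).
have xk : x ord0 k = \sum_(j in K) c j * vtx j ord0 k.
  by rewrite cx summxE; apply: eq_bigr => j _; rewrite mxE.
have /andP[i1 i2] := Di k.
apply/andP; split.
  rewrite -subr_gt0 opprK xk -[X in _ + X]mul1r -c1 mulr_suml -big_split/=.
  rewrite (bigD1 i)//= ltr_pwDl//; first by rewrite -mulrDr mulr_gt0// -ltrBlDr sub0r.
  apply: sumr_ge0 => j _; rewrite -mulrDr mulr_ge0// -lerBlDr sub0r.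
  by have /andP[] := Dv j.
rewrite -subr_gt0 xk -[X in X - _]mul1r -c1 mulr_suml -sumrB.
rewrite (bigD1 i)//= ltr_pwDl//; first by rewrite -mulrBr mulr_gt0// subr_gt0.
apply: sumr_ge0 => j _; rewrite -mulrBr mulr_ge0// subr_ge0.
by have /andP[] := Dv j.
Qed.

Lemma within_bigcup_continuous (f : E -> R) (s : seq {set vertex}) :
  (forall K, K \in s -> K \in simp /\ {within hullM K, continuous f}) ->
  closed (\bigcup_(K in [set` s]) hullM K) /\
  {within \bigcup_(K in [set` s]) hullM K, continuous f}.
Proof.
elim: s => [|K s IH] h.
  rewrite bigcup_seq big_nil; split; first exact: closed0.
  by apply/subspace_continuousP => x [].
rewrite bigcup_seq big_cons -bigcup_seq.
have [KS cK] := h K (mem_head _ _).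
have [clS cS] : closed (\bigcup_(K in [set` s]) hullM K) /\
  {within \bigcup_(K in [set` s]) hullM K, continuous f}.
  by apply: IH => K' K's; apply: h; rewrite inE K's orbT.
have clK : closed (hullM K) := hull_closed (simplex_card KS) (simplex_free KS).
by split; [exact: closedU|exact: withinU_continuous].
Qed.

(** Any simplex containing the point may be used: two of them meet in the hull of their common
    vertices, where both affine functions are determined by the same values. The zero boundary
    values come from [face_boundary]. *)
Lemma nodal_exists (w : vertex -> R) : (forall i, ~ D° (vtx i) -> w i = 0) ->
  exists2 f, V0h M f & forall i, f (vtx i) = w i.
Proof.
move=> w0; have [a [g ag]] := nodal_pieces w.
pose f x : R := if [pick K | (K \in simp) && `[< hullM K x >]] is Some K
  then a K + dotv (g K) x else 0.
have fK K x : K \in simp -> hullM K x -> f x = a K + dotv (g K) x.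
  move=> KS Kx; rewrite /f; case: pickP => [K' /andP[KS' /asboolP Kx']|/(_ K)]; last first.
    by rewrite KS (asboolT Kx).
  have : (hullM K `&` hullM K') x by [].
  rewrite (mesh_conforming KS KS') => -[c [_ c1 cx]].
  rewrite !(affine_comb _ _ c1 cx); apply: eq_bigr => i; rewrite inE => /andP[iK iK'].
  by rewrite !ag.
exists f; last first.
  move=> i; have [K KS iK] := mesh_vtx_used i.
  by rewrite (fK K) ?ag//; exact: vtx_hullM.
split.
- have [|_] := @within_bigcup_continuous f (enum simp).
    move=> K; rewrite mem_enum => KS; split=> //.
    apply: (@subspace_eq_continuous _ _ _ (fun x => a K + dotv (g K) x)).
      by move=> x /set_mem Kx; rewrite /from_subspace (fK K).
    by apply: continuous_subspaceT => x; exact: continuous_affine.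
  suff -> : \bigcup_(K in [set` enum simp]) hullM K = D by [].
  rewrite -[RHS](mesh_cover M); apply: eq_bigcupl.
  by split=> K /=; rewrite mem_enum.
- move=> x nDx; have [Dx|Dx] := pselect (D x); last first.
    rewrite /f; case: pickP => // K /andP[KS /asboolP Kx].
    by case: Dx; exact: (hull_subD KS).
  have [K KS Kx] := mesh_mem M Dx; have [c [c0 c1 cx]] := Kx.
  rewrite (fK K)// (affine_comb _ _ c1 cx) big1// => i iK; rewrite ag//.
  have [->|/w0 ->] := face_boundary Dx nDx c0 c1 cx iK; last by rewrite mulr0.
  by rewrite mul0r.
- by move=> K KS; exists (g K), (a K) => x; exact: fK.
Qed.

Lemma node_vtx i : D° (vtx i) -> exists k : 'I_(nb_nodes M), enum_val k = i.
Proof.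
move=> Di; have iN : i \in interior_vertices M by rewrite inE; apply/asboolP.
by exists (enum_rank_in iN i); rewrite enum_rankK_in.
Qed.

Lemma nodal_basisP (k : 'I_(nb_nodes M)) : V0h M (nodal_basis k) /\
  forall i, nodal_basis k (vtx i) = (i == enum_val k)%:R.
Proof.
have Dk : D° (vtx (enum_val k)).
  by have := enum_valP k; rewrite inE => /asboolP.
have z i : ~ D° (vtx i) -> (i == enum_val k)%:R = 0 :> R.
  by move=> Di; case: eqP => [e|_]; [exfalso; apply: Di; rewrite e; exact: Dk|exact: erefl].
have [f Vf fv] := nodal_exists z.
have : [set f | V0h M f /\ forall l : 'I_(nb_nodes M), f (node l) = (l == k)%:R] f.
  by split=> // l; rewrite /node fv (inj_eq enum_val_inj).
rewrite /nodal_basis; case: xgetP => [h -> [Vh hv] _|/(_ f)//].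
split=> // i; have [Di|Di] := pselect (D° (vtx i)).
  by have [l <-] := node_vtx Di; rewrite -/(node l) hv (inj_eq enum_val_inj).
have [_ h0 _] := Vh; rewrite (z i Di); exact: h0.
Qed.

Lemma grad_on_nodal f K : V0h M f -> K \in simp ->
  grad_on K f = \sum_(k : 'I_(nb_nodes M)) f (node k) *: grad_on K (nodal_basis k).
Proof.
move=> Vf KS.
have h (k : 'I_(nb_nodes M)) : exists b : R, forall x, hullM K x ->
    nodal_basis k x = b + dotv (grad_on K (nodal_basis k)) x.
  by have [[_ _ h] _] := nodal_basisP k; exact: (affine_grad_on KS (h K KS)).
have [b hb] := choice h => {h}.
apply: (@grad_onE _ _ _ M K f _ (\sum_(k : 'I_(nb_nodes M)) f (node k) * b k) KS) => x [c [c0 c1 cx]].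
rewrite (V0h_lam Vf KS _ c1 cx); last by move=> i _; exact: c0.
rewrite (affine_comb _ _ c1 cx); apply: eq_bigr => i iK; congr (_ * _).
rewrite dotvC dotv_sumr -big_split/=.
have h k : f (node k) * b k + dotv (vtx i) (f (node k) *: grad_on K (nodal_basis k)) =
    f (node k) * (i == enum_val k)%:R.
  rewrite dotvZr dotvC -mulrDr -hb; first by rewrite (nodal_basisP k).2.
  exact: vtx_hullM.
rewrite (eq_bigr _ (fun k _ => h k)).
have [Di|Di] := pselect (D° (vtx i)); last first.
  have [_ -> // _] := Vf; rewrite big1// => k _; case: eqP => [e|_]; last by rewrite mulr0.
  by case: Di; rewrite e; have := enum_valP k; rewrite inE => /asboolP.
have [l li] := node_vtx Di; rewrite (bigD1 l)//= big1 => [|k kl].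
  by rewrite li eqxx mulr1 addr0 /node li.
by rewrite -li (inj_eq enum_val_inj) eq_sym (negbTE kl) mulr0.
Qed.

Lemma volume_gt0 K : K \in simp -> 0 < volume K.
Proof.
move=> KS; have [c [r [r0 h]]] := hull_ball (simplex_card KS) (simplex_free KS).
apply: lt_le_trans (ball_volume d0 KS (ltW r0) h).
by rewrite exprn_gt0// divr_gt0 ?mulr_gt0 ?ltr0n.
Qed.

Lemma weight_gt0 (k : 'I_(nb_nodes M)) : 0 < weight k.
Proof.
have [K KS kK] := mesh_vtx_used (enum_val k); rewrite /weight (bigD1 K) ?KS//=.
rewrite ltr_pwDl ?divr_gt0 ?volume_gt0//.
by apply: sumr_ge0 => K' _; rewrite divr_ge0 ?volume_ge0.
Qed.

(** The sums over simplices and over vertices are exchanged; boundary vertices contribute nothing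
    because [G] vanishes there. *)
Lemma sum_weight (G : E -> R) : (forall i, ~ D° (vtx i) -> G (vtx i) = 0) ->
  \sum_(k : 'I_(nb_nodes M)) weight k * G (node k) = quad M G.
Proof.
move=> G0; rewrite /weight; under eq_bigr do rewrite mulr_suml.
rewrite (exchange_big_dep (mem simp))/=; last by move=> k K _ /andP[].
apply: eq_bigr => K KS; rewrite -mulr_sumr; congr (_ * _).
rewrite (bigID (fun i => i \in interior_vertices M))/= [X in _ = _ + X]big1 ?addr0; last first.
  by move=> i /andP[_]; rewrite inE => /asboolPn; exact: G0.
have := @big_enum_val_cond _ _ 0 _ (mem (interior_vertices M))
  (fun i => i \in K) (fun i => G (vtx i)).
rewrite KS/= => H.
rewrite (eq_bigl (fun i => (i \in interior_vertices M) && (i \in K)))//; last first.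
  by move=> i; rewrite andbC.
Qed.

Variables (beta : R) (V : E -> R).

Lemma quad_eq f g : (forall i, f (vtx i) = g (vtx i)) -> quad M f = quad M g.
Proof. by move=> h; apply: eq_bigr => K _; congr (_ * _); apply: eq_bigr => i _. Qed.

Lemma qdot_gradC f g : qdot_grad M f g = \sum_(K in simp) volume K * dotv (grad_on K f) (grad_on K g).
Proof.
apply: eq_bigr => K KS; rewrite sumr_const (simplex_card KS) -[X in _ * X]mulr_natl.
by rewrite mulrA divfK ?pnatr_eq0.
Qed.

Lemma stiff_energy f : V0h M f ->
  \sum_k (nodal_values M f) k ord0 * (stiff_mx M *m nodal_values M f) k ord0 = qdot_grad M f f.
Proof.
move=> Vf; rewrite qdot_gradC.
transitivity (\sum_(k : 'I_(nb_nodes M)) \sum_(l : 'I_(nb_nodes M)) \sum_(K in simp)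
   f (node k) * (volume K * dotv (grad_on K (nodal_basis k)) (grad_on K (nodal_basis l)) * f (node l))).
  apply: eq_bigr => k _; rewrite !mxE mulr_sumr; apply: eq_bigr => l _.
  by rewrite !mxE qdot_gradC mulr_suml mulr_sumr.
under eq_bigr do rewrite exchange_big/=.
rewrite exchange_big/=; apply: eq_bigr => K KS.
rewrite (grad_on_nodal Vf KS) dotv_sumr mulr_sumr exchange_big/=; apply: eq_bigr => l _.
rewrite dotvZr dotvC dotv_sumr !mulr_sumr; apply: eq_bigr => k _.
by rewrite dotvZr (dotvC (grad_on K (nodal_basis l))); ring.
Qed.

(** The discrete equation, multiplied by the mass matrix, is tested with its own solution. *)
Lemma eigenvalue_h f (lambda : R) : V0h M f -> eigenpair_h M beta V f lambda ->
  qdot_grad M f f + quad M (fun x => V x * f x ^+ 2) + beta * quad M (fun x => f x ^+ 4) =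
  lambda * quad M (fun x => f x ^+ 2).
Proof.
move=> Vf; rewrite /eigenpair_h; set u := nodal_values M f => eig.
have mU : mass_mx M \in unitmx.
  rewrite unitmxE unitfE det_diag prodf_seq_neq0; apply/allP => k _ /=.
  by rewrite mxE gt_eqF// weight_gt0.
have f0 i : ~ D° (vtx i) -> f (vtx i) = 0 by have [_ h _] := Vf; exact: h.
have {}eig k : (stiff_mx M *m u) k ord0 + weight k * (V (node k) * f (node k)) +
    beta * (weight k * f (node k) ^+ 3) = lambda * (weight k * f (node k)).
  have := congr1 (fun A : 'cV_(nb_nodes M) => (mass_mx M *m A) k ord0) eig.
  have e1 : mass_mx M *m (- laplace_mx M *m u) = stiff_mx M *m u.
    by rewrite /laplace_mx opprK !mulmxA mulmxV// mul1mx.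
  rewrite !mulmxDr e1.
  rewrite -!scalemxAr /mass_mx /potential_mx !mul_diag_mx !mxE.
  by rewrite !mulrA => <-.
have e2 : \sum_k u k ord0 * ((stiff_mx M *m u) k ord0 + weight k * (V (node k) * f (node k)) +
    beta * (weight k * f (node k) ^+ 3)) = \sum_k u k ord0 * (lambda * (weight k * f (node k))).
  by apply: eq_bigr => k _; rewrite eig.
rewrite -(stiff_energy Vf) -!sum_weight; last 3 first.
- by move=> i /f0 ->; rewrite expr0n.
- by move=> i /f0 ->; rewrite expr0n.
- by move=> i /f0 ->; rewrite expr0n/= mulr0.
move: e2; rewrite !mulr_sumr -!big_split/= => H; rewrite -/u.
under eq_bigr => k _.
  rewrite (_ : _ + _ = u k ord0 * ((stiff_mx M *m u) k ord0 + weight k * (V (node k) * f (node k)) +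
    beta * (weight k * f (node k) ^+ 3))); last by rewrite mxE; ring.
  over.
rewrite H; apply: eq_bigr => k _; rewrite mxE; ring.
Qed.

End nodal_interpolation.

(** * Taylor estimates and interpolation of test functions *)

Section taylor.
Context {R : realType} {d : nat}.
Local Notation E := 'rV[R]_d.

Lemma is_derive_axis (psi : E -> R) (p : E) j (t : R) : smooth psi ->
  is_derive t (1 : R) (fun s : R => psi (s *: dirv j + p)) (pderiv j psi (t *: dirv j + p)).
Proof.
move=> sp; apply: (@is_derive_section _ _ _ psi (fun s : R => s *: dirv j + p) t (dirv j) 1).
  by move=> h; rewrite addrA -scalerDl; congr (_ *: _ + _); rewrite [_ *: _]mulr1.
by apply: DeriveDef => //; exact: smooth_derivable.
Qed.

Lemma axis_lip (psi : E -> R) (p : E) j (w b : R) : smooth psi ->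
  (forall t, (0 <= t <= b) || (b <= t <= 0) -> `|pderiv j psi (t *: dirv j + p)| <= w) ->
  `|psi (b *: dirv j + p) - psi p| <= w * `|b|.
Proof.
move=> sp h; pose g (s : R) := psi (s *: dirv j + p).
have dg (s : R) : is_derive s (1 : R) g (pderiv j psi (s *: dirv j + p)) by exact: is_derive_axis.
have cg A : {within A, continuous g}.
  apply: continuous_subspaceT => s; have [dgs _] := dg s.
  by apply: differentiable_continuous; exact/derivable1_diffP.
have g0 : psi p = g 0 by rewrite /g scale0r add0r.
rewrite g0 -/(g b); have [b0|b0] := leP 0 b.
  have [s + ->] := @MVT_segment R g (fun s => pderiv j psi (s *: dirv j + p)) 0 b b0 (fun s _ => dg s) (cg _).
  by rewrite in_itv/= => si; rewrite subr0 normrM ler_wpM2r// h// si.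
rewrite distrC.
have [s + ->] := @MVT_segment R g (fun s => pderiv j psi (s *: dirv j + p)) b 0 (ltW b0) (fun s _ => dg s) (cg _).
by rewrite in_itv/= => si; rewrite sub0r normrM normrN ler_wpM2r// h// si orbT.
Qed.

Definition inbox (z : E) (r : R) (x : E) : Prop := forall k, `|x ord0 k - z ord0 k| <= r.

(** One walks from [x] to [y] changing one coordinate at a time; the path stays in the box, and each
    leg is an application of the mean value theorem. *)
Lemma box_lip (psi : E -> R) (z : E) (r w : R) : smooth psi ->
  (forall p, inbox z r p -> forall j, `|pderiv j psi p| <= w) ->
  forall x y, inbox z r x -> inbox z r y ->
  `|psi y - psi x| <= w * \sum_k `|y ord0 k - x ord0 k|.
Proof.
move=> sp h x y xz yz.
pose pth n : E := \row_k (if (k < n)%N then y ord0 k else x ord0 k).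
have p0 : pth 0%N = x by apply/rowP => k; rewrite mxE ltn0.
have pd : pth d = y by apply/rowP => k; rewrite mxE ltn_ord.
have step (n : 'I_d) : pth n.+1 = (y ord0 n - x ord0 n) *: dirv n + pth n.
  apply/rowP => k; rewrite !mxE eqxx/= ltnS leq_eqVlt -(inj_eq val_inj)/=.
  case: eqP => [e|ne]/=; last by rewrite mulr0 add0r.
  by rewrite e ltnn mulr1 (val_inj e) subrK.
rewrite -{1}pd -{1}p0 -(telescope_sumr (fun n => psi (pth n)) (leq0n d)) big_mkord.
apply: le_trans (ler_norm_sum _ _ _) _; rewrite mulr_sumr; apply: ler_sum => n _.
rewrite step; apply: axis_lip => // t ht; apply: h => k; rewrite !mxE eqxx/=.
case: eqP => [->|ne]; last first.
  by rewrite mulr0 add0r; case: ifP => _; [exact: yz|exact: xz].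
rewrite ltnn mulr1; have := xz n; have := yz n; rewrite !ler_norml => /andP[a1 a2] /andP[b1 b2].
case/orP: ht => /andP[t1 t2]; apply/andP; split; lra.
Qed.

Definition gradv (phi : E -> R) (z : E) : E := \row_j pderiv j phi z.

End taylor.

Section interpolation.
Context {R : realType} {d : nat}.
Variable L : R.
Hypotheses (L0 : 0 < L) (d0 : (0 < d)%N).
Local Notation E := 'rV[R]_d.
Local Notation mu := (@lebesgue R d).
Local Notation D := (@cube R d L).
Local Notation Int f := (Rintegral mu D f).
Let mD : measurable D := cube_measurable L.
Let muD : (mu D < +oo)%E := cube_finite L.

(** [box_lip] is used twice: on the first derivatives, which vary by at most a multiple of [r] in
    the box, and then on [phi] minus its linearisation at [z], whose derivatives are exactly those
    variations. *)
Lemma test_taylor (phi : E -> R) : test_function D phi ->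
  exists2 C : R, 0 <= C & forall z (r : R) x y, inbox z r x -> inbox z r y ->
    `|phi y - phi x - dotv (gradv phi z) (y - x)| <=
      C * r * \sum_k `|y ord0 k - x ord0 k|.
Proof.
move=> tp; have sp := test_smooth tp.
have h (q : 'I_d * 'I_d) : exists C : R, 0 <= C /\
    forall x, `|pderiv q.1 (pderiv q.2 phi) x| <= C.
  by have [C C0 hC] := test_bounded (test_pderiv q.1 (test_pderiv q.2 tp)); exists C.
have [C hC] := choice h.
pose C' := \sum_q C q.
have CC q : C q <= C'.
  by rewrite /C' (bigD1 q)//= lerDl; apply: sumr_ge0 => p _; have [] := hC p.
have C'0 : 0 <= C' by apply: sumr_ge0 => q _; have [] := hC q.
exists (C' * d%:R); first by rewrite mulr_ge0.
move=> z r x y xz yz.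
have r0 : 0 <= r.
  have i0 : 'I_d := Ordinal d0.
  exact: le_trans (normr_ge0 _) (xz i0).
pose psi p := phi p - (0 + dotv (gradv phi z) p).
have spsi : smooth psi by apply: (smoothB sp); exact: smooth_affine.
have -> : phi y - phi x - dotv (gradv phi z) (y - x) = psi y - psi x.
  by rewrite /psi dotvBr; ring.
apply: (box_lip (z := z) (r := r)) => // p pz j.
rewrite /psi (pderivB _ _ sp (smooth_affine _ _)) pderiv_affine mxE.
have zz : inbox z r z by move=> k; rewrite subrr normr0.
have := @box_lip _ _ (pderiv j phi) z r C' (smooth_pderiv j sp) _ z p zz pz.
move=> /(_ _)/le_trans; apply.
  by move=> q _ k; apply: le_trans (CC (k, j)); have [_] := hC (k, j); exact.
rewrite -mulrA ler_wpM2l//; apply: (@le_trans _ _ (\sum_(k < d) r)).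
  by apply: ler_sum => k _; exact: pz.
by rewrite sumr_const card_ord -[leLHS]mulr_natl.
Qed.

(** A linear function on a simplex oscillates most between two vertices; the two end points are
    replaced by vertices in turn. *)
Lemma hull_osc (M : mesh D) (K : {set 'I_(nvtx M)}) (q : E) (B : R) :
  (forall i j, i \in K -> j \in K -> `|dotv q (vtx i - vtx j)| <= B) ->
  forall x y, hull (@vtx R d D M) K x -> hull (@vtx R d D M) K y -> `|dotv q (x - y)| <= B.
Proof.
move=> h; have comb (z : E) : (forall i, i \in K -> `|dotv q (vtx i - z)| <= B) ->
    forall x, hull (@vtx R d D M) K x -> `|dotv q (x - z)| <= B.
  move=> hz x [c [c0 c1 cx]].
  rewrite dotvBr addrC (affine_comb (- dotv q z) q c1 cx).
  apply: le_trans (ler_norm_sum _ _ _) _; rewrite -[leRHS]mul1r -c1 mulr_suml.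
  apply: ler_sum => i iK; rewrite normrM ger0_norm// ler_wpM2l// addrC -dotvBr; exact: hz.
move=> x y Kx Ky; apply: (comb y) => // i iK.
by rewrite -normrN -dotvNr opprB; apply: (comb (vtx i)) => // j jK; exact: h.
Qed.

Lemma quad_unif (G : E -> R) (eps : R) : {within D, continuous G} -> 0 < eps ->
  exists2 r : R, 0 < r & forall M : mesh D, mesh_size M < r ->
    `|quad M G - Int G| <= eps.
Proof.
move=> cG eps0; pose v := Int (fun=> 1).
have v0 : 0 <= v by apply: Rintegral_ge0.
have e1 : 0 < eps / (v + 1) by rewrite divr_gt0// ltr_wpDl.
have [r r0 h] := within_unif_continuous (@cube_compact R d L) cG e1.
have [B B0 hB] := within_bounded (@cube_compact R d L) cG.
have iG : intg mu D G.
  exact: (intg_bounded mD muD (within_continuous_measurable_rV mD cG) hB).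
exists r => // M Mr.
have osc (K : {set 'I_(nvtx M)}) x i : K \in simplices M -> hull (@vtx R d D M) K x -> i \in K ->
    `|G x - G (vtx i)| <= eps / (v + 1).
  move=> KS Kx iK; apply/ltW/h.
  - exact: (hull_subD KS Kx).
  - exact: (vtx_D (M := M) i).
  move=> k; apply: le_lt_trans Mr; apply: le_trans (diam_le_size KS).
  apply: le_trans (diam_dist L0 KS Kx (vtx_hullM KS iK)).
  by apply: le_trans (normv_coord _ k); rewrite !mxE.
have vol : \sum_(K in simplices M) eps / (v + 1) * volume K <= eps.
  rewrite -mulr_sumr sum_volume// -/v -mulrA ler_piMr ?(ltW eps0)//.
  by rewrite mulrC ler_pdivrMr ?ltr_wpDl// mul1r lerDl.
have h1 : quad M G <= Int G + eps.
  apply: le_trans (lerD (lexx _) vol); apply: quad_le_Int => // K x i KS Kx iK.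
  by have := osc K x i KS Kx iK; rewrite ler_norml => /andP[]; lra.
have h2 : Int G <= quad M G + eps.
  apply: le_trans (lerD (lexx _) vol); apply: Int_le_quad => // K x i KS Kx iK.
  by have := osc K x i KS Kx iK; rewrite ler_norml => /andP[]; lra.
by rewrite ler_norml; apply/andP; split; lra.
Qed.

Variable sigma : R.
Hypothesis sigma0 : 0 < sigma.

(** The constant gradient on a simplex is compared with that of [phi] at every point of it. Since
    [f] and [phi] agree at the vertices, their difference tested on edges is a second order Taylor
    remainder, and [grad_bound] turns this into an error of order [h]. *)
Lemma interp_grad (phi : E -> R) (eps : R) : test_function D phi -> 0 < eps ->
  exists2 r : R, 0 < r & forall M : mesh D, shape_regular M sigma -> mesh_size M < r ->
    forall f, V0h M f -> (forall i : 'I_(nvtx M), f (vtx i) = phi (vtx i)) ->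
    qdot_grad M f f <= Int (fun x => \sum_j pderiv j phi x ^+ 2) + eps.
Proof.
move=> tp eps0; have [C C0 hC] := test_taylor tp.
have sg j : sq_intg mu D (pderiv j phi) by exact: test_sq (test_pderiv j tp).
have [iA eA] := Int_sum_sq sg.
set A := Int (fun x => \sum_j pderiv j phi x ^+ 2).
have A0 : 0 <= A by rewrite /A eA; apply: sumr_ge0 => j _; exact: Int_sq_ge0.
pose v := Int (fun=> 1).
have v0 : 0 <= v by apply: Rintegral_ge0.
(* Makes the relative error [delta A] at most [eps / 2]; the choice of [r] below does the same for
   the remaining error [W h^2]. *)
pose delta := eps / 2 / (A + 1).
have delta0 : 0 < delta by rewrite !divr_gt0// ltr_wpDl.
have dV : 0 <= delta^-1 by rewrite invr_ge0 ltW.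
pose W := (1 + delta^-1) * (4 * sigma * (C * d%:R)) ^+ 2 * v.
have W0 : 0 <= W by rewrite /W mulr_ge0// mulr_ge0 ?sqr_ge0// addr_ge0.
pose r := Num.min 1 (eps / 2 / (W + 1)).
have r0 : 0 < r by rewrite lt_min ltr01 !divr_gt0// ltr_wpDl.
exists r => // M reg Mr f Vf fv.
set h := mesh_size M in Mr *.
have h0 : 0 <= h := mesh_size_ge0 M.
have h1 : h <= 1 by apply: ltW; apply: lt_le_trans Mr _; rewrite ge_min lexx.
have hW : W * h ^+ 2 <= eps / 2.
  apply: (@le_trans _ _ (W * h)); first by rewrite ler_wpM2l// expr2 ler_piMl.
  have : h * (W + 1) <= eps / 2.
    rewrite -ler_pdivlMr ?ltr_wpDl//; apply: ltW; apply: lt_le_trans Mr _.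
    by rewrite ge_min lexx orbT.
  by apply: le_trans; rewrite mulrDr mulr1 mulrC lerDl.
have gK (K : {set 'I_(nvtx M)}) z : K \in simplices M -> hull (@vtx R d D M) K z ->
    normv (grad_on K f - gradv phi z) <= 4 * sigma * (C * d%:R) * h.
  move=> KS Kz; set q := _ - _.
  have dh : diam (hull (@vtx R d D M) K) <= h by exact: diam_le_size.
  have dd0 : 0 <= diam (hull (@vtx R d D M) K) by exact: (diam_ge0 L0 KS).
  rewrite -mulrA; apply: (grad_bound d0 sigma0 reg KS) => //; first by rewrite !mulr_ge0// ltW.
  apply: hull_osc => i j iK jK.
  have [a fa] := V0h_affine Vf.
  have Ki := vtx_hullM KS iK; have Kj := vtx_hullM KS jK.
  have box k : k \in K -> inbox z (diam (hull (@vtx R d D M) K)) (vtx k).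
    move=> kK l; apply: le_trans (diam_dist L0 KS (vtx_hullM KS kK) Kz).
    by apply: le_trans (normv_coord _ l); rewrite !mxE.
  have -> : dotv q (vtx i - vtx j) = phi (vtx i) - phi (vtx j) - dotv (gradv phi z) (vtx i - vtx j).
    rewrite /q dotvBl -!fv (fa _ KS _ Ki) (fa _ KS _ Kj) !dotvBr; ring.
  apply: le_trans (hC z _ _ _ (box j jK) (box i iK)) _.
  set D' := diam _; rewrite -!mulrA ler_wpM2l//.
  apply: (@le_trans _ _ (D' * \sum_(k < d) D')).
    rewrite ler_wpM2l//; apply: ler_sum => k _.
    apply: le_trans (diam_dist L0 KS Ki Kj).
    by apply: le_trans (normv_coord _ k); rewrite !mxE.
  rewrite sumr_const card_ord -[_ *+ _]mulr_natl mulrCA ler_wpM2l//.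
  by rewrite ler_wpM2r.
pose c := (1 + delta^-1) * (4 * sigma * (C * d%:R) * h) ^+ 2.
have : qdot_grad M f f <= Int (fun x => (1 + delta) * \sum_j pderiv j phi x ^+ 2) +
    \sum_(K in simplices M) c * volume K.
  apply: quad_le_Int => //; first exact: intgZ.
  move=> K x i KS Kx iK; have gx := gK K x KS Kx.
  apply: (@le_trans _ _ ((1 + delta) * \sum_j pderiv j phi x ^+ 2 +
     (1 + delta^-1) * dotv (grad_on K f - gradv phi x) (grad_on K f - gradv phi x))).
    rewrite !dotv_sum_sq !mulr_sumr -big_split/=; apply: ler_sum => j _.
    by apply: sq_young => //; rewrite !mxE.
  rewrite lerD2l /c ler_wpM2l ?addr_ge0// -normv_sq lerXn2r ?nnegrE ?normv_ge0//.
  by rewrite !mulr_ge0// ltW.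
rewrite RintegralZl// -/A -mulr_sumr sum_volume// -/v => /le_trans; apply.
have -> : c * v = W * h ^+ 2 by rewrite /c /W; ring.
have : delta * A <= eps / 2.
  by rewrite /delta mulrAC ler_pdivrMr ?ltr_wpDl// ler_wpM2l ?divr_ge0 ?(ltW eps0)// lerDl.
by rewrite mulrDl mul1r; lra.
Qed.

Lemma interpolation (V phi : E -> R) (eps : R) : {within D, continuous V} ->
  test_function D phi -> 0 < eps ->
  exists2 r : R, 0 < r & forall M : mesh D, shape_regular M sigma -> mesh_size M < r ->
    exists f, [/\ V0h M f, `|quad M (fun x => f x ^+ 2) - Int (fun x => phi x ^+ 2)| <= eps,
      qdot_grad M f f <= Int (fun x => \sum_j pderiv j phi x ^+ 2) + eps,
      quad M (fun x => V x * f x ^+ 2) <= Int (fun x => V x * phi x ^+ 2) + eps &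
      quad M (fun x => f x ^+ 4) <= Int (fun x => phi x ^+ 4) + eps].
Proof.
move=> cV tp eps0.
have cphi : {within D, continuous phi}.
  by apply: continuous_subspaceT; exact: test_continuous tp.
have cX n : {within D, continuous (fun x => phi x ^+ n)}.
  by apply: continuous_subspaceT; apply: smooth_continuous; apply: smoothX; exact: test_smooth tp.
have cVX : {within D, continuous (fun x => V x * phi x ^+ 2)}.
  by move=> x; apply: cvgM; [exact: cV|exact: cX].
have [r1 r10 h1] := quad_unif (cX 2%N) eps0.
have [r2 r20 h2] := quad_unif cVX eps0.
have [r3 r30 h3] := quad_unif (cX 4%N) eps0.
have [r4 r40 h4] := interp_grad tp eps0.
exists (Num.min (Num.min r1 r2) (Num.min r3 r4)); first by rewrite !lt_min r10 r20 r30.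
move=> M reg; rewrite !lt_min => /andP[/andP[k1 k2] /andP[k3 k4]].
have [|f Vf fv] := @nodal_exists _ _ _ M (fun i => phi (vtx i)).
  by move=> i; exact: test_out.
have q (F : E -> R) (P : E -> R -> R) : (forall x, F x = P x (phi x)) ->
    quad M (fun x => P x (f x)) = quad M F.
  by move=> e; apply: quad_eq => i; rewrite e fv.
exists f; split=> //.
- by rewrite (q (fun x => phi x ^+ 2) (fun _ t => t ^+ 2))//; exact: h1.
- exact: h4.
- rewrite (q (fun x => V x * phi x ^+ 2) (fun x t => V x * t ^+ 2))//.
  by have := h2 M k2; rewrite ler_norml => /andP[]; lra.
- rewrite (q (fun x => phi x ^+ 4) (fun _ t => t ^+ 4))//.
  by have := h3 M k3; rewrite ler_norml => /andP[]; lra.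
Qed.

End interpolation.

(** * Quadratic means *)

Section truncation.
Context {R : realType}.
Implicit Types (a b e s t : R).

Definition nrm e a b : R := Num.sqrt ((a ^+ 2 + b ^+ 2) / 2 + e ^+ 2).
(* A bounded smooth approximation of the quadratic mean of [a] and [b]. *)
Definition qmean e a b : R := e^-1 * (1 - (1 + e * (nrm e a b - e))^-1).

Lemma nrm_arg e a b : 0 < e -> 0 < (a ^+ 2 + b ^+ 2) / 2 + e ^+ 2.
Proof. by move=> e0; rewrite ltr_wpDl ?exprn_gt0// divr_ge0// addr_ge0 ?sqr_ge0. Qed.

Lemma nrm_sq e a b : 0 < e -> nrm e a b ^+ 2 = (a ^+ 2 + b ^+ 2) / 2 + e ^+ 2.
Proof. by move=> e0; rewrite sqr_sqrtr// ltW// nrm_arg. Qed.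

Lemma nrm_ge e a b : 0 < e -> e <= nrm e a b.
Proof.
move=> e0; rewrite -[leLHS]ger0_norm ?(ltW e0)// -sqrtr_sqr ler_wsqrtr// lerDr.
by rewrite divr_ge0// addr_ge0 ?sqr_ge0.
Qed.

(** [nrm e a b] is the Euclidean norm of the vector with entries [a / sqrt 2], [b / sqrt 2] and [e],
    hence a contraction; the bound on [m] is Cauchy-Schwarz, proved by Lagrange's identity. *)
Lemma nrm_lip e a b a' b' : 0 < e ->
  (nrm e a b - nrm e a' b') ^+ 2 <= ((a - a') ^+ 2 + (b - b') ^+ 2) / 2.
Proof.
move=> e0; have h := @nrm_sq e a b e0; have h' := @nrm_sq e a' b' e0.
have p0 := le_trans (ltW e0) (@nrm_ge e a b e0); have q0 := le_trans (ltW e0) (@nrm_ge e a' b' e0).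
set p := nrm e a b in h p0 *; set q := nrm e a' b' in h' q0 *.
pose m := (a * a' + b * b') / 2 + e ^+ 2.
have pq : m <= p * q.
  apply: le_trans (ler_norm _) _; rewrite -(ger0_norm (mulr_ge0 p0 q0)).
  rewrite -ler_sqr ?nnegrE// !real_normK ?num_real// exprMn h h' -subr_ge0.
  rewrite (_ : _ - _ = ((a * b' - a' * b) / 2) ^+ 2 +
     e ^+ 2 / 2 * ((a - a') ^+ 2 + (b - b') ^+ 2)); last by rewrite /m; field.
  by rewrite addr_ge0 ?sqr_ge0// mulr_ge0 ?divr_ge0 ?addr_ge0 ?sqr_ge0.
rewrite sqrrB h h' (_ : p * q *+ 2 = 2 * (p * q)); last by rewrite mulr_natl.
by move: pq; rewrite /m; nra.
Qed.

Section bounds.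
Variables (e a b : R).
Hypothesis e0 : 0 < e.
Let s := nrm e a b - e.

Let s0 : 0 <= s.
Proof. by rewrite subr_ge0 nrm_ge. Qed.

Let k1 : 1 <= 1 + e * s.
Proof. by rewrite lerDl mulr_ge0// ltW. Qed.

(** The form used for estimates: [s / (1 + e s)] is at most [s] and at most [1 / e]. The form in the
    definition is the one that is easy to differentiate. *)
Lemma qmeanE : qmean e a b = s / (1 + e * s).
Proof.
have kn : 1 + e * s != 0 by rewrite gt_eqF// (lt_le_trans ltr01 k1).
by rewrite /qmean -/s; field; rewrite kn gt_eqF.
Qed.

Lemma qmean_ge0 : 0 <= qmean e a b.
Proof. by rewrite qmeanE divr_ge0// (le_trans ler01 k1). Qed.

Lemma qmean_le : qmean e a b <= e^-1.
Proof.
by rewrite /qmean ler_piMr ?invr_ge0 ?(ltW e0)// lerBlDr lerDl invr_ge0 (le_trans ler01 k1).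
Qed.

Lemma qmean_sq_le : qmean e a b ^+ 2 <= (a ^+ 2 + b ^+ 2) / 2.
Proof.
have qs : qmean e a b <= s.
  by rewrite qmeanE ler_pdivrMr ?(lt_le_trans ltr01 k1)// ler_peMr.
have : qmean e a b ^+ 2 <= s ^+ 2 by rewrite lerXn2r ?nnegrE ?qmean_ge0.
move/le_trans; apply; have h := @nrm_sq e a b e0; have g := @nrm_ge e a b e0.
have -> : (a ^+ 2 + b ^+ 2) / 2 = nrm e a b ^+ 2 - e ^+ 2 by rewrite h addrK.
rewrite -subr_ge0 (_ : _ - _ = 2 * (e * s)); last by rewrite /s; ring.
by rewrite !mulr_ge0// ltW.
Qed.

End bounds.

(** Both [nrm] and the map [s / (1 + e s)] on [s >= 0] are contractions. *)
Lemma qmean_lip e a b a' b' : 0 < e ->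
  (qmean e a b - qmean e a' b') ^+ 2 <= ((a - a') ^+ 2 + (b - b') ^+ 2) / 2.
Proof.
move=> e0; apply: le_trans (nrm_lip a b a' b' e0); rewrite !qmeanE//.
have sa := @nrm_ge e a b e0; have sb := @nrm_ge e a' b' e0.
set p := nrm e a b in sa *; set q := nrm e a' b' in sb *.
have k1 : 1 <= 1 + e * (p - e) by rewrite lerDl mulr_ge0 ?subr_ge0// ltW.
have k2 : 1 <= 1 + e * (q - e) by rewrite lerDl mulr_ge0 ?subr_ge0// ltW.
have n1 : 1 + e * (p - e) != 0 by rewrite gt_eqF// (lt_le_trans ltr01 k1).
have n2 : 1 + e * (q - e) != 0 by rewrite gt_eqF// (lt_le_trans ltr01 k2).
rewrite (_ : _ - _ = (p - q) * ((1 + e * (p - e)) * (1 + e * (q - e)))^-1); last first.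
  by field; rewrite n1 n2.
rewrite exprMn ler_piMr ?sqr_ge0// exprn_ile1//.
  by rewrite invr_ge0 mulr_ge0 ?(le_trans ler01 k1) ?(le_trans ler01 k2).
rewrite invf_le1; first by rewrite mulr_ege1.
by rewrite mulr_gt0 ?(lt_le_trans ltr01 k1) ?(lt_le_trans ltr01 k2).
Qed.

Lemma qmean00 e : 0 < e -> qmean e 0 0 = 0.
Proof.
move=> e0; have := @qmean_sq_le e 0 0 e0; rewrite expr0n/= addr0 mul0r => h.
by apply/eqP; rewrite -sqrf_eq0; apply/eqP/le_anti; rewrite h sqr_ge0.
Qed.

Lemma qmean_cvg (e_ : nat -> R) a b : (forall n, 0 < e_ n) -> e_ @ \oo --> (0 : R) ->
  qmean (e_ n) a b ^+ 2 @[n --> \oo] --> (a ^+ 2 + b ^+ 2) / 2.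
Proof.
move=> e0 ce; set rho := _ / 2.
have rho0 : 0 <= rho by rewrite divr_ge0// addr_ge0 ?sqr_ge0.
have cn : nrm (e_ n) a b @[n --> \oo] --> Num.sqrt rho.
  apply: (@continuous_cvg _ _ _ _ _ _ (@Num.sqrt R)); first exact: sqrt_continuous.
  rewrite -[X in _ --> X]addr0; apply: cvgD; first exact: cvg_cst.
  by rewrite -(mulr0 (0 : R)); under eq_fun do rewrite expr2; exact: cvgM.
have cs : nrm (e_ n) a b - e_ n @[n --> \oo] --> Num.sqrt rho.
  by rewrite -[X in _ --> X]subr0; exact: cvgB.
have cq : qmean (e_ n) a b @[n --> \oo] --> Num.sqrt rho.
  rewrite (_ : (fun n => _) = fun n => (nrm (e_ n) a b - e_ n) * (1 + e_ n * (nrm (e_ n) a b - e_ n))^-1).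
    rewrite -[X in _ --> X]mulr1 -[X in _ * X]invr1; apply: cvgM => //; apply: cvgV; first exact: oner_neq0.
    rewrite -[X in _ --> X]addr0; apply: cvgD; first exact: cvg_cst.
    by rewrite -(mul0r (Num.sqrt rho)); exact: cvgM.
  by apply/funext => n; rewrite qmeanE.
rewrite -[X in _ --> X](sqr_sqrtr rho0).
by rewrite (_ : (fun n => _) = fun n => qmean (e_ n) a b * qmean (e_ n) a b)//; exact: cvgM.
Qed.

End truncation.

Section smooth_truncation.
Context {R : realType} {d : nat}.
Local Notation E := 'rV[R]_d.
Variables (e : R) (phi psi : E -> R).
Hypotheses (e0 : 0 < e) (sphi : smooth phi) (spsi : smooth psi).

Let rho x : R := (phi x ^+ 2 + psi x ^+ 2) * 2^-1 + e ^+ 2.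
Let srho : smooth rho.
Proof.
apply: (smoothD _ (smooth_cst _)); apply: (smoothM _ (smooth_cst _)).
exact: (smoothD (smoothX 2 sphi) (smoothX 2 spsi)).
Qed.

Let rho0 x : 0 < rho x.
Proof. exact: nrm_arg. Qed.

Let k x : R := 1 + e * (Num.sqrt (rho x) - e).
Let sk : smooth k.
Proof.
apply: (smoothD (smooth_cst _)); apply: smoothZ; apply: (smoothB _ (smooth_cst _)).
exact: smooth_sqrt.
Qed.

Let k1 x : 1 <= k x.
Proof. by rewrite lerDl mulr_ge0 ?(ltW e0)// subr_ge0; exact: nrm_ge. Qed.

Let kn x : k x != 0.
Proof. by rewrite gt_eqF// (lt_le_trans ltr01 (k1 x)). Qed.

Lemma smooth_qmean : smooth (fun x => qmean e (phi x) (psi x)).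
Proof.
apply: smoothZ; apply: (smoothB (smooth_cst _)); exact: (smoothV sk kn).
Qed.

Lemma pderiv_rho i x : pderiv i rho x = phi x * pderiv i phi x + psi x * pderiv i psi x.
Proof.
have s2 := smoothD (smoothX 2 sphi) (smoothX 2 spsi).
rewrite /rho (pderivD _ _ (smoothM s2 (smooth_cst _)) (smooth_cst _)) pderiv_cst addr0.
rewrite (pderivM _ _ s2 (smooth_cst _)) pderiv_cst mulr0 add0r.
rewrite (pderivD _ _ (smoothX 2 sphi) (smoothX 2 spsi)) !pderivX2//.
by field.
Qed.

Lemma pderiv_qmean i x : pderiv i (fun x => qmean e (phi x) (psi x)) x =
  (k x ^+ 2)^-1 * ((2 * Num.sqrt (rho x))^-1 *
    (phi x * pderiv i phi x + psi x * pderiv i psi x)).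
Proof.
have sV := smoothV sk kn; have ss := smooth_sqrt srho rho0.
rewrite /qmean (pderivZ _ _ _ (smoothB (smooth_cst _) sV)).
rewrite (pderivB _ _ (smooth_cst _) sV) pderiv_cst sub0r.
rewrite (@pderiv_comp _ _ (fun y : R => y ^- 1) k _ i x sk (is_derive_invX 1 (kn x))).
rewrite {2}/k (pderivD _ _ (smooth_cst _) (smoothZ _ (smoothB ss (smooth_cst _)))) pderiv_cst add0r.
rewrite (pderivZ _ _ _ (smoothB ss (smooth_cst _))) (pderivB _ _ ss (smooth_cst _)) pderiv_cst subr0.
rewrite pderiv_sqrt// pderiv_rho.
set A := _^-1 * _; set B := k x ^- 2.
by field; rewrite gt_eqF.
Qed.

(** Pointwise convexity of the Dirichlet energy in the density: by Cauchy-Schwarz the derivative of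
    the quadratic mean is at most the quadratic mean of the derivatives, and the truncation only
    multiplies it by [k^-2 <= 1]. *)
Lemma pderiv_qmean_sq i x : pderiv i (fun x => qmean e (phi x) (psi x)) x ^+ 2 <=
  (pderiv i phi x ^+ 2 + pderiv i psi x ^+ 2) / 2.
Proof.
rewrite pderiv_qmean exprMn.
set g := (2 * _)^-1 * _.
have kk : ((k x ^+ 2)^-1) ^+ 2 <= 1.
  rewrite exprn_ile1 ?invr_ge0 ?sqr_ge0// invf_le1 ?exprn_gt0 ?(lt_le_trans ltr01 (k1 x))//.
  exact: exprn_ege1.
apply: (@le_trans _ _ (g ^+ 2)); first by rewrite ler_piMl ?sqr_ge0.
set a := phi x in g *; set b := psi x in g *; set p := pderiv i phi x in g *; set q := pderiv i psi x in g *.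
have r0 := rho0 x.
rewrite /g exprMn exprVn exprMn sqr_sqrtr ?(ltW r0)// mulrC ler_pdivrMr ?mulr_gt0 ?exprn_gt0//.
rewrite -subr_ge0 (_ : _ - _ = (a * q - b * p) ^+ 2 + 2 * e ^+ 2 * (p ^+ 2 + q ^+ 2)); last first.
  by rewrite /rho -/a -/b; field.
have pq : 0 <= p ^+ 2 + q ^+ 2 by rewrite addr_ge0 ?sqr_ge0.
by apply: addr_ge0; [exact: sqr_ge0|apply: mulr_ge0 => //; rewrite mulr_ge0 ?sqr_ge0].
Qed.

End smooth_truncation.

Section L2_limits.
Context {disp : measure_display} {T : measurableType disp} {R : realType}.
Variables (mu : {measure set T -> \bar R}) (D : set T).
Hypotheses (mD : measurable D) (muD : (mu D < +oo)%E).
Local Notation Int f := (Rintegral mu D f).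
Local Notation sq := (sq_intg mu D).

(** On a set of finite measure, L^2 convergence gives L^1 convergence by pairing with the constant
    1. *)
Lemma L2cvg_lip (f_ g_ : nat -> T -> R) (f g : T -> R) (C : R) :
  (forall n, sq (f_ n)) -> sq f -> L2cvg mu D f_ f ->
  (forall n, intg mu D (g_ n)) -> intg mu D g ->
  (forall n x, D x -> `|g_ n x - g x| <= C * `|f_ n x - f x|) ->
  Int (g_ n) @[n --> \oo] --> Int g.
Proof.
move=> sf_ sf cf ig_ ig h.
have sa n : sq (fun x => `|f_ n x - f x|).
  have [m i] := sq_intgB mD (sf_ n) sf; split; first exact: measurableT_comp.
  by apply: (intg_eq mD _ i) => x _; rewrite real_normK ?num_real.
have s1 : sq (fun=> 1 : R) by apply: (sq_intg_bounded mD muD (M := 1)) => // x _; rewrite normr1.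
have c0 : Int (fun x => `|f_ n x - f x| * 1) @[n --> \oo] --> (0 : R).
  apply: (Int_mul_cvg0 mD sa s1); move: cf; rewrite /L2cvg; apply: cvg_trans.
  apply: near_eq_cvg; apply: nearW => n; apply: eq_Rintegral => x _.
  by rewrite real_normK ?num_real.
apply/subr_cvg0/norm_cvg0P.
have cC : C * Int (fun x => `|f_ n x - f x| * 1) @[n --> \oo] --> (0 : R).
  by rewrite -(mulr0 C); exact: cvgMr.
apply: (cvg0_le _ cC) => n; rewrite normr_ge0/= -RintegralB//; last exact: ig_.
have iB := intgB mD (ig_ n) ig.
apply: le_trans (le_normr_Rintegral mD iB) _.
have i1 := sq_intgM mD (sa n) s1.
rewrite -RintegralZl//; apply: Int_le => //; first exact: intg_abs.
  exact: intgZ.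
by move=> x Dx; rewrite mulr1; exact: h.
Qed.

Lemma L2cvg_norm (f_ : nat -> T -> R) (f : T -> R) :
  (forall n, sq (f_ n)) -> sq f -> L2cvg mu D f_ f ->
  Int (fun x => f_ n x ^+ 2) @[n --> \oo] --> Int (fun x => f x ^+ 2).
Proof.
move=> sf_ sf cf.
have sa n : sq (fun x => f_ n x - f x) by exact: sq_intgB.
have c0 : Int (fun x => (f_ n x - f x) * f x) @[n --> \oo] --> (0 : R).
  exact: (Int_mul_cvg0 mD sa sf).
rewrite (_ : (fun n => _) = fun n => Int (fun x => (f_ n x - f x) ^+ 2) +
    2 * Int (fun x => (f_ n x - f x) * f x) + Int (fun x => f x ^+ 2)).
  rewrite -[X in _ --> X]add0r; apply: cvgD; last exact: cvg_cst.
  rewrite -[X in _ --> X]addr0; apply: cvgD => //.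
  by rewrite -(mulr0 2); exact: cvgMr.
apply/funext => n; have [_ i1] := sa n; have [_ i2] := sf.
have i3 := sq_intgM mD (sa n) sf.
rewrite -RintegralZl// -RintegralD//; last exact: intgZ.
rewrite -RintegralD//; last by apply: intgD => //; exact: intgZ.
by apply: eq_Rintegral => x _; ring.
Qed.

End L2_limits.

Lemma qmean_meas {disp : measure_display} {T : measurableType disp} {R : realType}
    (D : set T) (f g : T -> R) (e : R) : 0 < e -> measurable_fun D f ->
  measurable_fun D g -> measurable_fun D (fun x => qmean e (f x) (g x)).
Proof.
move=> e0 mf mg.
(* The absolute value makes [h] continuous on the whole line; it is evaluated at nonnegative
   arguments only. *)
pose h (t : R) := e^-1 * (1 - (1 + e * (Num.sqrt (`|t| + e ^+ 2) - e))^-1).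
have ch : continuous h.
  move=> t; have cs : Num.sqrt (`|s| + e ^+ 2) @[s --> t] --> Num.sqrt (`|t| + e ^+ 2).
    apply: (@continuous_cvg _ _ _ _ _ _ (@Num.sqrt R)); first exact: sqrt_continuous.
    by apply: cvgD; [exact: norm_continuous|exact: cvg_cst].
  apply: cvgMr; apply: cvgB; first exact: cvg_cst.
  apply: cvgV.
    rewrite gt_eqF// ltr_pwDl// mulr_ge0 ?(ltW e0)// subr_ge0.
    by rewrite -[leLHS]ger0_norm ?(ltW e0)// -sqrtr_sqr ler_wsqrtr// lerDr.
  apply: cvgD; first exact: cvg_cst.
  by apply: cvgMr; apply: cvgB => //; exact: cvg_cst.
rewrite (_ : (fun x => _) = h \o (fun x => (f x ^+ 2 + g x ^+ 2) / 2)).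
  apply: measurableT_comp; first exact: continuous_measurable_fun.
  by apply: measurable_funM => //; apply: measurable_funD; exact: measurable_funX.
apply/funext => x; rewrite /h/= /qmean /nrm ger0_norm//.
by rewrite divr_ge0// addr_ge0 ?sqr_ge0.
Qed.

(** * Approximation of quadratic means by test functions *)

Section approximation.
Context {R : realType} {d : nat}.
Variable L : R.
Hypothesis L0 : 0 < L.
Local Notation E := 'rV[R]_d.
Local Notation mu := (@lebesgue R d).
Local Notation D := (@cube R d L).
Local Notation test := (test_function D).
Local Notation Int f := (Rintegral mu D f).
Local Notation sq := (sq_intg mu D).
Implicit Types (f g u v phi psi : E -> R) (G H : 'I_d -> E -> R).
Let mD : measurable D := cube_measurable L.
Let muD : (mu D < +oo)%E := cube_finite L.

Variables (V : E -> R) (B : R).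
Hypotheses (Vc : {within D, continuous V}) (VB : forall x, D x -> 0 <= V x <= B).

Definition dir G : R := Int (fun x => \sum_i G i x ^+ 2).
Definition pot f : R := Int (fun x => V x * f x ^+ 2).
Definition quart f : R := Int (fun x => f x ^+ 4).
Definition L4 f : Prop := intg mu D (fun x => f x ^+ 4).

Lemma V_meas : measurable_fun D V.
Proof. exact: within_continuous_measurable_rV. Qed.

Lemma B_ge0 : 0 <= B.
Proof.
have D00 : D 0 by move=> i; rewrite mxE oppr_le0 (ltW L0).
by have /andP[a b] := VB D00; exact: le_trans a b.
Qed.

Lemma pot_intg f : sq f -> intg mu D (fun x => V x * f x ^+ 2).
Proof.
move=> [mf i2]; apply: (intg_le mD _ _ (intgZ mD B i2)).
  by apply: measurable_funM; [exact: V_meas|exact: measurable_funX].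
move=> x Dx; have /andP[a b] := VB Dx.
by rewrite normrM (ger0_norm (sqr_ge0 _)) ger0_norm// ler_wpM2r ?sqr_ge0.
Qed.

Lemma Vmul_intg f g : sq f -> sq g -> intg mu D (fun x => V x * f x * g x).
Proof.
move=> sf sg; have i := sq_intgM mD sf sg.
apply: (intg_le mD _ _ (intgZ mD B (intg_abs i))).
  by apply: measurable_funM; [apply: measurable_funM; [exact: V_meas|by have [] := sf]|by have [] := sg].
move=> x Dx; have /andP[a b] := VB Dx.
by rewrite -mulrA normrM (ger0_norm a) ler_wpM2r.
Qed.

(* Smooth quadratic means of the two approximating sequences give test
   functions whose Dirichlet energy is at most the mean of the two energies. *)
Lemma mean_approx u v G H (delta : R) : is_grad L u G -> is_grad L v H ->
  L4 u -> L4 v -> 0 < delta ->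
  let rho x := (u x ^+ 2 + v x ^+ 2) / 2 in
  exists w, [/\ test w, `|Int (fun x => w x ^+ 2) - Int rho| <= delta,
    dir (fun i => pderiv i w) <= (dir G + dir H) / 2 + delta,
    pot w <= Int (fun x => V x * rho x) + delta &
    quart w <= Int (fun x => rho x ^+ 2) + delta].
Proof.
move=> [su sG [phi tphi [cphi cG]]] [sv sH [psi tpsi [cpsi cH]]] u4 v4 delta0 rho.
have [mu_ iu] := su; have [mv iv] := sv.
have mrho : measurable_fun D rho.
  by apply: measurable_funM => //; apply: measurable_funD; exact: measurable_funX.
have irho : intg mu D rho.
  apply: (intg_eq mD _ (intgZ mD 2^-1 (intgD mD iu iv))) => x _.
  by rewrite /rho mulrC.
have irho2 : intg mu D (fun x => rho x ^+ 2).
  apply: (intg_le mD _ _ (intgD mD u4 v4)); first exact: measurable_funX.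
  move=> x _; rewrite ger0_norm ?sqr_ge0// /rho.
  rewrite !X4E.
  by have := sqr_ge0 (u x ^+ 2 - v x ^+ 2); have := sqr_ge0 (u x ^+ 2);
    have := sqr_ge0 (v x ^+ 2); nra.
have iVrho : intg mu D (fun x => V x * rho x).
  apply: (intg_eq mD _ (intgZ mD 2^-1 (intgD mD (pot_intg su) (pot_intg sv)))) => x _.
  by rewrite /rho; ring.
have meas_q e : 0 < e -> measurable_fun D (fun x => qmean e (u x) (v x)) by move=> e0; exact: qmean_meas.
have qB e x : 0 < e -> `|qmean e (u x) (v x)| <= e^-1.
  by move=> e0; rewrite ger0_norm ?qmean_ge0// qmean_le.
have sqW e : 0 < e -> sq (fun x => qmean e (u x) (v x)).
  by move=> e0; apply: (sq_intg_bounded mD muD (meas_q e e0) (fun x _ => qB e x e0)).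
have delta2 : 0 < delta / 2 by rewrite divr_gt0.
(* The truncation parameter is fixed before the approximating sequences are used. With [e] fixed all
   means are bounded by [e^-1], so that L^2 convergence suffices for the mass, the potential and the
   quartic term. *)
have [e [e0 he]] : exists e, 0 < e /\ `|Int (fun x => qmean e (u x) (v x) ^+ 2) - Int rho| <= delta / 2.
  pose e_ (n : nat) : R := n.+1%:R^-1.
  have e_0 n : 0 < e_ n by rewrite invr_gt0 ltr0n.
  have [|||||_ cv] := @Int_dct _ _ R mu D mD (fun n x => qmean (e_ n) (u x) (v x) ^+ 2) rho rho.
  - by move=> n; apply: measurable_funX; exact: meas_q.
  - exact: mrho.
  - by apply: aeW => x _; apply: qmean_cvg => //; exact: cvg_harmonic.
  - exact: irho.
  - by move=> n x _; rewrite ger0_norm ?sqr_ge0// qmean_sq_le.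
  have /filter_ex[n hn] : \forall n \near \oo,
      `|Int rho - Int (fun x => qmean (e_ n) (u x) (v x) ^+ 2)| <= delta / 2.
    by have := cv => /cvgrPdist_le/(_ _ delta2).
  by exists (e_ n); rewrite distrC.
pose W x := qmean e (u x) (v x).
pose w_ n x := qmean e (phi n x) (psi n x).
have tw n : test (w_ n).
  apply: (test_comb (tphi n) (tpsi n)).
    by apply: smooth_qmean => //; [exact: test_smooth (tphi n)|exact: test_smooth (tpsi n)].
  by move=> x p0 q0; rewrite /w_ p0 q0 qmean00.
have sw n : sq (w_ n) by exact: test_sq (tw n).
have cW : L2cvg mu D w_ W.
  have c2 : 2^-1 * (Int (fun x => (phi n x - u x) ^+ 2) + Int (fun x => (psi n x - v x) ^+ 2))
      @[n --> \oo] --> (0 : R).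
    by rewrite -(mulr0 2^-1); apply: cvgMr; rewrite -[X in _ --> X]addr0; exact: cvgD.
  apply: (cvg0_le _ c2) => n; rewrite Int_sq_ge0/=.
  have [_ i1] := sq_intgB mD (test_sq (tphi n)) su.
  have [_ i2] := sq_intgB mD (test_sq (tpsi n)) sv.
  rewrite -RintegralD// -RintegralZl//; last exact: intgD.
  have [_ i3] := sq_intgB mD (sw n) (sqW e e0).
  apply: Int_le => //; first by apply: intgZ => //; exact: intgD.
  by move=> x _; rewrite mulrC; exact: qmean_lip.
have wB n x : `|w_ n x| <= e^-1 by rewrite ger0_norm ?qmean_ge0// qmean_le.
have WB x : `|W x| <= e^-1 by exact: qB.
have eV0 : 0 <= e^-1 by rewrite invr_ge0 ltW.
have B0 := B_ge0.
have mW : measurable_fun D W by exact: meas_q.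
have c2 : Int (fun x => w_ n x ^+ 2) @[n --> \oo] --> Int (fun x => W x ^+ 2).
  by apply: L2cvg_norm => //; exact: sqW.
have iV f : sq f -> intg mu D (fun x => V x * f x ^+ 2) by exact: pot_intg.
have cV : pot (w_ n) @[n --> \oo] --> pot W.
  apply: (L2cvg_lip (C := B * (2 * e^-1)) mD muD sw (sqW e e0) cW).
  - by move=> n; exact: iV.
  - exact: iV (sqW e e0).
  move=> n x Dx; have /andP[V0 V1] := VB Dx.
  rewrite -mulrBr normrM ger0_norm// -mulrA ler_pM// subr_sqr normrM mulrC ler_wpM2r//.
  by apply: le_trans (ler_normD _ _) _; rewrite mulr_natl mulr2n lerD.
have i4 f : measurable_fun D f -> (forall x, `|f x| <= e^-1) -> intg mu D (fun x => f x ^+ 4).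
  move=> mf hf; apply: (intg_bounded (M := e^-1 ^+ 4) mD muD); first exact: measurable_funX.
  by move=> x Dx; rewrite normrX lerXn2r ?nnegrE.
have c4 : quart (w_ n) @[n --> \oo] --> quart W.
  apply: (L2cvg_lip (C := 2 * e^-1 ^+ 2 * (2 * e^-1)) mD muD sw (sqW e e0) cW).
  - by move=> n; apply: i4 => //; have [] := sw n.
  - exact: i4.
  move=> n x Dx; have h1 := wB n x; have h2 := WB x.
  rewrite (_ : _ - _ = (w_ n x ^+ 2 + W x ^+ 2) * ((w_ n x + W x) * (w_ n x - W x))); last by ring.
  rewrite !normrM mulrA ler_wpM2r// ler_pM//.
    apply: le_trans (ler_normD _ _) _; rewrite mulr_natl mulr2n !normrX lerD// lerXn2r ?nnegrE//.
  by apply: le_trans (ler_normD _ _) _; rewrite mulr_natl mulr2n lerD.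
(* The derivatives of [w_ n] need not converge: their energy is bounded pointwise by the mean of
   those of [phi n] and [psi n], whose integrals do converge. *)
have cdir : 2^-1 * (dir (fun i => pderiv i (phi n)) + dir (fun i => pderiv i (psi n)))
    @[n --> \oo] --> 2^-1 * (dir G + dir H).
  apply: cvgMr; apply: cvgD; rewrite /dir.
    rewrite (Int_sum_sq sG).2 (_ : (fun n => _) =
      fun n => \sum_i Int (fun x => pderiv i (phi n) x ^+ 2)).
      by apply: cvg_sumr => i; apply: L2cvg_norm => // n; exact: test_sq (test_pderiv i (tphi n)).
    by apply/funext => n; apply: (Int_sum_sq _).2 => i; exact: test_sq (test_pderiv i (tphi n)).
  rewrite (Int_sum_sq sH).2 (_ : (fun n => _) =
    fun n => \sum_i Int (fun x => pderiv i (psi n) x ^+ 2)).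
    by apply: cvg_sumr => i; apply: L2cvg_norm => // n; exact: test_sq (test_pderiv i (tpsi n)).
  by apply/funext => n; apply: (Int_sum_sq _).2 => i; exact: test_sq (test_pderiv i (tpsi n)).
have /filter_ex[n [[h2 hV] [h4 hd]]] : \forall n \near \oo,
    (`|Int (fun x => W x ^+ 2) - Int (fun x => w_ n x ^+ 2)| <= delta / 2 /\
     pot (w_ n) < pot W + delta) /\ (quart (w_ n) < quart W + delta /\
     2^-1 * (dir (fun i => pderiv i (phi n)) + dir (fun i => pderiv i (psi n))) <
      2^-1 * (dir G + dir H) + delta).
  near=> n; split; split; near: n.
  - by have := c2 => /cvgrPdist_le/(_ _ delta2).
  - by apply: (cvgr_lt _ cV); rewrite ltrDl.
  - by apply: (cvgr_lt _ c4); rewrite ltrDl.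
  - by apply: (cvgr_lt _ cdir); rewrite ltrDl.
exists (w_ n); split=> //.
- rewrite distrC in h2; rewrite -(subrK (Int (fun x => W x ^+ 2)) (Int (fun x => w_ n x ^+ 2))) -addrA.
  by apply: le_trans (ler_normD _ _) _; rewrite [leRHS]splitr lerD.
- rewrite mulrC; apply: le_trans (ltW hd); rewrite /dir.
  have sp i : sq (pderiv i (phi n)) by exact: test_sq (test_pderiv i (tphi n)).
  have sq_ i : sq (pderiv i (psi n)) by exact: test_sq (test_pderiv i (tpsi n)).
  have sw_ i : sq (pderiv i (w_ n)) by exact: test_sq (test_pderiv i (tw n)).
  have i1 := (Int_sum_sq sp).1; have i2 := (Int_sum_sq sq_).1.
  rewrite -RintegralD// -RintegralZl//; last exact: intgD.
  apply: Int_le => //; first exact: (Int_sum_sq sw_).1.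
    by apply: intgZ => //; exact: intgD.
  move=> x _; rewrite -big_split mulr_sumr; apply: ler_sum => i _; rewrite mulrC.
  by apply: pderiv_qmean_sq => //; [exact: test_smooth (tphi n)|exact: test_smooth (tpsi n)].
- apply: le_trans (ltW hV) _; rewrite lerD2r; apply: Int_le => //; first exact: iV (sqW e e0).
  move=> x Dx; have /andP[V0 _] := VB Dx.
  by rewrite ler_wpM2l//; exact: qmean_sq_le.
- apply: le_trans (ltW h4) _; rewrite lerD2r; apply: Int_le => //; first exact: i4.
  move=> x _; rewrite X4E.
  rewrite lerXn2r ?nnegrE ?sqr_ge0//; first by rewrite divr_ge0// addr_ge0 ?sqr_ge0.
  exact: qmean_sq_le.
Unshelve. all: by end_near. Qed.

End approximation.

(** * The continuous ground state *)

Lemma gap_arith {R : realType} (a a' X b delta : R) : a * (1 - delta) ^+ 2 <= a' ->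
  a' <= X + (1 + b) * delta -> a * (1 - 2 * delta) <= a * (1 - delta) ^+ 2 ->
  delta * (1 + b + 2 * a) < delta * (2 * (1 + b + 2 * a)) ->
  delta * (2 * (1 + b + 2 * a)) <= a - X -> False.
Proof. by nra. Qed.

Lemma mean_arith {R : realType} (du dv pu pv qu qv s b : R) :
  2^-1 * (du + pu) + b / 4 * qu <=
    2^-1 * ((du + dv) / 2 + (pu + pv) / 2) + b / 4 * ((qu + qv) / 2 - s / 4) ->
  b / 8 * s <= 2^-1 * (dv + pv) + b / 4 * qv - (2^-1 * (du + pu) + b / 4 * qu).
Proof. by lra. Qed.

Lemma mean_arith_delta {R : realType} (dw pw qw dm pm qm b delta : R) :
  dw <= dm + delta -> pw <= pm + delta -> b / 4 * qw <= b / 4 * (qm + delta) ->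
  2^-1 * (dw + pw) + b / 4 * qw <= 2^-1 * (dm + pm) + b / 4 * qm + (1 + b / 4) * delta.
Proof. by lra. Qed.

Section continuous_energy.
Context {R : realType} {d : nat}.
Variable L : R.
Hypothesis L0 : 0 < L.
Local Notation E := 'rV[R]_d.
Local Notation mu := (@lebesgue R d).
Local Notation D := (@cube R d L).
Local Notation test := (test_function D).
Local Notation Int f := (Rintegral mu D f).
Local Notation sq := (sq_intg mu D).
Implicit Types (f g u v phi psi : E -> R) (G H : 'I_d -> E -> R).
Let mD : measurable D := cube_measurable L.
Let muD : (mu D < +oo)%E := cube_finite L.

Variables (V : E -> R) (B beta : R).
Hypotheses (beta0 : 0 < beta) (Vc : {within D, continuous V}).
Hypothesis VB : forall x, D x -> 0 <= V x <= B.
Local Notation quart := (@quart R d L).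
Local Notation pot := (@pot R d L V).
Local Notation L4 := (@L4 R d L).
Local Notation dir := (@dir R d L).

Definition dirichlet f : R := dir (fun i => wderiv D i f).
(** The real-valued counterpart of [energy]. The two agree on [L4] by [energyE]; elsewhere the
    real-valued quartic integral carries no information. *)
Definition en f : R := 2^-1 * (dirichlet f + pot f) + beta / 4 * quart f.

Lemma H01_sq f : H01 D f -> sq f.
Proof. by move=> [[/L2P]]. Qed.

Lemma dirichlet_grad f G : is_grad L f G -> dirichlet f = dir G.
Proof.
move=> fG; have [_ sG _] := fG.
have [_ sW _] := H01_is_grad L0 (is_grad_H01 L0 fG).
rewrite /dirichlet /dir (Int_sum_sq sW).2 (Int_sum_sq sG).2; apply: eq_bigr => i _.
have [m1 _] := sW i; have [m2 _] := sG i.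
apply: Int_ae_eq => //; [exact: measurable_funX|exact: measurable_funX|].
have := wderiv_ae (is_grad_wderiv L0 i fG); apply: filterS => x h Dx.
by rewrite (h Dx).
Qed.

Lemma dirichlet_ge0 f : 0 <= dirichlet f.
Proof. by apply: Rintegral_ge0 => // x _; apply: sumr_ge0 => i _; exact: sqr_ge0. Qed.

Lemma pot_ge0 f : 0 <= pot f.
Proof.
by apply: Rintegral_ge0 => // x Dx; have /andP[? _] := VB Dx; rewrite mulr_ge0 ?sqr_ge0.
Qed.

Lemma quart_ge0 f : 0 <= quart f.
Proof. by apply: Rintegral_ge0 => // x Dx; rewrite X4E sqr_ge0. Qed.

Lemma en_ge0 f : 0 <= en f.
Proof.
by rewrite /en addr_ge0// ?mulr_ge0 ?quart_ge0 ?addr_ge0 ?dirichlet_ge0 ?pot_ge0 ?divr_ge0// ltW.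
Qed.

Lemma Int_EFin f : intg mu D f -> (\int[mu]_(x in D) (f x)%:E)%E = (Int f)%:E.
Proof. by move=> fi; rewrite /Rintegral fineK//; exact: integrable_fin_num. Qed.

Lemma energy_quad f : H01 D f -> (\int[mu]_(x in D)
    (\sum_i (wderiv D i f x) ^+ 2 + V x * (f x) ^+ 2)%:E)%E = (dirichlet f + pot f)%:E.
Proof.
move=> Hf; have [_ sW _] := H01_is_grad L0 Hf; have iW := (Int_sum_sq sW).1.
have iV := pot_intg Vc VB (H01_sq Hf).
rewrite Int_EFin; last exact: intgD.
by rewrite RintegralD.
Qed.

Lemma energyE f : H01 D f -> L4 f -> energy D beta V f = (en f)%:E.
Proof.
move=> Hf f4; rewrite /energy energy_quad// (Int_EFin f4).
by rewrite -!EFinM -EFinD.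
Qed.

(** The quadratic part is always finite on [H01], so an infinite energy can only come from the
    quartic term. *)
Lemma energy_L4 f : H01 D f -> (energy D beta V f < +oo)%E -> L4 f.
Proof.
move=> Hf; rewrite /energy energy_quad//.
have mf4 : measurable_fun D (fun x => f x ^+ 4).
  by apply: measurable_funX; have [] := H01_sq Hf.
move=> h; apply/integrableP; split; first exact: measurableT_comp.
rewrite (eq_integral (fun x => (f x ^+ 4)%:E)); last first.
  by move=> x _; rewrite /= ger0_norm// X4E sqr_ge0.
move: h; set X := (\int[mu]_(x in D) _)%E.
have X0 : (0 <= X)%E by apply: integral_ge0 => x _; rewrite lee_fin X4E sqr_ge0.
case: X X0 => [r| |]//= _; first by move=> _; exact: ltry.
by rewrite gt0_muley ?lte_fin ?divr_gt0// -EFinM addey.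
Qed.

Lemma test_L4 w : test w -> L4 w.
Proof.
move=> tw; have [C C0 hC] := test_bounded tw.
apply: (intg_bounded (M := C ^+ 4) mD muD).
  by apply: measurable_funX; have [] := test_sq tw.
by move=> x Dx; rewrite normrX lerXn2r ?nnegrE.
Qed.

Lemma test_H01 w : test w -> H01 D w.
Proof. by move=> tw; exact: (is_grad_H01 L0 (test_is_grad tw)). Qed.

Section scaling.
Variables (f : E -> R) (k : R).
Hypotheses (Hf : H01 D f) (f4 : L4 f).
Let g x := k * f x.

Lemma H01Z : H01 D g.
Proof. exact: (is_grad_H01 L0 (is_gradZ k (H01_is_grad L0 Hf))). Qed.

Lemma L4Z : L4 g.
Proof.
by apply: (intg_eq mD _ (intgZ mD (k ^+ 4) f4)) => x _; rewrite /g exprMn.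
Qed.

Lemma dirichletZ : dirichlet g = k ^+ 2 * dirichlet f.
Proof.
have fW := H01_is_grad L0 Hf; have [_ sW _] := fW.
rewrite (dirichlet_grad (is_gradZ k fW)) /dirichlet /dir -RintegralZl//; last first.
  exact: (Int_sum_sq sW).1.
by apply: eq_Rintegral => x _; rewrite mulr_sumr; apply: eq_bigr => i _; rewrite exprMn.
Qed.

Lemma potZ : pot g = k ^+ 2 * pot f.
Proof.
rewrite /pot -RintegralZl//; last exact: (pot_intg Vc VB (H01_sq Hf)).
by apply: eq_Rintegral => x _; rewrite /g exprMn mulrCA.
Qed.

Lemma quartZ : quart g = k ^+ 4 * quart f.
Proof. by rewrite /quart -RintegralZl//; apply: eq_Rintegral => x _; rewrite exprMn. Qed.

Lemma massZ : Int (fun x => g x ^+ 2) = k ^+ 2 * Int (fun x => f x ^+ 2).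
Proof.
have [_ i2] := H01_sq Hf.
by rewrite -RintegralZl//; apply: eq_Rintegral => x _; rewrite exprMn.
Qed.

End scaling.

Variables (u : E -> R).
Hypothesis gs : ground_state D beta V u.

Let Hu : H01 D u. Proof. by have [] := gs. Qed.
Let u1 : Int (fun x => u x ^+ 2) = 1. Proof. by have [] := gs. Qed.

(** A test function close to [u], normalised, is a competitor of finite energy; by minimality this
    forces the energy of [u] to be finite. *)
Lemma unit_test : exists w, [/\ H01 D w, L4 w & Int (fun x => w x ^+ 2) = 1].
Proof.
have [su sG [phi tphi [cphi _]]] := H01_is_grad L0 Hu.
have := L2cvg_norm mD (fun n => test_sq (tphi n)) su cphi; rewrite u1 => c1.
have /filter_ex[n n0] : \forall n \near \oo, 0 < Int (fun x => phi n x ^+ 2).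
  by apply: (cvgr_gt _ c1); exact: ltr01.
set m := Int _ in n0.
exists (fun x => (Num.sqrt m)^-1 * phi n x); split.
- exact: H01Z (test_H01 (tphi n)).
- exact: L4Z (test_L4 (tphi n)).
- rewrite massZ; last exact: test_H01 (tphi n).
  by rewrite -/m exprVn sqr_sqrtr ?(ltW n0)// mulVf// gt_eqF.
Qed.

Lemma ground_L4 : L4 u.
Proof.
apply: energy_L4 => //; have [w [Hw w4 w1]] := unit_test.
have [_ _ min _] := gs; apply: le_lt_trans (min w Hw w1) _.
by rewrite energyE// ltry.
Qed.

Lemma ground_min v : H01 D v -> L4 v -> Int (fun x => v x ^+ 2) = 1 -> en u <= en v.
Proof.
move=> Hv v4 v1; have [_ _ min _] := gs; have := min v Hv v1.
by rewrite !energyE ?lee_fin//; exact: ground_L4.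
Qed.

(** Normalising [w] multiplies the quadratic terms by [m^-1] and the quartic term by [m^-2], both at
    most [(1 - delta)^-2]. *)
Lemma ground_min_scaled w (delta : R) : H01 D w -> L4 w -> 0 <= delta < 1 ->
  1 - delta <= Int (fun x => w x ^+ 2) -> en u * (1 - delta) ^+ 2 <= en w.
Proof.
move=> Hw w4 /andP[delta0 delta1]; set m := Int _ => m1.
have p0 : 0 < 1 - delta by rewrite subr_gt0.
have m0 : 0 < m := lt_le_trans p0 m1.
pose k := (Num.sqrt m)^-1.
have k2 : k ^+ 2 = m^-1 by rewrite exprVn sqr_sqrtr// ltW.
have := ground_min (H01Z k Hw) (L4Z k w4) _; rewrite massZ// -/m k2 mulVf ?gt_eqF// => /(_ erefl).
rewrite /en dirichletZ// potZ// quartZ// X4E k2 -mulrDr => h.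
set e0 := _ + _ in h; rewrite -/e0.
have A0 : 0 <= dirichlet w + pot w by rewrite addr_ge0 ?dirichlet_ge0 ?pot_ge0.
have Q0 : 0 <= beta / 4 * quart w by rewrite mulr_ge0 ?quart_ge0// divr_ge0// ltW.
apply: (@le_trans _ _ ((2^-1 * (m^-1 * (dirichlet w + pot w)) + beta / 4 * (m^-1 ^+ 2 * quart w)) * (1 - delta) ^+ 2)).
  by rewrite ler_wpM2r ?sqr_ge0.
have c2 : m^-1 ^+ 2 * (1 - delta) ^+ 2 <= 1.
  by rewrite -exprMn exprn_ile1 ?mulr_ge0 ?invr_ge0 ?(ltW m0) ?(ltW p0)// mulrC ler_pdivrMr// mul1r.
have c1 : m^-1 * (1 - delta) ^+ 2 <= 1.
  rewrite mulrC ler_pdivrMr// mul1r; apply: le_trans m1.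
  by rewrite expr2 ler_piMl ?(ltW p0)// lerBlDr lerDl.
rewrite mulrDl; apply: lerD.
  rewrite (_ : _ * _ = (m^-1 * (1 - delta) ^+ 2) * (2^-1 * (dirichlet w + pot w))); last by ring.
  by rewrite ler_piMl// mulr_ge0.
rewrite (_ : _ * _ = (m^-1 ^+ 2 * (1 - delta) ^+ 2) * (beta / 4 * quart w)); last by ring.
by rewrite ler_piMl.
Qed.

(** The mean of [u] with itself has density [u ^+ 2], so [mean_approx] truncates [u] and
    approximates it by test functions in one go, with control of the quartic term. *)
Lemma almost_minimizer (delta : R) : 0 < delta -> exists w, [/\ test w,
  `|Int (fun x => w x ^+ 2) - 1| <= delta & en w <= en u + delta].
Proof.
move=> delta0; pose eta := delta / (1 + beta / 4).
have b0 : 0 < 1 + beta / 4 by rewrite ltr_wpDr// divr_ge0// ltW.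
have eta0 : 0 < eta by rewrite divr_gt0.
have eta1 : eta <= delta by rewrite ler_pdivrMr// ler_peMr ?(ltW delta0)// lerDl divr_ge0// ltW.
have uG := H01_is_grad L0 Hu; have u4 := ground_L4.
have [w [tw w1 w2 w3 w4]] := mean_approx L0 Vc VB uG uG u4 u4 eta0.
have rhoE x : (u x ^+ 2 + u x ^+ 2) / 2 = u x ^+ 2 by field.
exists w; split=> //.
  apply: le_trans eta1; move: w1.
  by under [X in `|_ - X|]eq_Rintegral do rewrite rhoE; rewrite u1.
have e1 : dir (fun i => pderiv i w) <= dirichlet u + eta.
  by apply: le_trans w2 _; rewrite lerD2r /dirichlet; lra.
have e2 : pot w <= pot u + eta.
  by apply: le_trans w3 _; rewrite lerD2r /pot; under eq_Rintegral do rewrite rhoE.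
have e3 : quart w <= quart u + eta.
  apply: le_trans w4 _; rewrite lerD2r /quart; under eq_Rintegral do rewrite rhoE.
  by under [leRHS]eq_Rintegral do rewrite X4E.
rewrite /en (dirichlet_grad (test_is_grad tw)).
have -> : delta = eta * (1 + beta / 4) by rewrite /eta divfK// gt_eqF.
have : beta / 4 * quart w <= beta / 4 * (quart u + eta) by rewrite ler_wpM2l// divr_ge0// ltW.
by rewrite mulrDr; lra.
Qed.

Section gap.
Variable v : E -> R.
Hypotheses (Hv : H01 D v) (v4 : L4 v) (v1 : Int (fun x => v x ^+ 2) = 1).

Lemma sq_diff_intg : intg mu D (fun x => (u x ^+ 2 - v x ^+ 2) ^+ 2).
Proof.
have [mu' _] := H01_sq Hu; have [mv' _] := H01_sq Hv.
apply: (intg_le mD _ _ (intgD mD (intgZ mD 2 ground_L4) (intgZ mD 2 v4))).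
  by apply: measurable_funX; apply: measurable_funB; exact: measurable_funX.
move=> x _; rewrite ger0_norm ?sqr_ge0// !X4E.
by have := sqr_ge0 (u x ^+ 2 + v x ^+ 2); nra.
Qed.

(* The quadratic mean of [u] and [v] has unit mass, and its energy falls short
   of the mean of the energies by the quartic term. *)
Lemma energy_gap : beta / 8 * Int (fun x => (u x ^+ 2 - v x ^+ 2) ^+ 2) <= en v - en u.
Proof.
have uG := H01_is_grad L0 Hu; have vG := H01_is_grad L0 Hv; have u4 := ground_L4.
have [_ iu] := H01_sq Hu; have [_ iv] := H01_sq Hv.
set S := Int _.
pose rho x := (u x ^+ 2 + v x ^+ 2) / 2.
have rho1 : Int rho = 1.
  rewrite (_ : rho = fun x => 2^-1 * (u x ^+ 2 + v x ^+ 2)); last by apply/funext => x; rewrite mulrC.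
  by rewrite RintegralZl ?RintegralD// ?u1 ?v1; [field|exact: intgD].
have rhoV : Int (fun x => V x * rho x) = (pot u + pot v) / 2.
  have i1 := pot_intg Vc VB (H01_sq Hu); have i2 := pot_intg Vc VB (H01_sq Hv).
  rewrite (_ : (fun x => _) = fun x => 2^-1 * (V x * u x ^+ 2 + V x * v x ^+ 2)).
    by rewrite RintegralZl ?RintegralD//; [rewrite mulrC|exact: intgD].
  by apply/funext => x; rewrite /rho; ring.
have rho2 : Int (fun x => rho x ^+ 2) = (quart u + quart v) / 2 - S / 4.
  have iS := sq_diff_intg.
  rewrite (_ : (fun x => _) = fun x => 2^-1 * (u x ^+ 4 + v x ^+ 4) - 4^-1 * (u x ^+ 2 - v x ^+ 2) ^+ 2).
    rewrite RintegralB//; [|by apply: intgZ => //; exact: intgD|exact: intgZ].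
    rewrite !RintegralZl//; last exact: intgD.
    by rewrite RintegralD// mulrC [4^-1 * _]mulrC.
  by apply/funext => x; rewrite /rho !X4E; field.
(* The bound for the energy of the mean. The mean itself is never shown to lie in [H01];
   approximating test functions are compared with [u] instead, and the argument is by
   contradiction. *)
pose X := 2^-1 * ((dirichlet u + dirichlet v) / 2 + (pot u + pot v) / 2) +
  beta / 4 * ((quart u + quart v) / 2 - S / 4).
suff h : en u <= X by exact: mean_arith h.
rewrite leNgt; apply/negP => Xu.
have eu0 := en_ge0 u.
pose C := 1 + beta / 4 + 2 * en u.
have C0 : 0 < C by rewrite /C !ltr_wpDr ?mulr_ge0 ?divr_ge0// ltW.
(* Small enough for the approximation error [(1 + beta / 4) delta] and the normalisation loss
   [2 delta * en u] together to stay below [en u - X]. *)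
pose delta := Num.min 2^-1 ((en u - X) / (2 * C)).
have delta0 : 0 < delta.
  by rewrite lt_min invr_gt0 ltr0n divr_gt0 ?subr_gt0 ?mulr_gt0.
have delta1 : delta < 1 by rewrite gt_min invf_lt1// ltr1n.
have deltaC : delta * (2 * C) <= en u - X.
  by rewrite -ler_pdivlMr ?mulr_gt0// ge_min lexx orbT.
have [w [tw w1 w2 w3 w4]] := mean_approx L0 Vc VB uG vG u4 v4 delta0.
rewrite -/rho rho1 in w1; rewrite -/rho rhoV in w3; rewrite -/rho rho2 in w4.
have m1 : 1 - delta <= Int (fun x => w x ^+ 2).
  by rewrite lerBlDr addrC -lerBlDr -opprB; have /ler_normlP[] := w1.
have := ground_min_scaled (test_H01 tw) (test_L4 tw) _ m1.
rewrite (ltW delta0) delta1 => /(_ isT) h.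
have h2 : en w <= X + (1 + beta / 4) * delta.
  rewrite /en /X (dirichlet_grad (test_is_grad tw)).
  apply: mean_arith_delta w2 w3 _.
  by rewrite ler_wpM2l// divr_ge0// ltW.
have h3 : en u * (1 - 2 * delta) <= en u * (1 - delta) ^+ 2.
  by rewrite ler_wpM2l// sqrrB expr1n mul1r mulr_natl lerDl sqr_ge0.
have h4 : delta * C < delta * (2 * C) by rewrite ltr_pM2l// ltr_pMl// ltr1n.
exact: (gap_arith h h2 h3 h4 deltaC).
Qed.

End gap.
End continuous_energy.

(** Convexity of the fourth power: its graph at [b] lies above the tangent at [a]. *)
Lemma quartic_young {R : realType} (a b : R) : 4 * a ^+ 3 * b <= 3 * a ^+ 4 + b ^+ 4.
Proof.
rewrite -subr_ge0 (_ : _ - _ = (a ^+ 2 - b ^+ 2) ^+ 2 + 2 * a ^+ 2 * (a - b) ^+ 2); last by ring.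
by rewrite addr_ge0 ?sqr_ge0// mulr_ge0 ?sqr_ge0// mulr_ge0 ?sqr_ge0.
Qed.

Lemma cubic_le {R : realType} (a b : R) : `|a ^+ 3 * b| <= a ^+ 4 + b ^+ 4.
Proof.
have nn (t : R) : `|t| ^+ 4 = t ^+ 4 by rewrite -normrX ger0_norm// X4E sqr_ge0.
have nn0 (t : R) : 0 <= t ^+ 4 by rewrite X4E sqr_ge0.
have := quartic_young `|a| `|b|; rewrite !nn -mulrA -normrX -normrM.
by move: (nn0 a) (nn0 b); move: `|_| (a ^+ 4) (b ^+ 4) => x y z; lra.
Qed.

(** [K], [Ku], [Kv] stand for Dirichlet plus potential energy of [v - u], [u], [v], and [Bu] for the
    bilinear form at [u] and [v]; [qu], [qv], [w3], [muv] are the integrals of [u^4], [v^4], [u^3 v]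
    and [u v]. *)
Lemma stability_arith {R : realType} (K Bu qu qv w3 Ku Kv lam muv b : R) :
  0 < b -> 4 * w3 <= 3 * qu + qv ->
  K = Kv + Ku - 2 * Bu -> Bu + b * w3 = lam * muv -> Ku + b * qu = lam ->
  K <= 2 * (2^-1 * Kv + b / 4 * qv - (2^-1 * Ku + b / 4 * qu)) + lam * (2 - 2 * muv).
Proof.
move=> b0 h -> h1 h2; have : b * (4 * w3) <= b * (3 * qu + qv) by rewrite ler_wpM2l// ltW.
have {h1}-> : Bu = lam * muv - b * w3 by rewrite -h1 addrK.
by lra.
Qed.

(** * Stability of the ground state *)

Section stability.
Context {R : realType} {d : nat}.
Variable L : R.
Hypothesis L0 : 0 < L.
Local Notation E := 'rV[R]_d.
Local Notation mu := (@lebesgue R d).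
Local Notation D := (@cube R d L).
Local Notation Int f := (Rintegral mu D f).
Local Notation sq := (sq_intg mu D).
Implicit Types (f g u v : E -> R).
Let mD : measurable D := cube_measurable L.
Let muD : (mu D < +oo)%E := cube_finite L.

Variables (V : E -> R) (B beta : R).
Hypotheses (beta0 : 0 < beta) (Vc : {within D, continuous V}).
Hypothesis VB : forall x, D x -> 0 <= V x <= B.
Local Notation quart := (@quart R d L).
Local Notation pot := (@pot R d L V).
Local Notation L4 := (@L4 R d L).
Local Notation dirichlet := (@dirichlet R d L).
Local Notation en := (@en R d L V beta).
Variables (u : E -> R) (lambda : R).
Hypotheses (gs : ground_state D beta V u) (eig : eigenpair D beta V u lambda).

Let Hu : H01 D u. Proof. by have [] := gs. Qed.
Let u1 : Int (fun x => u x ^+ 2) = 1. Proof. by have [] := gs. Qed.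
Let u4 : L4 u. Proof. exact: (ground_L4 L0 beta0 Vc VB gs). Qed.
Let su : sq u. Proof. exact: H01_sq. Qed.

Lemma cubic_intg v : sq v -> L4 v -> intg mu D (fun x => u x ^+ 3 * v x).
Proof.
move=> [mv _] v4; have [mu' _] := su.
apply: (intg_le mD _ _ (intgD mD u4 v4)).
  by apply: measurable_funM => //; exact: measurable_funX.
by move=> x _; exact: cubic_le.
Qed.

Definition cross f g : R :=
  Int (fun x => \sum_i wderiv D i f x * wderiv D i g x) + Int (fun x => V x * f x * g x).

Lemma cross_intg f g : H01 D f -> H01 D g ->
  intg mu D (fun x => \sum_i wderiv D i f x * wderiv D i g x).
Proof.
move=> Hf Hg; have [_ sf _] := H01_is_grad L0 Hf; have [_ sg _] := H01_is_grad L0 Hg.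
by apply: (intg_sum mD) => i _; exact: sq_intgM.
Qed.

Lemma eigen_cross v : H01 D v -> L4 v ->
  cross u v + beta * Int (fun x => u x ^+ 3 * v x) = lambda * Int (fun x => u x * v x).
Proof.
move=> Hv v4; rewrite -(eig Hv) /cross.
have i1 := cross_intg Hu Hv; have i2 := Vmul_intg Vc VB su (H01_sq Hv).
have i3 := cubic_intg (H01_sq Hv) v4.
rewrite -RintegralZl// -RintegralD// -RintegralD//; first last.
- exact: intgZ.
- exact: intgD.
by apply: eq_Rintegral => x _; rewrite real_normK ?num_real//; ring.
Qed.

Lemma eigen_self : dirichlet u + pot u + beta * quart u = lambda.
Proof.
have := eigen_cross Hu u4; rewrite (_ : Int (fun x => u x * u x) = 1); last first.
  by rewrite -u1; apply: eq_Rintegral => x _; rewrite expr2.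
rewrite mulr1 => <-; congr (_ + _ + beta * _).
all: by apply: eq_Rintegral => x _; ring.
Qed.

Section competitor.
Variable v : E -> R.
Hypotheses (Hv : H01 D v) (v4 : L4 v) (v1 : Int (fun x => v x ^+ 2) = 1).
Let sv : sq v. Proof. exact: H01_sq. Qed.

Lemma diff_grad : is_grad L (v \- u) (fun i x => wderiv D i v x - wderiv D i u x).
Proof. exact: (is_gradB (H01_is_grad L0 Hv) (H01_is_grad L0 Hu)). Qed.

Lemma diff_energy : dirichlet (v \- u) + pot (v \- u) =
  dirichlet v + pot v + (dirichlet u + pot u) - 2 * cross u v.
Proof.
have [_ sWu _] := H01_is_grad L0 Hu; have [_ sWv _] := H01_is_grad L0 Hv.
have i1 := cross_intg Hu Hv; have i2 := Vmul_intg Vc VB su sv.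
have iu := (Int_sum_sq sWu).1; have iv := (Int_sum_sq sWv).1.
have pu := pot_intg Vc VB su; have pv := pot_intg Vc VB sv.
have e1 : dirichlet (v \- u) = dirichlet v + dirichlet u -
    2 * Int (fun x => \sum_i wderiv D i u x * wderiv D i v x).
  rewrite (dirichlet_grad L0 diff_grad) /dirichlet /dir -RintegralD// -RintegralZl//.
  rewrite -RintegralB//; [|exact: intgD|exact: intgZ].
  apply: eq_Rintegral => x _; rewrite mulr_sumr -big_split/= -sumrB.
  by apply: eq_bigr => i _; ring.
have e2 : pot (v \- u) = pot v + pot u - 2 * Int (fun x => V x * u x * v x).
  rewrite /pot -RintegralD// -RintegralZl//.
  rewrite -RintegralB//; [|exact: intgD|exact: intgZ].
  by apply: eq_Rintegral => x _; rewrite /=; ring.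
rewrite e1 e2 /cross; move: (dirichlet v) (dirichlet u) (pot v) (pot u) => a b c a'.
by move: (Rintegral _ _ _) (Rintegral _ _ _) => s t; ring.
Qed.

Lemma diff_mass : Int (fun x => (v x - u x) ^+ 2) = 2 - 2 * Int (fun x => u x * v x).
Proof.
have [_ iu] := su; have [_ iv] := sv; have iuv := sq_intgM mD su sv.
rewrite (_ : 2 - _ = Int (fun x => v x ^+ 2) + Int (fun x => u x ^+ 2) - 2 * Int (fun x => u x * v x)).
  rewrite -RintegralD// -RintegralZl// -RintegralB//; [|exact: intgD|exact: intgZ].
  by apply: eq_Rintegral => x _; ring.
by rewrite u1 v1.
Qed.

(** The quadratic energy of [v - u] is expanded; its cross term is eliminated by the eigenvalue
    equation tested with [v], and the resulting integral of [u^3 v] is absorbed by convexity of the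
    quartic term. *)
Lemma stability : dirichlet (v \- u) + pot (v \- u) <=
  2 * (en v - en u) + lambda * Int (fun x => (v x - u x) ^+ 2).
Proof.
rewrite diff_mass; apply: (stability_arith beta0 _ diff_energy (eigen_cross Hv v4) eigen_self).
have i3 := cubic_intg sv v4.
rewrite /quart -!RintegralZl// -RintegralD//; last exact: intgZ.
apply: Int_le => //; [exact: intgZ|by apply: intgD => //; exact: intgZ|].
by move=> x _; rewrite mulrA; exact: quartic_young.
Qed.

(** For nonnegative functions [(v - u)^2] is at most [|v - u| (v + u) = |u^2 - v^2|], to which
    Young's inequality is applied on the finite measure space. *)
Lemma mass_diff_le (eta : R) : 0 < eta -> (forall x, D x -> 0 <= v x) ->
  Int (fun x => (v x - u x) ^+ 2) <=
    eta * Int (fun=> 1) + eta^-1 * Int (fun x => (u x ^+ 2 - v x ^+ 2) ^+ 2).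
Proof.
move=> eta0 v0; have [_ _ _ up] := gs.
have [_ i1] := sq_intgB mD sv su.
have i2 := sq_diff_intg L0 beta0 Vc VB gs Hv v4.
have i3 := intg_cst mD muD 1.
rewrite -!RintegralZl// -RintegralD//; [|exact: intgZ|exact: intgZ].
apply: Int_ae_le => //; first by apply: intgD => //; exact: intgZ.
apply: filterS up => x h Dx; have u0 := ltW (h Dx); have {}v0 := v0 x Dx.
have en' : eta != 0 by rewrite gt_eqF.
set y := u x ^+ 2 - v x ^+ 2.
have h1 : (v x - u x) ^+ 2 <= `|y|.
  rewrite /y subr_sqr normrM (ger0_norm (addr_ge0 u0 v0)) -sqrrN opprB.
  rewrite -(real_normK (num_real (u x - v x))) expr2 ler_wpM2l//.
  by apply: le_trans (ler_normB _ _) _; rewrite !ger0_norm.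
apply: le_trans h1 _.
rewrite -subr_ge0 -(real_normK (num_real y)).
rewrite (_ : _ - _ = eta^-1 * ((`|y| - eta / 2) ^+ 2 + 3 / 4 * eta ^+ 2)); last by field.
by rewrite mulr_ge0 ?invr_ge0 ?(ltW eta0)// addr_ge0 ?sqr_ge0// mulr_ge0 ?sqr_ge0.
Qed.

(** With [a = u^2] and [b = v^2], [b^2 - a^2 = (b - a)^2 + 2 a (b - a)], and the last product is
    split by Young's inequality with weight [eta]. *)
Lemma quart_diff_le (eta : R) : 0 < eta ->
  `|quart v - quart u| <= (1 + eta^-1) * Int (fun x => (u x ^+ 2 - v x ^+ 2) ^+ 2) + eta * quart u.
Proof.
move=> eta0; have i2 := sq_diff_intg L0 beta0 Vc VB gs Hv v4.
have i0 : intg mu D (fun x => v x ^+ 4 - u x ^+ 4) by exact: intgB.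
rewrite /quart -RintegralB//; apply: le_trans (le_normr_Rintegral mD i0) _.
rewrite -!RintegralZl// -RintegralD//; [|exact: intgZ|exact: intgZ].
apply: Int_le => //; [exact: intg_abs|by apply: intgD => //; exact: intgZ|].
move=> x _; rewrite !X4E; set a := u x ^+ 2; set b := v x ^+ 2.
have en' : eta != 0 by rewrite gt_eqF.
have h1 : 0 <= eta^-1 by rewrite invr_ge0 ltW.
have p1 : 0 <= eta^-1 * ((b - a) - eta * a) ^+ 2 by rewrite mulr_ge0 ?sqr_ge0.
have p2 : 0 <= eta^-1 * ((b - a) + eta * a) ^+ 2 by rewrite mulr_ge0 ?sqr_ge0.
have q1 : eta^-1 * ((b - a) - eta * a) ^+ 2 = eta^-1 * (a - b) ^+ 2 - 2 * a * (b - a) + eta * a ^+ 2 by field.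
have q2 : eta^-1 * ((b - a) + eta * a) ^+ 2 = eta^-1 * (a - b) ^+ 2 + 2 * a * (b - a) + eta * a ^+ 2 by field.
rewrite q1 in p1; rewrite q2 in p2; clear q1 q2.
have sq0 := sqr_ge0 (a - b).
rewrite ler_norml mulrDl mul1r; apply/andP; split; nra.
Qed.

End competitor.
End stability.

(** * Convergence *)

Section arithmetic.
Context {R : realType}.
Implicit Types a b m e x y C K delta : R.

Lemma scale_arith a b m delta : 0 <= a -> 0 <= b -> 0 <= delta < 1 -> 1 - delta <= m ->
  (m^-1 * a + m^-1 ^+ 2 * b) * (1 - delta) ^+ 2 <= a + b.
Proof.
move=> a0 b0 /andP[delta0 delta1] m1.
have p0 : 0 < 1 - delta by rewrite subr_gt0.
have m0 : 0 < m := lt_le_trans p0 m1.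
have c2 : m^-1 ^+ 2 * (1 - delta) ^+ 2 <= 1.
  by rewrite -exprMn exprn_ile1 ?mulr_ge0 ?invr_ge0 ?(ltW m0) ?(ltW p0)// mulrC ler_pdivrMr// mul1r.
have c1 : m^-1 * (1 - delta) ^+ 2 <= 1.
  rewrite mulrC ler_pdivrMr// mul1r; apply: le_trans m1.
  by rewrite expr2 ler_piMl ?(ltW p0)// lerBlDr lerDl.
rewrite mulrDl; apply: lerD.
  by rewrite mulrAC ler_piMl.
by rewrite mulrAC ler_piMl.
Qed.

(** For [delta <= 1/4] the factor is at least [1/2], which gives the crude bound [x <= 2 (e + C)];
    this makes the loss [2 delta x] of order [delta]. *)
Lemma rescale_arith x e C delta : 0 <= e -> 0 <= C -> 0 < delta -> delta <= 4^-1 ->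
  x * (1 - delta) ^+ 2 <= e + C * delta -> x <= e + (C + 4 * (e + C)) * delta.
Proof.
move=> e0 C0 delta0 delta1 h; have [x0|x0] := leP x 0.
  by apply: le_trans x0 _; rewrite addr_ge0// mulr_ge0 ?(ltW delta0)// addr_ge0// mulr_ge0// addr_ge0.
have h1 : x * (1 - 2 * delta) <= e + C * delta.
  apply: le_trans h; rewrite ler_wpM2l ?(ltW x0)// sqrrB expr1n mul1r mulr_natl lerDl.
  exact: sqr_ge0.
have h2 : x * 2^-1 <= x * (1 - 2 * delta) by rewrite ler_wpM2l ?(ltW x0)//; lra.
have h3 : C * delta <= C * 4^-1 by rewrite ler_wpM2l.
have h4 : x <= 2 * (e + C) by lra.
have h5 : delta * x <= delta * (2 * (e + C)) by rewrite ler_wpM2l// ltW.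
lra.
Qed.

Lemma cube_arith x y K delta : 0 <= y <= K -> 0 < delta <= 1 ->
  x <= (1 + delta) ^+ 3 * y + delta -> x <= y + (7 * K + 1) * delta.
Proof.
move=> /andP[y0 yK] /andP[delta0 delta1] h; apply: le_trans h _.
(* Higher powers of [delta <= 1] are bounded by [delta], and [7 = 3 + 3 + 1]. *)
have c : (1 + delta) ^+ 3 <= 1 + 7 * delta.
  have d2 : delta ^+ 2 <= delta by rewrite expr2 ler_piMl// ltW.
  have d3 : delta ^+ 3 <= delta.
    by apply: le_trans d2; rewrite exprS ler_piMl// sqr_ge0.
  have -> : (1 + delta) ^+ 3 = 1 + 3 * delta + 3 * delta ^+ 2 + delta ^+ 3 by ring.
  lra.
have h1 : (1 + delta) ^+ 3 * y <= (1 + 7 * delta) * y by rewrite ler_wpM2r.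
have h2 : delta * y <= delta * K by rewrite ler_wpM2l// ltW.
lra.
Qed.

Lemma small_delta C eps (delta0 : R) : 0 <= C -> 0 < eps -> 0 < delta0 ->
  exists delta, [/\ 0 < delta, delta <= delta0 & C * delta <= eps].
Proof.
move=> C0 e0 d0; have C1 : 0 < C + 1 by rewrite ltr_wpDl.
exists (Num.min delta0 (eps / (C + 1))); split.
- by rewrite lt_min d0 divr_gt0.
- by rewrite ge_min lexx.
- apply: (@le_trans _ _ (C * (eps / (C + 1)))).
    by rewrite ler_wpM2l// ge_min lexx orbT.
  by rewrite mulrA ler_pdivrMr// mulrC ler_wpM2l ?(ltW e0)// lerDl.
Qed.

End arithmetic.

Section limits.
Context {R : realType} {I : Type} (F : set_system I) {FF : Filter F}.
Implicit Types a b c : I -> R.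

(** An inequality up to an error that tends to zero along [F]. It is transitive and does not
    presuppose that either side converges. *)
Definition lim_le a b : Prop := forall eps : R, 0 < eps -> \forall i \near F, a i <= b i + eps.

Lemma lim_le_trans a b c : lim_le a b -> lim_le b c -> lim_le a c.
Proof.
move=> h1 h2 e e0; have e2 : 0 < e / 2 by rewrite divr_gt0.
apply: filterS2 (h1 _ e2) (h2 _ e2) => i k1 k2; apply: le_trans k1 _.
by rewrite [X in _ <= _ + X]splitr addrA lerD2r.
Qed.

Lemma lim_le_cvg a (l : R) : lim_le a (fun=> l) -> lim_le (fun=> l) a -> a i @[i --> F] --> l.
Proof.
move=> h1 h2; apply/cvgrPdist_le => e e0.
apply: filterS2 (h1 _ e0) (h2 _ e0) => i k1 k2.
by rewrite ler_distl; apply/andP; split; [rewrite lerBlDr|].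
Qed.

Lemma cvg_lim_le a (l : R) : a i @[i --> F] --> l -> lim_le a (fun=> l) /\ lim_le (fun=> l) a.
Proof.
move=> c; split=> e e0; have := c => /cvgrPdist_le/(_ _ e0); apply: filterS => i.
  by rewrite ler_distl lerBlDr => /andP[].
by rewrite ler_distl => /andP[].
Qed.

Lemma cvg0_squeeze a b : (\forall i \near F, 0 <= a i <= b i) ->
  b i @[i --> F] --> (0 : R) -> a i @[i --> F] --> (0 : R).
Proof. by move=> h cb; apply: (squeeze_cvgr h) => //; exact: cvg_cst. Qed.

(** For bounds produced by Young's inequality: [eta] is fixed to make [eta * C] small, after which
    the coefficient of [b] is a constant. *)
Lemma cvg0_eta a b (C : R) : 0 <= C -> b i @[i --> F] --> (0 : R) ->
  (forall eta : R, 0 < eta -> \forall i \near F, 0 <= a i <= eta * C + (1 + eta^-1) * b i) ->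
  a i @[i --> F] --> (0 : R).
Proof.
move=> C0 cb h; apply/cvgr0Pnorm_le => e e0.
have [eta [eta0 _ etaC]] := small_delta C0 (divr_gt0 e0 (ltr0Sn R 1)) ltr01.
have k0 : 0 < 1 + eta^-1 by rewrite addr_gt0// invr_gt0.
have e1 : 0 < e / 2 / (1 + eta^-1) by rewrite !divr_gt0.
have := cb => /cvgr0Pnorm_le/(_ _ e1); apply: filterS2 (h eta eta0) => i /andP[a0 a1] b1.
rewrite ger0_norm//; apply: le_trans a1 _; rewrite [leRHS]splitr.
apply: lerD; first by rewrite mulrC.
by rewrite mulrC -ler_pdivlMr//; exact: le_trans (ler_norm _) b1.
Qed.

End limits.

Section discrete_scaling.
Context {R : realType} {d : nat}.
Variable L : R.
Hypotheses (L0 : 0 < L) (d0 : (0 < d)%N).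
Local Notation E := 'rV[R]_d.
Local Notation D := (@cube R d L).
Variable M : mesh D.
Variables (V : E -> R) (beta : R).
Hypotheses (beta0 : 0 < beta) (V0 : forall x, D x -> 0 <= V x).
Implicit Types f g : E -> R.

Lemma energy_hE f : energy_h M beta V f =
  2^-1 * (qdot_grad M f f + quad M (fun x => V x * f x ^+ 2)) + beta / 4 * quad M (fun x => f x ^+ 4).
Proof.
rewrite /energy_h !qdotE mulrDr; congr (_ + _ * _ + _ * _); apply: quad_eq => i; ring.
Qed.

Lemma qdot_sqE f : qdot M f f = quad M (fun x => f x ^+ 2).
Proof. by rewrite qdotE; apply: quad_eq => i; rewrite expr2. Qed.

Lemma quad_ge0 f : (forall x, D x -> 0 <= f x) -> 0 <= quad M f.
Proof.
move=> h; apply: sumr_ge0 => K KS; rewrite mulr_ge0 ?divr_ge0 ?volume_ge0//.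
by apply: sumr_ge0 => i iK; apply: h; exact: (vtx_D (M := M) i).
Qed.

Lemma quadZ k f : quad M (fun x => k * f x) = k * quad M f.
Proof.
rewrite /quad /quadrature mulr_sumr; apply: eq_bigr => K _.
by rewrite -mulr_sumr mulrCA.
Qed.

Lemma V0hZ k f : V0h M f -> V0h M (fun x => k * f x).
Proof.
move=> [cf of_ af]; split.
- by move=> x; apply: cvgM; [exact: cvg_cst|exact: cf].
- by move=> x /of_ ->; rewrite mulr0.
- move=> K KS; have [g [a h]] := af K KS.
  by exists (k *: g), (k * a) => x Kx; rewrite h// dotvZl mulrDr.
Qed.

Lemma qdot_gradZ k f : V0h M f -> qdot_grad M (fun x => k * f x) (fun x => k * f x) =
  k ^+ 2 * qdot_grad M f f.
Proof.
move=> Vf; rewrite !qdot_gradE mulr_sumr; apply: eq_bigr => K KS.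
have [a fa] := V0h_affine Vf.
rewrite (@grad_onE _ _ _ M K _ (k *: grad_on K f) (k * a K) KS); last first.
  by move=> x Kx; rewrite (fa _ KS _ Kx) dotvZl mulrDr.
by rewrite dotvZr dotvZl; ring.
Qed.

(** The discrete counterpart of [ground_min_scaled], needed because an interpolant has discrete mass
    only close to 1. *)
Lemma ground_h_scaled u f (delta : R) : ground_state_h M beta V u -> V0h M f ->
  0 <= delta < 1 -> 1 - delta <= quad M (fun x => f x ^+ 2) ->
  energy_h M beta V u * (1 - delta) ^+ 2 <=
  2^-1 * (qdot_grad M f f + quad M (fun x => V x * f x ^+ 2)) + beta / 4 * quad M (fun x => f x ^+ 4).
Proof.
move=> [_ _ umin _] Vf hd; set m := quad M _ => m1.
have m0 : 0 < m by apply: lt_le_trans m1; rewrite subr_gt0; case/andP: hd.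
pose k := (Num.sqrt m)^-1.
have k2 : k ^+ 2 = m^-1 by rewrite exprVn sqr_sqrtr// ltW.
have quadX n (w : E -> R) : quad M (fun x => w x * (k * f x) ^+ n) = k ^+ n * quad M (fun x => w x * f x ^+ n).
  by rewrite -quadZ; apply: quad_eq => i; rewrite exprMn mulrCA.
have quad1 n (g : E -> R) : quad M (fun x => g x ^+ n) = quad M (fun x => (fun=> 1) x * g x ^+ n).
  by apply: quad_eq => i; rewrite mul1r.
have kf1 : qdot M (fun x => k * f x) (fun x => k * f x) = 1.
  rewrite qdot_sqE quad1 quadX k2 -(quad1 2%N f) -/m mulVf// gt_eqF//.
have := umin _ (V0hZ k Vf) kf1; rewrite [X in _ <= X]energy_hE qdot_gradZ// quadX quad1 quadX -(quad1 4%N f).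
rewrite X4E k2 -mulrDr => h.
apply: le_trans (ler_wpM2r (sqr_ge0 _) h) _.
have A0 : 0 <= 2^-1 * (qdot_grad M f f + quad M (fun x => V x * f x ^+ 2)).
  rewrite mulr_ge0// addr_ge0 ?qdot_grad_ge0//.
  by apply: quad_ge0 => x Dx; rewrite mulr_ge0 ?sqr_ge0// V0.
have Q0 : 0 <= beta / 4 * quad M (fun x => f x ^+ 4).
  rewrite mulr_ge0 ?divr_ge0 ?(ltW beta0)//.
  by apply: quad_ge0 => x Dx; rewrite X4E sqr_ge0.
by rewrite (mulrCA 2^-1) (mulrCA (beta / 4)); exact: scale_arith.
Qed.

End discrete_scaling.

Section arithmetic.
Context {R : realType}.

Lemma comb_arith (x y a b p q r t : R) : x <= a * p + b * r -> y <= a * q + b * t ->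
  x + y <= a * (p + q) + b * (r + t).
Proof. by move=> h1 h2; rewrite !mulrDr addrACA lerD. Qed.

Lemma eta_arith (a b eta : R) : - (a - b) <= eta / 2 -> - (b - 1) <= eta / 2 -> 1 - eta <= a.
Proof. by lra. Qed.

Lemma interp_arith (e g v q dw pw qw b eta : R) : 0 <= b -> 0 <= eta ->
  2^-1 * (dw + pw) + b * qw <= e + eta / 2 -> g <= dw + eta / 2 -> v <= pw + eta / 2 ->
  b * q <= b * (qw + eta / 2) ->
  2^-1 * (g + v) + b * q <= e + (3 + b) * eta.
Proof. by move=> b0 eta0 *; have := mulr_ge0 b0 eta0; lra. Qed.

Lemma bounds_arith (a b c e : R) : 2^-1 * (a + b) + c <= e + 1 -> 0 <= a -> 0 <= b -> 0 <= c ->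
  [/\ a <= 2 * (e + 1), b <= 2 * (e + 1) & c <= e + 1].
Proof. by move=> *; split; lra. Qed.

Lemma bounds_arith4 (b q e : R) : b / 4 * q <= e + 1 -> b * q <= 2 * (2 * (e + 1)).
Proof. by lra. Qed.

Lemma en_arith (g p q v r b delta eps : R) : p <= v + delta -> b * q <= b * (r + delta) ->
  (1 + b) * delta <= eps -> 0 <= delta ->
  2^-1 * (g + p) + b * q <= 2^-1 * (g + v) + b * r + eps.
Proof. by lra. Qed.

Lemma lower_arith (e x delta eps : R) : 2 * e * delta <= eps -> 0 <= e ->
  e * (1 - delta) ^+ 2 <= x -> e <= x + eps.
Proof.
move=> h1 e0 h2; have : 0 <= e * delta ^+ 2 by rewrite mulr_ge0 ?sqr_ge0.
have -> : e * delta ^+ 2 = e * (1 - delta) ^+ 2 - e + 2 * e * delta by ring.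
by move: h2; set y := e * _; set z := 2 * e * _; rewrite -/z in h1; lra.
Qed.

End arithmetic.

(** * Convergence of the discrete ground states and eigenvalues *)

Section convergence.
Context {R : realType} {d : nat}.
Variable L : R.
Hypotheses (L0 : 0 < L) (d0 : (0 < d)%N) (d3 : (d <= 3)%N).
Local Notation E := 'rV[R]_d.
Local Notation mu := (@lebesgue R d).
Local Notation D := (@cube R d L).
Local Notation Int f := (Rintegral mu D f).
Let mD : measurable D := cube_measurable L.
Let muD : (mu D < +oo)%E := cube_finite L.

Variables (V : E -> R) (B beta : R).
Hypotheses (beta0 : 0 < beta) (Vc : {within D, continuous V}).
Hypothesis VB : forall x, D x -> 0 <= V x <= B.
Local Notation quart := (@quart R d L).
Local Notation pot := (@pot R d L V).
Local Notation L4 := (@L4 R d L).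
Local Notation dirichlet := (@dirichlet R d L).
Local Notation en := (@en R d L V beta).
Variables (u : E -> R) (lambda : R).
Hypotheses (gs : ground_state D beta V u) (eig : eigenpair D beta V u lambda).

Variables (I : Type) (M : I -> mesh D) (sigma : R).
Hypotheses (sigma0 : 0 < sigma) (reg : forall i, shape_regular (M i) sigma).
Variables (uh : I -> E -> R) (lambdah : I -> R).
Hypotheses (gsh : forall i, ground_state_h (M i) beta V (uh i)).
Hypothesis eigh : forall i, eigenpair_h (M i) beta V (uh i) (lambdah i).

Local Notation size i := (mesh_size (M i)).
Local Notation F := (size_to0 (fun i => size i)).

Lemma size_to0_filter : Filter F.
Proof.
apply: filter_from_filter; first by exists 1 => /=.
move=> e1 e2 /= e10 e20; exists (Num.min e1 e2) => /=; first by rewrite lt_min e10.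
by move=> i /=; rewrite lt_min => /andP[].
Qed.
Local Existing Instance size_to0_filter.

Lemma near_size (r : R) : 0 < r -> \forall i \near F, size i < r.
Proof. by move=> r0; exists r. Qed.

Lemma near_size_mul (C eps : R) : 0 <= C -> 0 < eps ->
  \forall i \near F, C * size i <= eps /\ size i <= 1.
Proof.
move=> C0 eps0; have [r [r0 r1 Cr]] := small_delta C0 eps0 ltr01.
apply: filterS (near_size r0) => i hi; split; last exact: le_trans (ltW hi) r1.
by apply: le_trans Cr; rewrite ler_wpM2l// ltW.
Qed.

Local Notation eh i := (energy_h (M i) beta V (uh i)).
Local Notation qV i := (quad (M i) (fun x => V x * uh i x ^+ 2)).
Local Notation q4 i := (quad (M i) (fun x => uh i x ^+ 4)).
Local Notation qg i := (qdot_grad (M i) (uh i) (uh i)).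
Local Notation q2 i := (quad (M i) (fun x => uh i x ^+ 2)).
Local Notation mass i := (Int (fun x => uh i x ^+ 2)).

Let V0 x : D x -> 0 <= V x. Proof. by move=> /VB/andP[]. Qed.

Lemma ground_state_H01 : ground_state D beta V u -> H01 D u.
Proof. by case. Qed.

Lemma uh_V0h i : V0h (M i) (uh i). Proof. by have [] := gsh i. Qed.

Lemma uh_unit i : q2 i = 1.
Proof. by have [_ h _ _] := gsh i; rewrite -qdot_sqE. Qed.

Lemma uh_ge0 i x : D x -> 0 <= uh i x.
Proof.
apply: (V0h_ge0 (uh_V0h i)); apply: (V0h_vtx_ge0 (uh_V0h i)) => k.
by have [_ _ _ h] := gsh i; exact: ltW.
Qed.

Lemma uh_grad i : is_grad L (uh i) (@pgrad _ _ _ (M i) (fun K => grad_on K (uh i))).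
Proof. exact: (V0h_is_grad L0 d0 (uh_V0h i) (@uh_ge0 i)). Qed.

Lemma uh_H01 i : H01 D (uh i).
Proof. exact: (is_grad_H01 L0 (uh_grad i)). Qed.

Lemma uh_L4 i : L4 (uh i).
Proof. exact: (V0h_X4_intg (uh_V0h i)). Qed.

Lemma uh_dirichlet i : dirichlet (uh i) = qg i.
Proof. by rewrite (dirichlet_grad L0 (uh_grad i)); exact: (qdot_grad_Int d0 (M i) (uh i)).2. Qed.

Lemma qV_ge0 i : 0 <= qV i.
Proof. by apply: (quad_ge0 (L := L)) => x Dx; rewrite mulr_ge0 ?sqr_ge0// V0. Qed.

Lemma q4_ge0 i : 0 <= q4 i.
Proof. by apply: (quad_ge0 (L := L)) => x Dx; rewrite X4E sqr_ge0. Qed.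

Lemma qg_ge0 i : 0 <= qg i.
Proof. exact: qdot_grad_ge0. Qed.

Lemma ehE i : eh i = 2^-1 * (qg i + qV i) + beta / 4 * q4 i.
Proof. exact: energy_hE. Qed.

Let b4 : 0 <= beta / 4. Proof. by rewrite divr_ge0// ltW. Qed.

Lemma eh_upper : lim_le F (fun i => eh i) (fun=> en u).
Proof.
move=> eps eps0; have e0 := en_ge0 beta0 VB u.
pose C := 3 + beta / 4.
have C0 : 0 <= C by rewrite addr_ge0.
have C'0 : 0 <= C + 4 * (en u + C) by rewrite addr_ge0// mulr_ge0// addr_ge0.
have q0 : 0 < 4^-1 :> R by rewrite invr_gt0.
have [eta [eta0 eta1 etaC]] := small_delta C'0 eps0 q0.
(* Half of [eta] each for the mass error of the almost minimiser and for that of its interpolant. *)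
pose delta := eta / 2.
have delta0 : 0 < delta by rewrite divr_gt0.
have [w [tw w1 w2]] := almost_minimizer L0 beta0 Vc VB gs delta0.
have [r r0 hr] := interpolation L0 d0 sigma0 Vc tw delta0.
apply: filterS (near_size r0) => i si.
have [f [Vf f1 f2 f3 f4]] := hr (M i) (@reg i) si.
have m1 : 1 - eta <= quad (M i) (fun x => f x ^+ 2).
  move: f1 w1; move: (quad _ _) (Int _) => a b /ler_normlP[h1 _] /ler_normlP[h2 _].
  exact: eta_arith h1 h2.
have heta : 0 <= eta < 1.
  by rewrite (ltW eta0)/=; apply: le_lt_trans eta1 _; rewrite invf_lt1// ltr1n.
have h := ground_h_scaled beta0 V0 (gsh i) Vf heta m1.
have dw := dirichlet_grad L0 (test_is_grad tw).
rewrite -/(dir L (fun j => pderiv j w)) -dw in f2.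
have {}h : eh i * (1 - eta) ^+ 2 <= en u + C * eta.
  apply: le_trans h _; apply: (interp_arith b4 (ltW eta0) w2 f2 f3).
  by rewrite ler_wpM2l.
apply: le_trans (rescale_arith e0 C0 eta0 eta1 h) _.
by rewrite lerD2l.
Qed.

(** An eventual bound for the gradient and for the potential term, since half of each is at most
    [en u + 1]. *)
Definition bnd : R := 2 * (en u + 1).

Lemma bnd_ge0 : 0 <= bnd.
Proof. by rewrite mulr_ge0// addr_ge0// (en_ge0 beta0 VB u). Qed.

Lemma eh_bounds : \forall i \near F, [/\ qg i <= bnd, qV i <= bnd & q4 i <= 2 * bnd / beta].
Proof.
apply: filterS (eh_upper ltr01) => i; rewrite ehE => h.
have h1 := qg_ge0 i; have h2 := qV_ge0 i; have h3 := q4_ge0 i.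
have h4 : 0 <= beta / 4 * q4 i by rewrite mulr_ge0.
move: h h1 h2 h4; rewrite /bnd; move: (qg i) (qV i) (en u) => a b e h h1 h2 h4.
have [k1 k2 k3] := bounds_arith h h1 h2 h4.
by split=> //; rewrite ler_pdivlMr// mulrC; apply: bounds_arith4 k3.
Qed.

(** The factor [(1 + delta)^3] is harmless because [Y] is eventually bounded; the comparisons
    between integrals and quadratures below are all put in this form. *)
Lemma near_cube (X Y C : I -> R) (K : R) : (\forall i \near F, 0 <= Y i <= K) -> 0 <= K ->
  (forall delta : R, 0 < delta <= 1 -> \forall i \near F, X i <= (1 + delta) ^+ 3 * Y i + delta) ->
  lim_le F X Y.
Proof.
move=> hY K0 h eps eps0.
have C0 : 0 <= 7 * K + 1 by rewrite addr_ge0// mulr_ge0.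
have [delta [delta0 delta1 deltaC]] := small_delta C0 eps0 (@ltr01 R).
have dd : 0 < delta <= 1 by rewrite delta0.
apply: filterS2 hY (h delta dd) => i Yi Xi.
by apply: le_trans (cube_arith Yi dd Xi) _; rewrite lerD2l.
Qed.

Lemma cube_ge (delta : R) : 0 < delta -> 1 + delta <= (1 + delta) ^+ 3.
Proof.
by move=> h; rewrite exprS ler_peMr ?addr_ge0 ?(ltW h)// exprn_ege1// lerDl ltW.
Qed.

Lemma dV_ge0 (delta : R) n (C : R) : 0 < delta -> 0 <= C -> 0 <= (1 + delta^-1) ^+ n * C.
Proof. by move=> h C0; rewrite mulr_ge0// exprn_ge0// addr_ge0// invr_ge0 ltW. Qed.

Lemma mass_upper : lim_le F (fun i => mass i) (fun=> 1).
Proof.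
apply: (@near_cube _ _ (fun=> 0) 1) => //; first by apply: nearW => i; rewrite lexx ler01.
move=> delta /andP[delta0 delta1].
have C0 := dV_ge0 1 delta0 bnd_ge0; rewrite expr1 in C0.
apply: filterS2 eh_bounds (near_size_mul C0 delta0) => i [g1 _ _] [s1 s2].
apply: le_trans (Int_sq_le_quad L0 d0 (uh_V0h i) delta0 g1 s2) _.
by rewrite uh_unit !mulr1 lerD// cube_ge.
Qed.

Lemma mass_bound : \forall i \near F, 0 <= mass i <= 2.
Proof.
apply: filterS (mass_upper ltr01) => i h; rewrite Int_sq_ge0/=.
by apply: le_trans h _; rewrite -[leRHS](natrD _ 1 1).
Qed.

Lemma mass_lower : lim_le F (fun=> 1) (fun i => mass i).
Proof.
apply: (@near_cube _ _ (fun=> 0) 2) => //; first exact: mass_bound.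
move=> delta /andP[delta0 delta1].
have C0 := dV_ge0 1 delta0 bnd_ge0; rewrite expr1 in C0.
apply: filterS2 eh_bounds (near_size_mul C0 delta0) => i [g1 _ _] [s1 s2].
have := quad_le_Int_sq L0 d0 (uh_V0h i) delta0 g1 s2; rewrite uh_unit => h.
apply: le_trans h _; rewrite lerD// ler_wpM2r ?Int_sq_ge0//; exact: cube_ge.
Qed.

Lemma mass_cvg : mass i @[i --> F] --> (1 : R).
Proof. by apply: lim_le_cvg; [exact: mass_upper|exact: mass_lower]. Qed.

Lemma pot_upper : lim_le F (fun i => pot (uh i)) (fun i => qV i).
Proof.
apply: (@near_cube _ _ (fun=> 0) bnd); last 1 first.
- move=> delta /andP[delta0 delta1].
  (* The oscillation allowed to [V]: it enters with the factor [1 + delta <= 2] and so contributes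
     at most [delta / 2]. *)
  have eta0 : 0 < delta / 4 by rewrite divr_gt0.
  have delta2 : 0 < delta / 2 by rewrite divr_gt0.
  have [r r0 hr] := within_unif_continuous (@cube_compact R d L) Vc eta0.
  have C0 : 0 <= B * ((1 + delta^-1) * bnd).
    by rewrite mulr_ge0 ?(B_ge0 L0 VB)//; have := dV_ge0 1 delta0 bnd_ge0; rewrite expr1.
  apply: filterS3 eh_bounds (near_size_mul C0 delta2) (near_size r0) => i [g1 _ _] [s1 s2] s3.
  have osc K x j : K \in simplices (M i) -> hull (@vtx _ _ _ (M i)) K x -> j \in K ->
      `|V x - V (@vtx _ _ _ (M i) j)| <= delta / 4.
    move=> KS Kx jK; apply/ltW/hr.
    - exact: (hull_subD KS Kx).
    - exact: (vtx_D (M := M i) j).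
    move=> k; apply: le_lt_trans s3; apply: le_trans (diam_le_size KS).
    apply: le_trans (diam_dist L0 KS Kx (vtx_hullM KS jK)).
    by apply: le_trans (normv_coord _ k); rewrite !mxE.
  apply: le_trans (Int_V_le_quad L0 d0 (uh_V0h i) Vc VB (ltW eta0) osc delta0 g1 s2) _.
  rewrite uh_unit mulr1 -addrA; apply: lerD.
    by rewrite ler_wpM2r ?qV_ge0// cube_ge.
  rewrite [leRHS]splitr; apply: lerD; last by rewrite mulrA.
  by rewrite (_ : delta / 2 = 2 * (delta / 4)) ?ler_wpM2r ?(ltW eta0)//; [rewrite -[leRHS](natrD _ 1 1) lerD2l|field].
- by apply: filterS eh_bounds => i [_ h _]; rewrite qV_ge0.
- exact: bnd_ge0.
Qed.

Let Q := 2 * bnd / beta.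
Let Q0 : 0 <= Q. Proof. by apply: divr_ge0; [apply: mulr_ge0 => //; exact: bnd_ge0|exact: ltW]. Qed.

Let C4 : 0 <= (2 * sigma * d%:R) ^+ d * bnd ^+ 2.
Proof. by rewrite mulr_ge0 ?sqr_ge0// exprn_ge0// !mulr_ge0// ltW. Qed.

Lemma quart_upper : lim_le F (fun i => quart (uh i)) (fun i => q4 i).
Proof.
apply: (@near_cube _ _ (fun=> 0) Q) => //.
  by apply: filterS eh_bounds => i [_ _ h]; rewrite q4_ge0.
move=> delta /andP[delta0 delta1].
have C0 := dV_ge0 3 delta0 C4.
apply: filterS2 eh_bounds (near_size_mul C0 delta0) => i [g1 _ _] [s1 s2].
apply: le_trans (Int_X4_le_quad L0 d0 d3 sigma0 (@reg i) (uh_V0h i) delta0 g1 s2) _.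
by rewrite lerD2l.
Qed.

Lemma quart_bound : \forall i \near F, 0 <= quart (uh i) <= Q + 1.
Proof.
apply: filterS2 eh_bounds (quart_upper ltr01) => i [_ _ h] h1; rewrite quart_ge0/=.
by apply: le_trans h1 _; rewrite lerD2r.
Qed.

Lemma quart_lower : lim_le F (fun i => q4 i) (fun i => quart (uh i)).
Proof.
apply: (@near_cube _ _ (fun=> 0) (Q + 1)); [exact: quart_bound|by rewrite addr_ge0|].
move=> delta /andP[delta0 delta1].
have C0 := dV_ge0 3 delta0 C4.
apply: filterS2 eh_bounds (near_size_mul C0 delta0) => i [g1 _ _] [s1 s2].
apply: le_trans (quad_le_Int_X4 L0 d0 d3 sigma0 (@reg i) (uh_V0h i) delta0 g1 s2) _.
by rewrite lerD2l.
Qed.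

Lemma en_upper : lim_le F (fun i => en (uh i)) (fun i => eh i).
Proof.
move=> eps eps0; pose C := 1 + beta / 4.
have C0 : 0 <= C by rewrite addr_ge0.
have [delta [delta0 _ hC]] := small_delta C0 eps0 ltr01.
apply: filterS2 (pot_upper delta0) (quart_upper delta0) => i h1 h2.
rewrite ehE /en uh_dirichlet; have h3 := ler_wpM2l b4 h2.
exact: en_arith h1 h3 hC (ltW delta0).
Qed.

(** [uh i] competes with [u] only after rescaling, but its mass tends to 1. Combined with [en_upper]
    this bounds the discrete energies from below. *)
Lemma en_lower : lim_le F (fun=> en u) (fun i => en (uh i)).
Proof.
move=> eps eps0; have e0 := en_ge0 beta0 VB u.
have C0 : 0 <= 2 * en u by rewrite mulr_ge0.
have h2 : 0 < 2^-1 :> R by rewrite invr_gt0.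
have [delta [delta0 delta1 hC]] := small_delta C0 eps0 h2.
apply: filterS (mass_lower delta0) => i hm.
have hd : 0 <= delta < 1.
  by rewrite (ltW delta0)/=; apply: le_lt_trans delta1 _; rewrite invf_lt1// ltr1n.
have m1 : 1 - delta <= mass i by rewrite lerBlDr.
exact: lower_arith hC e0 (ground_min_scaled L0 beta0 Vc VB gs (uh_H01 i) (uh_L4 i) hd m1).
Qed.

Lemma eh_cvg : eh i @[i --> F] --> en u.
Proof.
by apply: lim_le_cvg; [exact: eh_upper|exact: lim_le_trans en_lower en_upper].
Qed.

Let k i : R := (Num.sqrt (mass i))^-1.
Let v i : E -> R := fun x => k i * uh i x.

Lemma mass_near (delta : R) : 0 < delta -> \forall i \near F, 1 - delta <= mass i.
Proof. by move=> h; apply: filterS (mass_lower h) => i; rewrite lerBlDr. Qed.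

Lemma mass_gt0 : \forall i \near F, 0 < mass i.
Proof.
have h2 : 0 < 2^-1 :> R by rewrite invr_gt0.
apply: filterS (mass_near h2) => i; apply: lt_le_trans.
by rewrite subr_gt0 invf_lt1// ltr1n.
Qed.

Lemma v_H01 i : H01 D (v i).
Proof. exact: (H01Z L0 (k i) (uh_H01 i)). Qed.

Lemma v_L4 i : L4 (v i).
Proof. exact: L4Z (uh_L4 i). Qed.

Lemma k_sq i : 0 < mass i -> k i ^+ 2 = (mass i)^-1.
Proof. by move=> m0; rewrite exprVn sqr_sqrtr// ltW. Qed.

Lemma v_unit i : 0 < mass i -> Int (fun x => v i x ^+ 2) = 1.
Proof. by move=> m0; rewrite (massZ _ (uh_H01 i)) k_sq// mulVf// gt_eqF. Qed.

Lemma v_ge0 i x : D x -> 0 <= v i x.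
Proof. by move=> Dx; rewrite mulr_ge0 ?uh_ge0// invr_ge0 sqrtr_ge0. Qed.

Lemma en_v_upper : lim_le F (fun i => en (v i)) (fun=> en u).
Proof.
move=> eps eps0; have e0 := en_ge0 beta0 VB u.
have C'0 : 0 <= 1 + 4 * (en u + 1) by rewrite addr_ge0// mulr_ge0// addr_ge0.
have q0 : 0 < 4^-1 :> R by rewrite invr_gt0.
have [delta [delta0 delta1 hC]] := small_delta C'0 eps0 q0.
apply: filterS3 (lim_le_trans en_upper eh_upper delta0) (mass_near delta0) mass_gt0 => i h1 m1 m0.
have hd : 0 <= delta < 1.
  by rewrite (ltW delta0)/=; apply: le_lt_trans delta1 _; rewrite invf_lt1// ltr1n.
have h : en (v i) * (1 - delta) ^+ 2 <= en u + 1 * delta.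
  rewrite mul1r; apply: le_trans h1; rewrite /en (dirichletZ L0 _ (uh_H01 i)).
  rewrite (potZ Vc VB _ (uh_H01 i)) (quartZ _ (uh_L4 i)) X4E (k_sq m0) -mulrDr.
  rewrite (mulrCA 2^-1) (mulrCA (beta / 4)); apply: scale_arith => //.
    by rewrite mulr_ge0// addr_ge0 ?dirichlet_ge0 ?(pot_ge0 VB).
  by rewrite mulr_ge0// quart_ge0.
apply: le_trans (rescale_arith e0 ler01 delta0 delta1 h) _.
by rewrite lerD2l.
Qed.

Let gap i : R := Int (fun x => (u x ^+ 2 - v i x ^+ 2) ^+ 2).

Lemma en_v_cvg : en (v i) - en u @[i --> F] --> (0 : R).
Proof.
apply/subr_cvg0; apply: lim_le_cvg; first exact: en_v_upper.
move=> eps eps0; apply: filterS mass_gt0 => i m0; apply: ler_wpDr; first exact: ltW.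
exact: (ground_min L0 beta0 Vc VB gs (v_H01 i) (v_L4 i) (v_unit m0)).
Qed.

Lemma gap_cvg : gap i @[i --> F] --> (0 : R).
Proof.
have c : (beta / 8)^-1 * (en (v i) - en u) @[i --> F] --> (0 : R).
  by rewrite -(mulr0 (beta / 8)^-1); apply: cvgMr; exact: en_v_cvg.
apply: cvg0_squeeze c; apply: filterS mass_gt0 => i m0; rewrite Int_sq_ge0/=.
have b8 : 0 < beta / 8 by rewrite divr_gt0.
rewrite mulrC ler_pdivlMr// mulrC.
exact: (energy_gap L0 beta0 Vc VB gs (v_H01 i) (v_L4 i) (v_unit m0)).
Qed.

Lemma v_mass_cvg : Int (fun x => (v i x - u x) ^+ 2) @[i --> F] --> (0 : R).
Proof.
apply: (cvg0_eta (C := Int (fun=> 1)) _ gap_cvg); first exact: Rintegral_ge0.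
move=> eta eta0; apply: nearW => i; rewrite Int_sq_ge0/=.
apply: le_trans (mass_diff_le L0 beta0 Vc VB gs (v_H01 i) (v_L4 i) eta0 (@v_ge0 i)) _.
by rewrite lerD2l ler_wpM2r ?Int_sq_ge0// lerDr.
Qed.

Lemma v_dirichlet_cvg : dirichlet (v i \- u) @[i --> F] --> (0 : R).
Proof.
have c : 2 * (en (v i) - en u) + lambda * Int (fun x => (v i x - u x) ^+ 2) @[i --> F] --> (0 : R).
  rewrite [X in _ --> X](_ : 0 = 2 * 0 + lambda * 0); last by rewrite !mulr0 addr0.
  by apply: cvgD; apply: cvgMr; [exact: en_v_cvg|exact: v_mass_cvg].
apply: cvg0_squeeze c; apply: filterS mass_gt0 => i m0; rewrite dirichlet_ge0/=.
apply: le_trans (stability L0 beta0 Vc VB gs eig (v_H01 i) (v_L4 i) (v_unit m0)).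
by rewrite lerDl (pot_ge0 VB).
Qed.

Lemma quart_v_cvg : quart (v i) @[i --> F] --> quart u.
Proof.
apply/subr_cvg0/norm_cvg0P.
apply: (cvg0_eta (C := quart u) (quart_ge0 _ _) gap_cvg) => eta eta0; apply: nearW => i.
rewrite normr_ge0/= [leRHS]addrC.
exact: (quart_diff_le L0 beta0 Vc VB gs (v_H01 i) (v_L4 i) eta0).
Qed.

Lemma quart_uh_cvg : quart (uh i) @[i --> F] --> quart u.
Proof.
have c : mass i ^+ 2 * quart (v i) @[i --> F] --> quart u.
  rewrite -[X in _ --> X]mul1r; apply: cvgM; last exact: quart_v_cvg.
  rewrite (_ : (fun i => _) = fun i => mass i * mass i); last by apply/funext => i; rewrite expr2.
  by rewrite -(mulr1 1); apply: cvgM; exact: mass_cvg.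
apply: cvg_trans c; apply: near_eq_cvg; apply: filterS mass_gt0 => i m0.
by rewrite (quartZ _ (uh_L4 i)) X4E (k_sq m0) mulrA -exprMn mulfV ?gt_eqF// expr1n mul1r.
Qed.

Lemma q4_cvg : q4 i @[i --> F] --> quart u.
Proof.
have [c1 c2] := cvg_lim_le quart_uh_cvg.
apply: lim_le_cvg; first exact: lim_le_trans quart_lower c1.
exact: lim_le_trans c2 quart_upper.
Qed.

Lemma lambdah_cvg : lambdah i @[i --> F] --> lambda.
Proof.
(* Either eigenvalue equation, tested with its own solution, takes this form, the mass being 1 in
   the respective inner product. *)
have lE : lambda = 2 * en u + beta / 2 * quart u.
  by rewrite -(eigen_self L0 beta0 Vc VB gs eig) /en; field.
have lhE i : lambdah i = 2 * eh i + beta / 2 * q4 i.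
  have := eigenvalue_h d0 (uh_V0h i) (@eigh i); rewrite uh_unit mulr1 => <-.
  by rewrite ehE; field.
rewrite lE (_ : lambdah = fun i => 2 * eh i + beta / 2 * q4 i); last exact/funext.
by apply: cvgD; apply: cvgMr; [exact: eh_cvg|exact: q4_cvg].
Qed.

Lemma sum_sq_le (a b x y : R) : (a * x + b * y) ^+ 2 <= 2 * a ^+ 2 * x ^+ 2 + 2 * b ^+ 2 * y ^+ 2.
Proof.
rewrite -subr_ge0 (_ : _ - _ = (a * x - b * y) ^+ 2) ?sqr_ge0//.
by ring.
Qed.

(** With [s] the L^2 norm of [uh i], [uh i - u = s (v i - u) - (1 - s) u], so undoing the
    normalisation costs only a multiple of [(s - 1)^2]. *)
Lemma H1norm_bound i : 0 < mass i -> H1norm D (uh i \- u) ^+ 2 <=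
  2 * mass i * (Int (fun x => (v i x - u x) ^+ 2) + dirichlet (v i \- u)) +
  2 * (Num.sqrt (mass i) - 1) ^+ 2 * (1 + dirichlet u).
Proof.
move=> m0; set s := Num.sqrt (mass i).
have s0 : s != 0 by rewrite gt_eqF// sqrtr_gt0.
have s2 : s ^+ 2 = mass i by rewrite sqr_sqrtr// ltW.
have [su sG _] := H01_is_grad L0 (ground_state_H01 gs).
have vu := is_gradB (H01_is_grad L0 (v_H01 i)) (H01_is_grad L0 (ground_state_H01 gs)).
set G := (fun j x => wderiv D j u x) in sG.
set H := (fun j x => _) in vu.
have [svu sH _] := vu.
have uu := is_gradB (is_gradZ s vu) (is_gradZ (1 - s) (H01_is_grad L0 (ground_state_H01 gs))).
have e : uh i \- u = (fun x => s * (v i \- u) x) \- (fun x => (1 - s) * u x).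
  by apply/funext => x; rewrite /= /v /k -/s; field.
rewrite e (H1norm_grad L0 uu) sqr_sqrtr; last first.
  by apply: addr_ge0; [exact: Int_sq_ge0|apply: sumr_ge0 => j _; exact: Int_sq_ge0].
have key (p q : E -> R) : sq_intg mu D p -> sq_intg mu D q ->
    Int (fun x => (s * p x - (1 - s) * q x) ^+ 2) <=
    2 * s ^+ 2 * Int (fun x => p x ^+ 2) + 2 * (s - 1) ^+ 2 * Int (fun x => q x ^+ 2).
  move=> sp sq; have [_ i1] := sp; have [_ i2] := sq.
  have [_ i3] := sq_intgB mD (sq_intgZ mD s sp) (sq_intgZ mD (1 - s) sq).
  rewrite -!RintegralZl// -RintegralD//; [|exact: intgZ|exact: intgZ].
  apply: Int_le => //; first by apply: intgD => //; exact: intgZ.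
  by move=> x _; rewrite -mulNr opprB; exact: sum_sq_le.
have u1 : Int (fun x => u x ^+ 2) = 1 by have [] := gs.
rewrite -s2 (dirichlet_grad L0 vu) /dirichlet /dir (Int_sum_sq sH).2 (Int_sum_sq sG).2.
apply: comb_arith; first by have := key _ _ svu su; rewrite u1.
by rewrite !mulr_sumr -big_split; apply: ler_sum => j _; exact: key.
Qed.

Lemma H1norm_cvg : H1norm D (uh i \- u) @[i --> F] --> (0 : R).
Proof.
have cs : Num.sqrt (mass i) @[i --> F] --> (1 : R).
  rewrite -sqrtr1; apply: (@continuous_cvg _ _ _ _ _ _ (@Num.sqrt R)); first exact: sqrt_continuous.
  exact: mass_cvg.
have cs0 : Num.sqrt (mass i) - 1 @[i --> F] --> (0 : R).
  by apply/subr_cvg0.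
have c : 2 * mass i * (Int (fun x => (v i x - u x) ^+ 2) + dirichlet (v i \- u)) +
    2 * (Num.sqrt (mass i) - 1) ^+ 2 * (1 + dirichlet u) @[i --> F] --> (0 : R).
  rewrite -[X in _ --> X]addr0; apply: cvgD.
    rewrite -(mulr0 (2 * 1)); apply: cvgM; first by apply: cvgMr; exact: mass_cvg.
    by rewrite -[X in _ --> X]addr0; apply: cvgD; [exact: v_mass_cvg|exact: v_dirichlet_cvg].
  rewrite -(mul0r (1 + dirichlet u)); apply: cvgM; last exact: cvg_cst.
  rewrite -(mulr0 2); apply: cvgMr; rewrite -(mulr0 (0 : R)).
  by rewrite (_ : (fun i => _) = fun i => (Num.sqrt (mass i) - 1) * (Num.sqrt (mass i) - 1)); [exact: cvgM|apply/funext => i; rewrite expr2].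
have c2 : H1norm D (uh i \- u) ^+ 2 @[i --> F] --> (0 : R).
  apply: cvg0_squeeze c; apply: filterS mass_gt0 => i m0.
  by rewrite sqr_ge0/=; exact: H1norm_bound.
have c3 : Num.sqrt (H1norm D (uh i \- u) ^+ 2) @[i --> F] --> Num.sqrt (0 : R).
  by apply: (@continuous_cvg _ _ _ _ _ _ (@Num.sqrt R)); first exact: sqrt_continuous.
rewrite sqrtr0 in c3; apply: cvg_trans c3; apply: near_eq_cvg; apply: nearW => i.
by rewrite sqrtr_sqr ger0_norm// sqrtr_ge0.
Qed.

End convergence.

Theorem theoremE6 (R : realType) (d : nat) (hd : (1 <= d <= 3)%N)
    (L : R) (hL : 0 < L) (beta : R) (hbeta : 0 < beta)
    (V : 'rV[R]_d -> R) (c : R) (hc : 0 < c)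
    (hVc : forall x, cube L x -> c <= V x)
    (hV : C1_closed (cube L) V)
    (u : 'rV[R]_d -> R) (lambda : R)
    (hu : ground_state (cube L) beta V u)
    (hlambda : eigenpair (cube L) beta V u lambda)
    (hu2 : H2 (cube L) u)
    (I : Type) (M : I -> mesh (@cube R d L))
    (sigma : R) (hsigma : 0 < sigma)
    (hreg : forall i, shape_regular (M i) sigma)
    (hmono : (2 <= d)%N -> forall i, monotone_mesh (M i))
    (hirr : forall i (w : 'cV[R]_(nb_nodes (M i))),
        irreducible_mx (linearized_mx beta V w))
    (uh : I -> 'rV[R]_d -> R) (lambdah : I -> R)
    (huh : forall i, ground_state_h (M i) beta V (uh i))
    (hlambdah : forall i, eigenpair_h (M i) beta V (uh i) (lambdah i)) :
  let F := size_to0 (fun i => mesh_size (M i)) in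
  cvg_H01 (cube L) F uh u /\ lambdah i @[i --> F] --> lambda.
Proof.
move=> F; have /andP[d0 d3] := hd; have [Vc _] := hV.
have [B B0 hB] := within_bounded (@cube_compact R d L) Vc.
have VB x : cube L x -> 0 <= V x <= B.
  move=> Dx; rewrite (le_trans (ltW hc) (hVc x Dx))/=.
  exact: le_trans (ler_norm _) (hB x Dx).
split; last exact: (lambdah_cvg hL d0 d3 hbeta Vc VB hu hlambda hsigma hreg huh hlambdah).
split.
- by move=> i; exact: (uh_H01 hL d0 huh i).
- by have [] := hu.
- exact: (H1norm_cvg hL d0 d3 hbeta Vc VB hu hlambda hsigma hreg huh).
Qed.
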